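(* Let $\epsilon\in\{+1,-1\}$, let $\beta>0$, let $F,G$ satisfy the assumptions of the weighted random balls model described in the context (with parameters $\epsilon,\beta,C_\beta$ for $F$ and $\alpha\in(1,2]$, $\sigma>0$, $b\in[-1,1]$, $\tau\in\mathbb{R}$ for $G$), and let $\lambda:(0,\infty)\to(0,\infty)$. Suppose $\lambda(\rho)\rho^\beta\to+\infty$ when $\rho\to 0^{-\epsilon}$, and let $n_1(\rho)=\lambda(\rho)^{1/\alpha}\rho^{\beta/\alpha}$. Then, as $\rho\to 0^{-\epsilon}$, $$ \frac{M_\rho(\cdot)-\mathbb{E}[M_\rho(\cdot)]}{n_1(\rho)}\longrightarrow Z_\alpha(\cdot) $$ in the sense of finite-dimensional distributions on $\mathcal{M}_{\alpha,\beta}$, where $$ Z_\alpha(\mu)=\int_{\mathbb{R}^d\times\mathbb{R}^+}\mu(B(x,r))\,M_\alpha(dr,dx) $$ is a stable integral with respect to the $\alpha$-stable random measure $M_\alpha$ with control measure $\sigma^\alpha C_\beta r^{-1-\beta}\,dr\,dx$ and constant skewness function $b$.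
   Context: Notation. $d\ge 1$ is an integer, $\|\cdot\|$ is the Euclidean norm on $\mathbb{R}^d$, $B(x,r)=\{y\in\mathbb{R}^d:\|y-x\|<r\}$, $\mathbb{R}^+=(0,\infty)$. For real $a$: $\varepsilon(a)=1$ if $a>0$, $-1$ if $a<0$, $0$ if $a=0$. Convention: $0^{+1}=0$, $0^{-1}=+\infty$; so $\rho\to0^{-\epsilon}$ means $\rho\to+\infty$ if $\epsilon=+1$ and $\rho\to0$ if $\epsilon=-1$. Stable laws. $S_\alpha(\sigma,b,\tau)$ is the law with characteristic function $\theta\mapsto\exp\big(-\sigma^\alpha|\theta|^\alpha(1-ib\,\varepsilon(\theta)\tan(\pi\alpha/2))+i\tau\theta\big)$. If $M_\alpha$ is an $\alpha$-stable random measure on a measure space with control measure $m$ and constant skewness $b$, then for $f\in L^\alpha(m)$ the stable integral $\int f\,dM_\alpha$ is well defined, linear in $f$, and has characteristic function $\theta\mapsto\exp\big(-\int|\theta f|^\alpha(1-ib\,\varepsilon(\theta f)\tan(\pi\alpha/2))\,dm\big)$. Radii. $F(dr)=f(r)\,dr$ is an absolutely continuous positive measure on $\mathbb{R}^+$ with $\int_{\mathbb{R}^+}r^d F(dr)<+\infty$ and $f(r)\sim C_\beta r^{-1-\beta}$ as $r\to0^{\epsilon}$, for some constant $C_\beta>0$. (Necessarily $\beta<d$ if $\epsilon=+1$ and $\beta>d$ if $\epsilon=-1$.) Weights. $G$ is a probability measure on $\mathbb{R}$ in the normal domain of attraction of $S_\alpha(\sigma,b,\tau)$, $\alpha\in(1,2]$,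 meaning that its characteristic function satisfies, as $\theta\to0$, $\varphi_G(\theta)=1+i\theta\tau-\sigma^\alpha|\theta|^\alpha(1-ib\,\varepsilon(\theta)\tan(\pi\alpha/2))+o(|\theta|^\alpha)$. Field. $\mathcal{M}$ is the space of signed measures on $\mathbb{R}^d$ with finite total variation. For $\rho>0$, $F_\rho(dr)=f(r/\rho)\,dr/\rho$ is the image of $F$ under $r\mapsto\rho r$, $N_{\lambda(\rho),\rho}$ is a Poisson random measure on $\mathbb{R}^d\times\mathbb{R}^+\times\mathbb{R}$ with intensity $\lambda(\rho)\,dx\,F_\rho(dr)\,G(dm)$, and for $\mu\in\mathcal{M}$ $M_\rho(\mu)=\int_{\mathbb{R}^d\times\mathbb{R}^+\times\mathbb{R}}m\,\mu(B(x,r))\,N_{\lambda(\rho),\rho}(dx,dr,dm)$, a well-defined integrable random variable. Space. $\mathcal{M}_{\alpha,\beta}$ is the set of $\mu\in\mathcal{M}$ for which there exist a finite constant $C$ and $0<p<\beta<q$ with $\int_{\mathbb{R}^d}|\mu(B(x,r))|^\alpha dx\le C\min(r^p,r^q)$ for all $r>0$. Convergence in finite-dimensional distributions on a set of measures means: for all $k$ and all $\mu_1,\dots,\mu_k$ in the set, the random vectors indexed by $(\mu_1,\dots,\mu_k)$ converge in distribution. *)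

(* Defs.v *)
From HB Require Import structures.
From mathcomp Require Import all_boot all_order all_algebra.
From mathcomp Require Import all_classical all_reals all_analysis.
From mathcomp Require Import measurable_realfun complex.

Set Implicit Arguments.
Unset Strict Implicit.
Unset Printing Implicit Defensive.
Import Order.TTheory GRing.Theory Num.Theory.
Import numFieldNormedType.Exports.

Local Open Scope classical_set_scope.
Local Open Scope ring_scope.

(* [d.-tuple R] carries the product sigma-algebra, i.e. the Borel sets of R^d. *)
Notation Rd R d := (d.-tuple (measurableTypeR R)).

Section lebesgue_tuple.
Context {R : realType}.

Definition tuple_cons n (p : measurableTypeR R * Rd R n) : Rd R n.+1 :=
  [tuple of p.1 :: p.2].

Lemma measurable_tuple_cons n : measurable_fun setT (@tuple_cons n).
Proof. exact: measurable_cons. Qed.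

Section step.
Variables (n : nat) (mu : {sigma_finite_measure set (Rd R n) -> \bar R}).

Definition lebesgue_tuple_step : set (Rd R n.+1) -> \bar R :=
  pushforward (lebesgue_measure \x mu)%E (@tuple_cons n).

Let step0 : lebesgue_tuple_step set0 = 0%E.
Proof. by rewrite /lebesgue_tuple_step /pushforward preimage_set0 measure0. Qed.

Let step_ge0 A : (0 <= lebesgue_tuple_step A)%E.
Proof. by rewrite /lebesgue_tuple_step /pushforward measure_ge0. Qed.

Let step_sigma_additive : semi_sigma_additive lebesgue_tuple_step.
Proof.
move=> F mF tF mUF; rewrite /lebesgue_tuple_step /pushforward preimage_bigcup.
have mpre A : measurable A -> measurable (@tuple_cons n @^-1` A).
  by move=> mA; rewrite -[X in measurable X]setTI; exact: measurable_tuple_cons.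
apply: measure_semi_sigma_additive => [i||].
- by apply: mpre; exact: mF.
- apply/trivIsetP => /= i j _ _ ij; rewrite -preimage_setI.
  by move/trivIsetP : tF => /(_ _ _ _ _ ij) ->//; rewrite preimage_set0.
- by rewrite -preimage_bigcup; exact: mpre.
Qed.

HB.instance Definition _ := isMeasure.Build _ _ _ lebesgue_tuple_step
  step0 step_ge0 step_sigma_additive.

Let step_sigma_finite : sigma_finite setT lebesgue_tuple_step.
Proof.
have /sigma_finiteP[F [FT ndF mF]] := sigma_finiteT (@lebesgue_measure R).
have /sigma_finiteP[H [HT ndH mH]] := sigma_finiteT mu.
exists (fun n => [set t | F n (tnth t ord0) /\ H n [tuple of behead t]]).
  apply/esym/seteqP; split => // t _.
  have [i _ Fi] : (\bigcup_i F i) (tnth t ord0) by rewrite -FT.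
  have [j _ Hj] : (\bigcup_i H i) [tuple of behead t] by rewrite -HT.
  exists (maxn i j) => //=; split.
  - by move: Fi; exact/subsetPset/ndF/leq_maxl.
  - by move: Hj; exact/subsetPset/ndH/leq_maxr.
move=> i; have [mFi Fi] := mF i; have [mHi Hi] := mH i; split.
  apply: measurableI.
  - by rewrite -[X in measurable X]setTI; exact: measurable_tnth.
  - by rewrite -[X in measurable X]setTI; exact: measurable_behead.
rewrite /lebesgue_tuple_step /pushforward.
rewrite (_ : _ @^-1` _ = F i `*` H i); last first.
  apply/seteqP; split => -[x t] /= [Fx Ht]; split => //.
  - by move: Ht; congr (H i _); exact: val_inj.
  - by move: Ht; congr (H i _); exact: val_inj.
by rewrite product_measure1E// lte_mul_pinfty// ge0_fin_numE.
Qed.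

HB.instance Definition _ := Measure_isSigmaFinite.Build _ _ _
  lebesgue_tuple_step step_sigma_finite.

End step.

Fixpoint lebesgue_tuple n : {sigma_finite_measure set (Rd R n) -> \bar R} :=
  match n with
  | 0 => \d_([tuple])
  | n.+1 => lebesgue_tuple_step (lebesgue_tuple n)
  end.

End lebesgue_tuple.
Arguments lebesgue_tuple {R} n.

(* 0^(+1) = 0 and 0^(-1) = +oo: [zero_pow e] is the filter of positive reals
   tending to 0 when e = 1, and to +oo when e = -1. *)
Definition zero_pow {R : realType} (e : int) : set_system R :=
  if e == 1 then 0^'+ else +oo.

Definition cexp {R : realType} (z : R[i]) : R[i] :=
  (expR (complex.Re z))%:C%C *
  (cos (complex.Im z) +i* sin (complex.Im z))%C.

Definition charfun d (T : measurableType d) (R : realType)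
    (P : probability T R) (X : T -> R) (theta : R) : R[i] :=
  (\int[P]_w cos (theta * X w) +i* \int[P]_w sin (theta * X w))%C.

Section stable_laws.
Context {R : realType}.
Implicit Types alpha sigma b tau theta : R.

(* sigma^alpha |theta|^alpha (1 - i b eps(theta) tan(pi alpha / 2)) *)
Definition stable_exponent alpha sigma b theta : R[i] :=
  (sigma `^ alpha * `|theta| `^ alpha)%:C%C *
  (1 - 'i%C * (b * Num.sg theta * tan (pi * alpha / 2))%:C%C).

Definition stable_cf alpha sigma b tau theta : R[i] :=
  cexp (- stable_exponent alpha sigma b theta + 'i%C * (tau * theta)%:C%C).

(* X has law S_alpha(sigma, b, tau) *)
Definition has_stable_law d (T : measurableType d) (P : probability T R)
    (X : T -> R) alpha sigma b tau :=
  forall theta, charfun P X theta = stable_cf alpha sigma b tau theta.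

Definition normal_domain_of_attraction alpha sigma b tau
    (G : probability (measurableTypeR R) R) :=
  ComplexField.Normc.normc (charfun G id theta -
         (1 + 'i%C * (theta * tau)%:C%C - stable_exponent alpha sigma b theta))
    / `|theta| `^ alpha @[theta --> 0^'] --> (0 : R).

End stable_laws.

(* Independence of X_0, ..., X_(k-1); subfamilies are covered by taking some of
   the sets B i to be the whole space. *)
Definition mutually_independent d (T : measurableType d) d' (T' : measurableType d')
    (R : realType) (P : probability T R) k (X : 'I_k -> T -> T') :=
  forall B : 'I_k -> set T', (forall i, measurable (B i)) ->
    P (\bigcap_(i in setT) X i @^-1` B i) =
    (\prod_(i < k) fine (P (X i @^-1` B i)))%:E.

Definition cvg_in_probability d (T : measurableType d) (R : realType)
    (P : probability T R) (X : nat -> T -> R) (Y : T -> R) :=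
  forall e : R, 0 < e -> P [set w | e <= `|X n w - Y w|] @[n --> \oo] --> 0%E.

Section poisson_random_measures.
Context d (T : measurableType d) d' (E : measurableType d') (R : realType).
Variable P : probability T R.

(* The Poisson law of mean m, carried by {+oo} when m = +oo.  The library's
   [poisson_pmf] equals 1 at every n when the rate is 0, hence the formula. *)
Definition has_poisson_law (X : T -> \bar R) (m : \bar R) :=
  if m == +oo%E then P [set w | X w = +oo%E] = 1%E
  else forall n : nat, P [set w | X w = n%:R%:E] =
         (expR (- fine m) * fine m ^+ n / n`!%:R)%:E.

Definition poisson_random_measure (N : R.-ker T ~> E) (nu : set E -> \bar R) :=
  (forall A, measurable A -> has_poisson_law (fun w => N w A) (nu A)) /\
  (forall k (A : 'I_k -> set E), (forall i, measurable (A i)) ->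
    trivIset setT A -> mutually_independent P (fun i w => N w (A i))).

End poisson_random_measures.

Section stable_random_measures.
Context d (T : measurableType d) d' (E : measurableType d') (R : realType).
Variables (P : probability T R) (alpha : R) (m : set E -> \bar R).

Import HBSimple.

Definition finite_sets : set (set E) :=
  [set A | measurable A /\ (m A < +oo)%E].

(* alpha-stable random measure with control measure m and constant skewness b:
   an independently scattered, sigma-additive map on the sets of finite
   m-measure, with M(A) of law S_alpha(m(A)^(1/alpha), b, 0). *)
Record stable_random_measure (b : R) (M : set E -> T -> R) : Prop := {
  srm_measurable : forall A, finite_sets A -> measurable_fun setT (M A) ;
  srm_law : forall A, finite_sets A ->
    has_stable_law P (M A) alpha (fine (m A) `^ alpha^-1) b 0 ;
  srm_independent : forall k (A : 'I_k -> set E),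
    (forall i, finite_sets (A i)) -> trivIset setT A ->
    mutually_independent P (fun i => M (A i)) ;
  srm_sigma_additive : forall A : nat -> set E,
    (forall n, finite_sets (A n)) -> trivIset setT A ->
    finite_sets (\bigcup_n A n) ->
    {ae P, forall w, series (fun n => M (A n) w) @ \oo --> M (\bigcup_n A n) w}
}.

Definition Lalpha : set (E -> R) :=
  [set f : E -> R | measurable_fun setT f /\
           (\int[m]_z (`|f z| `^ alpha)%:E < +oo)%E].

Definition simple_stable_integral (M : set E -> T -> R) (s : {sfun E >-> R})
    (w : T) : R :=
  \sum_(y \in range s) y * M (s @^-1` [set y]) w.

(* I is the stable integral f |-> \int f dM on L^alpha(m): I f is the limit in
   probability of the integrals of simple functions converging to f in
   L^alpha(m). *)
Definition stable_integral (M : set E -> T -> R) (I : (E -> R) -> T -> R) :=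
  forall f, Lalpha f -> measurable_fun setT (I f) /\
    exists s : nat -> {sfun E >-> R},
      [/\ forall n, Lalpha (s n),
          (\int[m]_z (`|s n z - f z| `^ alpha)%:E)%E @[n --> \oo] --> 0%E &
          cvg_in_probability P (fun n => simple_stable_integral M (s n)) (I f)].

End stable_random_measures.

Section convergence_in_distribution.
Context (R : realType) (J : Type) (d : measure_display)
  (T : J -> measurableType d) (P : forall j, probability (T j) R)
  (d' : measure_display) (T' : measurableType d') (P' : probability T' R).

Definition cvg_in_distribution (F : set_system J) k
    (X : forall j, T j -> 'rV[R]_k) (Y : T' -> 'rV[R]_k) :=
  forall g : 'rV[R]_k -> R, continuous g -> (exists C, forall x, `|g x| <= C) ->
    \int[P j]_w g (X j w) @[j --> F] --> \int[P']_w g (Y w).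

(* Finite-dimensional convergence of random fields indexed by the elements of
   S. *)
Definition fdd_cvg (F : set_system J) (V : Type) (S : set V)
    (X : forall j, V -> T j -> R) (Y : V -> T' -> R) :=
  forall k (v : 'I_k -> V), (forall i, S (v i)) ->
    cvg_in_distribution F (fun j w => \row_i X j (v i) w)
                          (fun w => \row_i Y (v i) w).

End convergence_in_distribution.

Section random_balls.
Context {R : realType} (d : nat).
Implicit Types (mu : {charge set (Rd R d) -> \bar R}) (f : R -> R).

Definition eball (x : Rd R d) (r : R) : set (Rd R d) :=
  [set y | Num.sqrt (\sum_(i < d) (tnth y i - tnth x i) ^+ 2) < r].

(* A charge is finite on every measurable set, so charges are exactly the
   signed measures of finite total variation.  Balls of radius r <= 0 are
   empty. *)
Definition ball_mass mu (z : Rd R d * measurableTypeR R) : R :=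
  fine (mu (eball z.1 z.2)).

(* f is the density of the measure F(dr) = f(r) dr on ]0, +oo[. *)
Definition radius_density (eps : int) (beta Cbeta : R) f :=
  [/\ measurable_fun (`]0, +oo[%classic : set R) f, forall r, 0 < r -> 0 <= f r,
      (\int[lebesgue_measure]_(r in `]0%R, +oo[) (r ^+ d * f r)%:E < +oo)%E &
      f r / (Cbeta * r `^ (- 1 - beta)) @[r --> zero_pow eps] --> (1 : R)].

(* lambda dx F_rho(dr) G(dm), where F_rho(dr) = f(r / rho) / rho dr on
   ]0, +oo[. *)
Definition ball_intensity (lambda : R) f (rho : R)
    (G : probability (measurableTypeR R) R)
    (A : set (Rd R d * measurableTypeR R * measurableTypeR R)) : \bar R :=
  (\int[(lebesgue_tuple d \x lebesgue_measure) \x G]_(z in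
      A `&` [set z | (0 < z.1.2)%R]) (lambda * (f (z.1.2 / rho) / rho))%:E)%E.

(* M_rho(mu), for N the Poisson random measure of the balls and weights; the
   integrand is N w-integrable only for almost every w. *)
Definition ball_field (T : Type)
    (N : T -> {measure set (Rd R d * measurableTypeR R * measurableTypeR R)
                 -> \bar R}) mu (w : T) : R :=
  \int[N w]_z (z.2 * ball_mass mu z.1).

Definition alpha_beta_space (alpha beta : R) :
    set (charge (Rd R d) R) :=
  [set mu | exists C p q : R, [/\ 0 < p, p < beta, beta < q &
    forall r, 0 < r ->
      (\int[lebesgue_tuple d]_x (`|ball_mass mu (x, r)| `^ alpha)%:E
        <= (C * Num.min (r `^ p) (r `^ q))%:E)%E]].

(* sigma^alpha C_beta r^(-1-beta) dr dx on R^d x ]0, +oo[ *)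
Definition stable_control (alpha beta Cbeta sigma : R)
    (A : set (Rd R d * measurableTypeR R)) : \bar R :=
  (\int[lebesgue_tuple d \x lebesgue_measure]_(z in
      A `&` [set z | (0 < z.2)%R])
    (sigma `^ alpha * Cbeta * z.2 `^ (- 1 - beta))%:E)%E.

End random_balls.
Arguments alpha_beta_space {R} d alpha beta.
Arguments stable_control {R} d alpha beta Cbeta sigma A.
Arguments radius_density {R} d eps beta Cbeta f.

(* Main.v *)
From HB Require Import structures.
Require Import Defs.
From mathcomp Require Import all_boot all_order all_algebra.
From mathcomp Require Import all_classical all_reals all_analysis.
From mathcomp Require Import finmap measurable_realfun complex ring lra zify.
Import Order.TTheory GRing.Theory Num.Theory.
Import numFieldNormedType.Exports.

Set Implicit Arguments.
Unset Strict Implicit.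
Unset Printing Implicit Defensive.
Local Open Scope classical_set_scope.
Local Open Scope ring_scope.

(** The idea is to compare characteristic functions. Campbell's formula for the
    compensated Poisson integral writes the characteristic function of the centred field at
    [mu], divided by the normalisation [u], as the exponential of the integral of
    [psi (mu (B (x, r)) / u)] against [lambda(rho) dx F_rho(dr)], where
    [psi t = phi_G t - 1 - i tau t]. The domain of attraction hypothesis gives
    [|u|^alpha psi (t / u) --> - sigma^alpha |t|^alpha (1 - i b sg(t) tan(pi alpha / 2))] with
    a bound of order [|t|^alpha] that is uniform in [t], and [lambda(rho) f(r / rho) / rho]
    divided by [u^alpha = lambda(rho) rho^beta] tends to [C_beta r^(-1-beta)]. Dominated
    convergence applies where [r / rho] is in the range in which [f] is comparable to its
    power asymptotics; on the remaining radii the moment condition on [F] and the exponents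
    [p < beta < q] of the alpha-beta space give a power of [rho] that tends to zero.

    The alpha-beta space is stable under linear combinations, so the one-dimensional
    characteristic functions determine the finite-dimensional ones. To pass from them to
    convergence in law without compactness of measures, continuous functions are
    approximated uniformly on cubes by trigonometric polynomials (Bernstein polynomials in
    [sin (h x_i)]), and the mass outside the cubes is controlled by a uniform bound on first
    absolute moments. That bound is obtained from [E |X| <= C sum_k 2^k E (1 - cos (X / 2^k))]
    (plus a constant), in which the characteristic functions enter once more. *)

(** Past the hypotheses, characteristic functions are handled as pairs of real numbers
    [expR a * cos c] and [expR a * sin c], so that only real dominated convergence is used. One
    obstacle is the scarcity of moments: [G] may have infinite variance, and even its mean, by which
    the field is centred, has to be read off from the expansion of [phi_G] at 0. The dyadic moment
    bound settles this and serves again for the rescaled fields and for the stable integrals; its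
    geometric series [sum_k 2^(k (1 - alpha))] converges because [alpha > 1]. Its constant must not
    depend on the probability space, since [Omega rho] changes with [rho] and only laws can be
    compared. The other obstacle is the far radii: there [f] is known through its moment of order
    [d] only, so the exponent bounding [int |mu (B (x, r))|^alpha dx] has to lie on the correct side
    of both [beta] and [d]. It is taken among [p], [q] and [d], the last being always available
    because ball masses are bounded and have [L^1] norm of order [r^d]. *)

(** * Integration against mixtures and densities *)

Section mixture.
Context dX (X : measurableType dX) dY (Y : measurableType dY) (R : realType).
Variables (P : {measure set X -> \bar R}) (kappa : X -> {measure set Y -> \bar R})
  (nu : {measure set Y -> \bar R}).
Hypothesis mkappa : forall U, measurable U -> measurable_fun setT (kappa ^~ U).
Hypothesis nuE : forall U, measurable U -> nu U = (\int[P]_x kappa x U)%E.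
Local Open Scope ereal_scope.
Import HBNNSimple.

Let integral_mixture_nnsfun (f : {nnsfun Y >-> R}) :
  \int[nu]_y (f y)%:E = \int[P]_x \int[kappa x]_y (f y)%:E.
Proof.
have -> : (fun x => \int[kappa x]_y (f y)%:E) =
   (fun x => \sum_(r \in range f) (r%:E * kappa x (f @^-1` [set r]))).
  by apply/funext => x; rewrite integralT_nnsfun sintegralE.
rewrite ge0_integral_fsum//; last 2 first.
- move=> r; apply: measurable_funeM.
  exact: mkappa.
- move=> r x _.
  have [r0|r0] := leP 0%R r; first by rewrite mule_ge0// lee_fin.
  by rewrite preimage_nnfun0// measure0 mule0.
rewrite integralT_nnsfun sintegralE; apply: eq_fsbigr => r _.
have [r0|r0] := leP 0%R r.
  by rewrite ge0_integralZl_EFin// ?nuE//; exact: mkappa.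
rewrite preimage_nnfun0// measure0 mule0 integral0_eq// => x _.
by rewrite measure0 mule0.
Qed.

(** Agreement on simple functions passes to the limit by monotone convergence, applied to [nu], to
    each [kappa x] and to [P]. With [kappa x] a weighted Dirac mass this is integration against a
    density; with [kappa = N] it is Campbell's formula. *)
Lemma ge0_integral_mixture (f : Y -> \bar R) :
  measurable_fun setT f -> (forall y, 0 <= f y) ->
  \int[nu]_y f y = \int[P]_x \int[kappa x]_y f y.
Proof.
move=> mf f0.
pose g := nnsfun_approx measurableT mf.
have cg y : EFin \o g ^~ y @ \oo --> f y by exact: cvg_nnsfun_approx.
have ndg y : {homo (fun n => (g n y)%:E) : n m / (n <= m)%N >-> n <= m}.
  by move=> a b ab; rewrite lee_fin; exact/lefP/nd_nnsfun_approx.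
have mcv (m : {measure set Y -> \bar R}) :
    \int[m]_y (g n y)%:E @[n --> \oo] --> \int[m]_y f y.
  have -> : f = (fun y => limn (fun n => (g n y)%:E)).
    by apply/funext => y; apply/esym/cvg_lim => //; exact: cg.
  apply: cvg_monotone_convergence => //.
  - by move=> n; exact/measurable_EFinP.
  - by move=> n y _; rewrite lee_fin.
apply: (cvg_unique _ (mcv nu)) => //.
rewrite (_ : (fun n => _) = (fun n => \int[P]_x \int[kappa x]_y (g n y)%:E)); last first.
  by apply/funext => n; exact: integral_mixture_nnsfun.
have -> : (fun x => \int[kappa x]_y f y) =
    (fun x => limn (fun n => \int[kappa x]_y (g n y)%:E)).
  by apply/funext => x; apply/esym/cvg_lim => //; exact: mcv.
apply: cvg_monotone_convergence => //.
- move=> n; apply: measurable_fun_integral_kernel => //.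
    by move=> z; rewrite lee_fin.
  exact/measurable_EFinP.
- by move=> n x _; apply: integral_ge0 => y _; rewrite lee_fin.
- move=> x _ a b ab; apply: ge0_le_integral => //.
  + by move=> y _; rewrite lee_fin.
  + exact/measurable_EFinP.
  + exact/measurable_EFinP.
  + by move=> y _; exact: ndg.
Qed.

End mixture.

Section density.
Context dX (X : measurableType dX) (R : realType).
Variables (m nu : {measure set X -> \bar R}) (h : X -> R).
Hypothesis (mh : measurable_fun setT h) (h0 : forall x, 0 <= h x).
Local Open Scope ereal_scope.

(** A mixture of the Dirac masses at [Z x] with weights [h x]. The cases used are [Z = id]
    (densities), constant [h] (scaling of Lebesgue measure) and a law tilted by a random variable
    ([decoupling]). *)
Lemma ge0_integral_weighted dY (Y : measurableType dY) (Z : X -> Y)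
    (eta : {measure set Y -> \bar R}) (f : Y -> \bar R) :
  measurable_fun setT Z ->
  (forall U, measurable U ->
     eta U = \int[m]_x ((h x)%:E * (\1_U (Z x))%:E)) ->
  measurable_fun setT f -> (forall y, 0 <= f y) ->
  \int[eta]_y f y = \int[m]_x ((h x)%:E * f (Z x)).
Proof.
move=> mZ etaE mf f0.
pose kappa x : {measure set Y -> \bar R} :=
  mscale (NngNum (h0 x)) (dirac (Z x)).
rewrite (@ge0_integral_mixture _ _ _ _ _ m kappa)//.
- apply: eq_integral => x _.
  by rewrite ge0_integral_mscale// integral_dirac// diracT mul1e.
- move=> U mU; rewrite /kappa /mscale/= /dirac.
  apply: emeasurable_funM; first exact/measurable_EFinP.
  apply/measurable_EFinP; apply: measurableT_comp => //.
Qed.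

Lemma ge0_integral_density (f : X -> \bar R) :
  (forall U, measurable U -> nu U = \int[m]_(x in U) (h x)%:E) ->
  measurable_fun setT f -> (forall x, 0 <= f x) ->
  \int[nu]_x f x = \int[m]_x ((h x)%:E * f x).
Proof.
move=> nuE mf f0; apply: (@ge0_integral_weighted _ X id) => //.
move=> U mU; rewrite nuE// integral_mkcond; apply: eq_integral => x _.
by rewrite /= indicE patchE; case: ifPn => xU; rewrite ?mule1 ?mule0.
Qed.

End density.

(** * Trigonometric approximation and convergence in law *)

Section trigonometric_polynomials.
Context {R : realType} (k : nat).
Implicit Types (t x : 'I_k -> R) (h : ('I_k -> R) -> R).

Definition pairing t x : R := \sum_i t i * x i.

(** Products are not among the constructors: convergence of integrals is then proved by induction
    from linearity alone, and [trig_mul] recovers the algebra structure from the product-to-sum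
    formulas. *)
Inductive trig_poly : (('I_k -> R) -> R) -> Prop :=
| trig_cos t : trig_poly (fun x => cos (pairing t x))
| trig_sin t : trig_poly (fun x => sin (pairing t x))
| trig_add h1 h2 of trig_poly h1 & trig_poly h2 :
    trig_poly (fun x => h1 x + h2 x)
| trig_scale a h of trig_poly h : trig_poly (fun x => a * h x).

Lemma eq_trig_poly h1 h2 : h1 =1 h2 -> trig_poly h1 -> trig_poly h2.
Proof. by move=> /funext ->. Qed.

Lemma pairingD t1 t2 x : pairing (fun i => t1 i + t2 i) x = pairing t1 x + pairing t2 x.
Proof. by rewrite /pairing -big_split; apply: eq_bigr => i _; rewrite mulrDl. Qed.

Lemma pairingB t1 t2 x : pairing (fun i => t1 i - t2 i) x = pairing t1 x - pairing t2 x.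
Proof. by rewrite /pairing -sumrB; apply: eq_bigr => i _; rewrite mulrBl. Qed.

Lemma pairing1 c j x : pairing (fun i => c *+ (i == j)) x = c * x j.
Proof.
rewrite /pairing (bigD1 j)//= eqxx big1 ?addr0// => i /negbTE ->.
by rewrite mul0r.
Qed.

Lemma trig_cst (c : R) : trig_poly (fun=> c).
Proof.
apply: eq_trig_poly (trig_scale c (trig_cos (fun=> 0))) => x.
by rewrite /pairing big1 ?cos0 ?mulr1// => i _; rewrite mul0r.
Qed.

Lemma trig_mul h1 h2 : trig_poly h1 -> trig_poly h2 ->
  trig_poly (fun x => h1 x * h2 x).
Proof.
have half (a b : R) : a = 2^-1 * (2 * a) by lra.
move=> H1; elim: H1 h2 => {h1} [t|t|h1 h1' _ IH1 _ IH2|a h _ IH] h2 H2; last first.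
- apply: eq_trig_poly (trig_scale a (IH _ H2)) => x; rewrite mulrA//.
- apply: eq_trig_poly (trig_add (IH1 _ H2) (IH2 _ H2)) => x; rewrite mulrDl//.
- elim: H2 => {h2} [s|s|h2 h2' _ IH1 _ IH2|a h _ IH]; last first.
  + by apply: eq_trig_poly (trig_scale a IH) => x; rewrite mulrCA.
  + by apply: eq_trig_poly (trig_add IH1 IH2) => x; rewrite mulrDr.
  + apply: eq_trig_poly (trig_add
      (trig_scale (2^-1) (trig_cos (fun i => t i - s i)))
      (trig_scale (- 2^-1) (trig_cos (fun i => t i + s i)))) => x.
    rewrite pairingB pairingD cosB cosD; lra.
  + apply: eq_trig_poly (trig_add
      (trig_scale (2^-1) (trig_sin (fun i => t i - s i)))
      (trig_scale (2^-1) (trig_sin (fun i => t i + s i)))) => x.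
    rewrite pairingB pairingD sinB sinD; lra.
- elim: H2 => {h2} [s|s|h2 h2' _ IH1 _ IH2|a h _ IH]; last first.
  + by apply: eq_trig_poly (trig_scale a IH) => x; rewrite mulrCA.
  + by apply: eq_trig_poly (trig_add IH1 IH2) => x; rewrite mulrDr.
  + apply: eq_trig_poly (trig_add
      (trig_scale (- 2^-1) (trig_sin (fun i => t i - s i)))
      (trig_scale (2^-1) (trig_sin (fun i => t i + s i)))) => x.
    rewrite pairingB pairingD sinB sinD; lra.
  + apply: eq_trig_poly (trig_add
      (trig_scale (2^-1) (trig_cos (fun i => t i - s i)))
      (trig_scale (2^-1) (trig_cos (fun i => t i + s i)))) => x.
    rewrite pairingB pairingD cosB cosD; lra.
Qed.

Lemma trig_exp h n : trig_poly h -> trig_poly (fun x => h x ^+ n).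
Proof.
move=> H; elim: n => [|n IH].
  by apply: eq_trig_poly (trig_cst 1) => x; rewrite expr0.
by apply: eq_trig_poly (trig_mul H IH) => x; rewrite exprS.
Qed.

Lemma trig_sum (I : Type) (s : seq I) (h : I -> ('I_k -> R) -> R) :
  (forall i, trig_poly (h i)) -> trig_poly (fun x => \sum_(i <- s) h i x).
Proof.
move=> H; elim: s => [|i s IH].
  by apply: eq_trig_poly (trig_cst 0) => x; rewrite big_nil.
by apply: eq_trig_poly (trig_add (H i) IH) => x; rewrite big_cons.
Qed.

Lemma trig_prod (I : Type) (s : seq I) (h : I -> ('I_k -> R) -> R) :
  (forall i, trig_poly (h i)) -> trig_poly (fun x => \prod_(i <- s) h i x).
Proof.
move=> H; elim: s => [|i s IH].
  by apply: eq_trig_poly (trig_cst 1) => x; rewrite big_nil.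
by apply: eq_trig_poly (trig_mul (H i) IH) => x; rewrite big_cons.
Qed.

End trigonometric_polynomials.

(** * Multivariate Bernstein polynomials *)

Section bernstein.
Context {R : realType}.

(** The probability of [m] successes in [n] independent trials of parameter [u]; the sums below are
    its total mass, mean, second moment and variance. *)
Definition bernstein n (u : R) (m : nat) : R :=
  'C(n, m)%:R * u ^+ m * (1 - u) ^+ (n - m).

Lemma bernstein_ge0 n u m : 0 <= u <= 1 -> 0 <= bernstein n u m.
Proof.
move=> /andP[u0 u1]; rewrite /bernstein !mulr_ge0// exprn_ge0// subr_ge0//.
Qed.

Lemma sum_bernstein n u : \sum_(m < n.+1) bernstein n u m = 1.
Proof.
have := exprDn (1 - u) u n; rewrite subrK expr1n => ->.
by apply: eq_bigr => i _; rewrite /bernstein -mulr_natl; ring.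
Qed.

Lemma bernsteinS n u m :
  bernstein n.+1 u m.+1 = u * bernstein n u m + (1 - u) * bernstein n u m.+1.
Proof.
rewrite /bernstein binS natrD !subSS.
have [mn|nm] := ltnP m n; last first.
  rewrite (@bin_small n m.+1)//; rewrite exprS; ring.
rewrite -(subnSK mn) !exprS; ring.
Qed.

Lemma bernsteinS0 n u : bernstein n.+1 u 0 = (1 - u) * bernstein n u 0.
Proof. by rewrite /bernstein !bin0 !subn0 !expr0 exprS; ring. Qed.

Lemma bernstein_gt n u m : (n < m)%N -> bernstein n u m = 0.
Proof. by move=> nm; rewrite /bernstein bin_small// mul0r mul0r. Qed.

(* One Bernoulli trial more: conditioning on its outcome. *)
Lemma sum_bernsteinS n u (h : nat -> R) :
  \sum_(m < n.+2) bernstein n.+1 u m * h m =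
  u * (\sum_(m < n.+1) bernstein n u m * h m.+1) +
  (1 - u) * (\sum_(m < n.+1) bernstein n u m * h m).
Proof.
rewrite big_ord_recl /= bernsteinS0.
under eq_bigr do rewrite /bump /= add1n bernsteinS mulrDl.
rewrite big_split /= !mulr_sumr.
under eq_bigr do rewrite -mulrA.
rewrite addrCA; congr (_ + _).
rewrite [in LHS]big_ord_recr /= (bernstein_gt u (ltnSn n)) mulr0 mul0r addr0.
rewrite [RHS]big_ord_recl /=; congr (_ + _); first by rewrite -mulrA.
by apply: eq_bigr => i _; rewrite -mulrA.
Qed.

Lemma sum_bernstein_mean n u :
  \sum_(m < n.+1) bernstein n u m * m%:R = n%:R * u.
Proof.
elim: n => [|n IH].
  by rewrite big_ord_recl big_ord0 /= mulr0 mul0r addr0.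
rewrite (sum_bernsteinS n u (fun m => m%:R)) IH.
under eq_bigr do rewrite -natr1 mulrDr mulr1.
rewrite big_split /= IH sum_bernstein -natr1; ring.
Qed.

Lemma sum_bernstein_sqr n u :
  \sum_(m < n.+1) bernstein n u m * (m%:R) ^+ 2 =
  (n%:R * u) ^+ 2 + n%:R * u * (1 - u).
Proof.
elim: n => [|n IH].
  by rewrite big_ord_recl big_ord0 /= expr0n /= mulr0 !mul0r !addr0 expr0n.
rewrite (sum_bernsteinS n u (fun m => m%:R ^+ 2)) IH.
have -> : \sum_(m < n.+1) bernstein n u m * (m.+1)%:R ^+ 2 =
  \sum_(m < n.+1) (bernstein n u m * m%:R ^+ 2 + 2 * (bernstein n u m * m%:R)
    + bernstein n u m).
  by apply: eq_bigr => i _; rewrite -natr1; ring.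
rewrite !big_split /= -mulr_sumr IH sum_bernstein sum_bernstein_mean -natr1; ring.
Qed.

Lemma sum_bernstein_var n u :
  \sum_(m < n.+1) bernstein n u m * (m%:R - n%:R * u) ^+ 2 = n%:R * u * (1 - u).
Proof.
have -> : \sum_(m < n.+1) bernstein n u m * (m%:R - n%:R * u) ^+ 2 =
  \sum_(m < n.+1) (bernstein n u m * m%:R ^+ 2 +
    (- 2 * (n%:R * u)) * (bernstein n u m * m%:R)
    + (n%:R * u) ^+ 2 * bernstein n u m).
  by apply: eq_bigr => i _; ring.
rewrite !big_split /= -!mulr_sumr sum_bernstein sum_bernstein_mean.
rewrite sum_bernstein_sqr; ring.
Qed.

Section multivariate.
Variables (k : nat).
Implicit Types (n : nat) (u : 'I_k -> R).

Definition mbernstein n u (m : {ffun 'I_k -> 'I_n.+1}) : R :=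
  \prod_i bernstein n (u i) (m i).

Lemma mbernstein_ge0 n u m : (forall i, 0 <= u i <= 1) -> 0 <= @mbernstein n u m.
Proof. by move=> u01; apply: prodr_ge0 => i _; exact: bernstein_ge0. Qed.

Lemma sum_mbernstein n u : \sum_m @mbernstein n u m = 1.
Proof.
rewrite -(bigA_distr_bigA (fun i (m : 'I_n.+1) => bernstein n (u i) m))/=.
by rewrite big1// => i _; exact: sum_bernstein.
Qed.

(** The coordinates are independent: distributing the product over the sum leaves a binomial
    variance at [j] and a total mass 1 at every other index. *)
Lemma sum_mbernstein_var n u j :
  \sum_m @mbernstein n u m * ((m j)%:R - n%:R * u j) ^+ 2 =
  n%:R * u j * (1 - u j).
Proof.
pose F i (m : 'I_n.+1) := bernstein n (u i) m *
  (if i == j then (m%:R - n%:R * u j) ^+ 2 else 1).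
transitivity (\sum_(m : {ffun 'I_k -> 'I_n.+1}) \prod_i F i (m i)).
  apply: eq_bigr => m _; rewrite /F big_split/=; congr (_ * _).
  by rewrite (bigD1 j)//= eqxx big1 ?mulr1// => i /negbTE ->.
rewrite -(bigA_distr_bigA F) (bigD1 j)//= [X in _ * X]big1 ?mulr1.
  by rewrite /F eqxx sum_bernstein_var.
move=> i /negbTE ij; rewrite /F ij.
by under eq_bigr do rewrite mulr1; exact: sum_bernstein.
Qed.

(* Korovkin's argument: positivity and the second moment suffice. *)
Lemma mbernstein_approx n u (H : {ffun 'I_k -> 'I_n.+1} -> R) (y C e delta : R) :
  (0 < n)%N -> 0 < delta -> 0 <= e ->
  (forall i, 0 <= u i <= 1) ->
  (forall m, `|H m| <= C) -> `|y| <= C ->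
  (forall m : {ffun 'I_k -> 'I_n.+1}, (forall i, `|(m i)%:R / n%:R - u i| < delta) -> `|H m - y| <= e) ->
  `|\sum_m @mbernstein n u m * H m - y| <= e + 2 * C / delta ^+ 2 * (k%:R / n%:R).
Proof.
move=> n0 d0 e0 u01 HC yC He.
have n0' : (0 : R) < n%:R by rewrite ltr0n.
have C0 : 0 <= C by exact: le_trans yC.
have -> : \sum_m @mbernstein n u m * H m - y =
    \sum_m @mbernstein n u m * (H m - y).
  under [RHS]eq_bigr do rewrite mulrBr.
  by rewrite sumrB -mulr_suml sum_mbernstein mul1r.
apply: (le_trans (ler_norm_sum _ _ _)).
(* [K * delta ^+ 2 = 2 * C]: as soon as one coordinate is [delta] away, the quadratic term alone
   reaches the trivial bound [2 * C] on the difference. *)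
pose K := 2 * C / delta ^+ 2.
have K0 : 0 <= K by rewrite !mulr_ge0// invr_ge0 exprn_ge0// ltW.
apply: (@le_trans _ _ (\sum_m @mbernstein n u m *
    (e + K * \sum_j ((m j)%:R / n%:R - u j) ^+ 2))).
  apply: ler_sum => m _; rewrite normrM ger0_norm; last exact: mbernstein_ge0.
  apply: ler_wpM2l; first exact: mbernstein_ge0.
  have [near|] := pselect (forall i, `|(m i)%:R / n%:R - u i| < delta).
    apply: (le_trans (He _ near)); rewrite lerDl mulr_ge0// sumr_ge0// => i _.
    by rewrite sqr_ge0.
  move=> /existsNP[j /negP]; rewrite -leNgt => far.
  apply: (@le_trans _ _ (2 * C)).
    by rewrite (le_trans (ler_normB _ _))// (le_trans (lerD (HC _) yC))//; lra.
  rewrite ler_wpDl// /K -mulrA ler_peMr//; first by rewrite mulr_ge0.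
  rewrite mulrC ler_pdivlMr ?exprn_gt0// mul1r (bigD1 j)//= ler_wpDr//.
    by apply: sumr_ge0 => i _; rewrite sqr_ge0.
  by rewrite -[leRHS]real_normK ?num_real//; apply: lerXn2r => //; rewrite nnegrE ltW.
under eq_bigr do rewrite mulrDr.
rewrite big_split/= -mulr_suml sum_mbernstein mul1r lerD2l.
have -> : \sum_m @mbernstein n u m *
    (K * \sum_j ((m j)%:R / n%:R - u j) ^+ 2) =
  K * \sum_j (u j * (1 - u j) / n%:R).
  under eq_bigr do rewrite mulrCA mulr_sumr.
  rewrite -mulr_sumr exchange_big/=; congr (_ * _); apply: eq_bigr => j _.
  transitivity (\sum_m (n%:R^-1) ^+ 2 *
      (@mbernstein n u m * ((m j)%:R - n%:R * u j) ^+ 2)).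
    by apply: eq_bigr => m _; field; rewrite gt_eqF.
  by rewrite -mulr_sumr sum_mbernstein_var; field; rewrite gt_eqF.
apply: ler_wpM2l => //.
apply: (@le_trans _ _ (\sum_(j < k) (n%:R^-1 : R))); last first.
  by rewrite sumr_const card_ord -[_ *+ k]mulr_natl.
apply: ler_sum => j _; rewrite ler_piMl ?invr_ge0 ?ltW//.
have /andP[a b] := u01 j; nra.
Qed.

End multivariate.
End bernstein.

(** Only [x] is confined to [K]; [y] may lie outside. A ball of radius [r / 2] around a point of [K]
    serves all its points at once, because their [r / 2]-neighbours stay in the ball of radius [r]
    where [f] varies little. Compactness enters as a covering property for the filter of small
    [delta]. *)
Lemma heine_cantor (R : realType) (U : pseudoMetricType R) (K : set U) (f : U -> R) (e : R) :
  compact K -> continuous f -> 0 < e ->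
  exists2 delta : R, 0 < delta &
    forall x y, K x -> ball x delta y -> `|f x - f y| <= e.
Proof.
move=> /compact_near_coveringP cK cf e0.
pose Q (delta : R) (x : U) := forall y, ball x delta y -> `|f x - f y| <= e.
have : \forall delta \near (0 : R)^'+, K `<=` Q delta.
  apply: cK => x Kx.
  have /(_ x)/cvgrPdist_le/(_ (e / 2)) := cf; rewrite divr_gt0// => /(_ isT).
  move=> /nbhs_ballP[r /= r0 rf].
  exists (ball x (r / 2), [set delta | delta < r / 2]); first split => /=.
  - by apply: nbhsx_ballx; rewrite divr_gt0.
  - by apply: nbhs_right_lt; rewrite divr_gt0.
  - move=> -[x' delta]/= [xx' dr] y x'y.
    have h1 : `|f x - f x'| <= e / 2.
      by apply: rf; apply: le_ball xx'; lra.
    have h2 : `|f x - f y| <= e / 2.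
      apply: rf; rewrite (_ : r = r / 2 + r / 2); last lra.
      by apply: ball_triangle xx' _; apply: le_ball x'y; exact: ltW.
    rewrite (_ : f x' - f y = (f x' - f x) + (f x - f y)); last ring.
    by rewrite (le_trans (ler_normD _ _))// (distrC (f x')); lra.
move=> H; have : \forall delta \near (0 : R)^'+, 0 < delta /\ K `<=` Q delta.
  by near=> delta; split; near: delta => //; exact: nbhs_right_gt.
by move=> /filter_ex[delta [d0 Hd]]; exists delta => // x y Kx; exact: Hd.
Unshelve. all: by end_near. Qed.


Section clamped_asin.
Context {R : realType}.

(** Clamping to [[- sin (1/2), sin (1/2)]] keeps the argument of the arcsine inside []-1, 1[], so
    that [casin] is continuous on the whole line while still inverting the sine on [[-1/2, 1/2]]. *)
Definition clamp (v : R) : R := Num.max (- sin (2^-1)) (Num.min v (sin (2^-1))).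
Definition casin v : R := asin (clamp v).

Let half_itv (a : R) : - 2^-1 <= a <= 2^-1 -> a \in `[- (pi / 2), pi / 2].
Proof.
have := pihalf_ge1 R; rewrite in_itv/= => h /andP[h1 h2].
by apply/andP; split; lra.
Qed.

Let sin_half : 0 < sin (2^-1 : R) < 1.
Proof.
have h := pihalf_ge1 R.
apply/andP; split; first by apply: sin_gt0_pihalf; apply/andP; split; lra.
rewrite [ltRHS](esym (@sin_pihalf R)) ltr_sin ?in_itv/=; first lra.
  by apply/andP; split; lra.
by apply/andP; split; lra.
Qed.

Let le_sin_half (a : R) : - 2^-1 <= a <= 2^-1 -> - sin (2^-1) <= sin a <= sin (2^-1).
Proof.
move=> h; have mono x y : - 2^-1 <= x <= 2^-1 -> - 2^-1 <= y <= 2^-1 ->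
    x <= y -> sin x <= sin y :> R.
  move=> hx hy; rewrite le_eqVlt => /predU1P[->//|xy].
  by rewrite ltW// ltr_sin// half_itv.
have /andP[h1 h2] := h.
rewrite -sinN; apply/andP; split; apply: mono => //; apply/andP; split; lra.
Qed.

Lemma casinK a : - 2^-1 <= a <= 2^-1 -> casin (sin a) = a.
Proof.
move=> h; have /andP[h1 h2] := le_sin_half h.
rewrite /casin /clamp; rewrite (min_idPl h2) (max_idPr h1) sinK//.
exact: half_itv.
Qed.

Lemma clamp_itv (x : R) : -1 < clamp x < 1.
Proof.
have /andP[s0 s1] := sin_half.
rewrite /clamp; set s := sin _ in s0 s1 *.
rewrite lt_max gt_max gt_min s1 orbT andbT.
have -> : -1 < - s by lra.
lra.
Qed.

Lemma continuous_casin : continuous casin.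
Proof.
move=> x; apply: continuous_comp; last exact/continuous_asin/clamp_itv.
apply: continuous_max; first exact: cvg_cst.
by apply: continuous_min; [exact: cvg_id|exact: cvg_cst].
Qed.

End clamped_asin.

Section approximation.
Context {R : realType} (k : nat).

(** On the cube, [x i] is recovered by [casin] from the sine of [x i / (2 L)], whose argument stays
    in [[-1/2, 1/2]]; hence [g] is there a continuous function of the [u x i]. Bernstein weights are
    nonnegative with sum 1, so the approximant is bounded by [C] everywhere and not only on the
    cube; the error estimate off the cube depends on this. *)
Lemma trig_poly_approx (g : 'rV[R]_k -> R) (C L e : R) :
  continuous g -> (forall x, `|g x| <= C) -> 0 < L -> 0 < e ->
  exists T : ('I_k -> R) -> R, [/\ trig_poly T, (forall x, `|T x| <= C) &
    forall x, (forall i, `|x i| <= L) -> `|T x - g (\row_i x i)| <= e].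
Proof.
move=> cg gC L0 e0.
have L2 : 0 < 2 * L by rewrite mulr_gt0.
pose K : set 'rV[R]_k := [set v | forall i, `[- L, L]%classic (v ord0 i)].
have cK : compact K.
  by apply: (@rV_compact _ k (fun=> `[- L, L]%classic)) => i; exact: segment_compact.
have e2 : 0 < e / 2 by rewrite divr_gt0.
have [d1 d10 gd1] := heine_cantor cK cg e2.
(* The division by [2 * L] anticipates the dilation after [casin]; the extra half turns the weak
   inequality of [heine_cantor] into the strict one that defines a ball. *)
pose d1' := d1 / (2 * L) / 2.
have d1'0 : 0 < d1' by rewrite /d1' !divr_gt0.
have [d2 d20 ad2] := heine_cantor (@segment_compact R (-1) 1)
  (@continuous_casin R) d1'0.
(* The arguments of [casin] are [2 * (m / n) - 1] and [2 * u - 1], twice as far apart as [m / n] and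
   [u]. *)
have d2' : 0 < d2 / 2 by rewrite divr_gt0.
pose M := 2 * C / (d2 / 2) ^+ 2 * k%:R.
have C0 : 0 <= C by exact: le_trans (gC 0).
pose n := (Num.truncn (M / (e / 2))).+1.
have n0 : 0 < n%:R :> R by rewrite ltr0n.
have nM : M / n%:R <= e / 2.
  rewrite ler_pdivrMr// mulrC -ler_pdivrMr//.
  by rewrite ltW// truncnS_gt.
pose u (x : 'I_k -> R) i := (1 + sin ((2 * L)^-1 * x i)) / 2.
pose H (m : {ffun 'I_k -> 'I_n.+1}) : R :=
  g (\row_i (2 * L * casin (2 * ((m i)%:R / n%:R) - 1))).
exists (fun x => \sum_m mbernstein (u x) m * H m).
have u01 x i : 0 <= u x i <= 1.
  have := sin_geN1 ((2 * L)^-1 * x i); have := sin_le1 ((2 * L)^-1 * x i).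
  by rewrite /u => h1 h2; apply/andP; split; lra.
split.
- apply: trig_sum => m; apply: trig_mul; last exact: trig_cst.
  apply: trig_prod => i; rewrite /bernstein.
  have tu : trig_poly (fun x => u x i).
    have ts : trig_poly (fun x : 'I_k -> R => sin ((2 * L)^-1 * x i)).
      apply: eq_trig_poly (trig_sin (fun j => (2 * L)^-1 *+ (j == i))) => x.
      by rewrite pairing1.
    apply: eq_trig_poly (trig_scale (2^-1) (trig_add (trig_cst k 1) ts)) => x.
    by rewrite /u mulrC.
  apply: trig_mul.
    by apply: trig_mul; [exact: trig_cst|exact: trig_exp].
  apply: trig_exp.
  apply: eq_trig_poly (trig_add (trig_cst k 1) (trig_scale (-1) tu)) => x.
  by rewrite mulN1r.
- move=> x; rewrite (le_trans (ler_norm_sum _ _ _))//.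
  rewrite (@le_trans _ _ (\sum_m @mbernstein _ _ n (u x) m * C))//.
    apply: ler_sum => m _; rewrite normrM ger0_norm ?mbernstein_ge0//.
    by apply: ler_wpM2l; [exact: mbernstein_ge0|exact: gC].
  by rewrite -mulr_suml sum_mbernstein mul1r.
- move=> x xL.
  apply: (@le_trans _ _ (e / 2 + M / n%:R)); last lra.
  rewrite (_ : M / n%:R = 2 * C / (d2 / 2) ^+ 2 * (k%:R / n%:R)); last first.
    by rewrite /M mulrA.
  apply: mbernstein_approx => //; first exact: ltW.
    by move=> m; exact: gC.
  move=> m Hm; rewrite distrC; apply: gd1.
    by move=> i /=; rewrite mxE in_itv/= -ler_norml.
  split => // i j; rewrite !mxE.
  rewrite -ball_normE/=.
  have xj : - 2^-1 <= (2 * L)^-1 * x j <= 2^-1.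
    by rewrite -ler_norml normrM gtr0_norm ?invr_gt0// mulrC
       ler_pdivrMr//; have := xL j; lra.
  have <- : 2 * L * casin (sin ((2 * L)^-1 * x j)) = x j.
    by rewrite casinK// mulrA divff ?mul1r// gt_eqF.
  rewrite -mulrBr normrM gtr0_norm//.
  rewrite mulrC -ltr_pdivlMr//.
  have d1lt : d1' < d1 / (2 * L) by rewrite /d1' ltr_pdivrMr// ltr_pMr ?divr_gt0//; lra.
  apply: le_lt_trans d1lt; apply: ad2 => /=.
    by rewrite in_itv/= sin_geN1 sin_le1.
  rewrite -ball_normE/=.
  have := Hm j; rewrite /u !ltr_norml => /andP[h1 h2].
  by apply/andP; split; lra.
Qed.

End approximation.

(** * From trigonometric integrals to convergence in law *)

Section probability_integrals.
Context d (T : measurableType d) {R : realType} (P : probability T R).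
Implicit Types (h : T -> R).

Lemma bounded_integrable h (C : R) : measurable_fun setT h -> (forall x, `|h x| <= C) ->
  P.-integrable setT (EFin \o h).
Proof.
move=> mh hC; apply: measurable_bounded_integrable => //.
- by apply: (le_lt_trans (probability_le1 P measurableT)); exact: ltry.
- exists C; split; first exact: num_real.
  by move=> x Cx y _ /=; rewrite (le_trans (hC y))// ltW.
Qed.

Lemma le_norm_Rintegral h (K : T -> R) : measurable_fun setT h ->
  (forall x, `|h x| <= K x) -> P.-integrable setT (EFin \o K) ->
  `|\int[P]_x h x| <= \int[P]_x K x.
Proof.
move=> mh hK iK.
have ih : P.-integrable setT (EFin \o h).
  apply: le_integrable iK => //; first exact/measurable_EFinP.
  by move=> x _; rewrite lee_fin (le_trans (hK x))// ler_norm.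
rewrite (le_trans (le_normr_Rintegral _ _))//.
by apply: le_Rintegral => //; exact: (integrable_norm ih).
Qed.

Lemma Rintegral_cst1 (c : R) : \int[P]_x c = c.
Proof. rewrite Rintegral_cst// -[RHS]mulr1; congr (_ * _).
exact: (congr1 fine (probability_setT P)). Qed.

End probability_integrals.

Section trig_measurable.
Context d (T : measurableType d) {R : realType} (k : nat).
Variables (X : T -> 'I_k -> R).
Hypothesis mX : forall i, measurable_fun setT (X ^~ i).

Lemma measurable_pairing t : measurable_fun setT (fun w => pairing t (X w)).
Proof.
by apply: measurable_sum => i; apply: measurable_funM.
Qed.

Lemma measurable_trig_poly h : trig_poly h -> measurable_fun setT (fun w => h (X w)).
Proof.
elim=> [t|t|h1 h2 _ m1 _ m2|a h1 _ m1].
- by apply: measurableT_comp (measurable_pairing t); exact: continuous_measurable_fun (@continuous_cos R).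
- by apply: measurableT_comp (measurable_pairing t); exact: continuous_measurable_fun (@continuous_sin R).
- exact: measurable_funD.
- exact: measurable_funM.
Qed.

(** A trigonometric polynomial within [1 / (n + 1)] of [g] on the cube of half-side [n + 1] gives a
    sequence of measurable functions converging pointwise, since every point ends up in the
    cubes. *)
Lemma measurable_continuous_row (g : 'rV[R]_k -> R) (C : R) :
  continuous g -> (forall x, `|g x| <= C) ->
  measurable_fun setT (fun w => g (\row_i X w i)).
Proof.
move=> cg gC.
have /choice[Tn HT] : forall n : nat, exists T : ('I_k -> R) -> R, trig_poly T /\
    forall x, (forall i, `|x i| <= n.+1%:R) -> `|T x - g (\row_i x i)| <= n.+1%:R^-1.
  move=> n; have [||T0 [tT _ HT]] := trig_poly_approx cg gC (_ : 0 < n.+1%:R) (_ : 0 < n.+1%:R^-1).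
    - by rewrite ltr0n.
    - by rewrite invr_gt0 ltr0n.
  by exists T0.
apply: (measurable_fun_cvg (h := fun n w => Tn n (X w))).
  by move=> n; apply: measurable_trig_poly; have [] := HT n.
move=> w _; apply/cvgrPdist_le => e e0.
pose M := \sum_i `|X w i|.
near=> n; rewrite distrC; have [_ /(_ (X w)) H] := HT n.
apply: le_trans (H _) _.
  move=> i; apply: (@le_trans _ _ M).
    by rewrite /M (bigD1 i)//= lerDl sumr_ge0.
  by apply: (@le_trans _ _ n%:R); [near: n; exact: nbhs_infty_ger|rewrite ler_nat].
by rewrite ltW//; near: n; exact: (near_infty_natSinv_lt (PosNum e0)).
Unshelve. all: by end_near. Qed.

End trig_measurable.

Section trig_bounded.
Context {R : realType} (k : nat).

Lemma trig_poly_bounded (h : ('I_k -> R) -> R) : trig_poly h ->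
  exists C, forall x, `|h x| <= C.
Proof.
elim=> [t|t|h1 h2 _ [C1 m1] _ [C2 m2]|a h1 _ [C1 m1]].
- by exists 1 => x; rewrite ler_norml cos_geN1 cos_le1.
- by exists 1 => x; rewrite ler_norml sin_geN1 sin_le1.
- by exists (C1 + C2) => x; rewrite (le_trans (ler_normD _ _))// lerD.
- by exists (`|a| * C1) => x; rewrite normrM ler_wpM2l.
Qed.

End trig_bounded.

(** Outside the cube some coordinate exceeds [L], so the trivial bound [2 * C] is at most
    [2 * C / L] times the sum of the absolute values of the coordinates: Markov's inequality,
    applied pointwise before integrating. *)
Lemma row_trig_error d (T : measurableType d) {R : realType} (P : probability T R)
  (k : nat) (X : T -> 'I_k -> R) (g : 'rV[R]_k -> R) h (C L e B : R) :
  (forall i, measurable_fun setT (X ^~ i)) ->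
  (forall i, (\int[P]_w (`|X w i|)%:E <= B%:E)%E) ->
  continuous g -> (forall x, `|g x| <= C) -> trig_poly h -> (forall x, `|h x| <= C) ->
  0 < L -> 0 <= e ->
  (forall x, (forall i, `|x i| <= L) -> `|h x - g (\row_i x i)| <= e) ->
  `|\int[P]_w g (\row_i X w i) - \int[P]_w h (X w)| <= e + 2 * C / L * (k%:R * B).
Proof.
move=> mX XB cg gC th hC L0 e0 Hh.
have mg := measurable_continuous_row mX cg gC.
have mh := measurable_trig_poly mX th.
have ig : P.-integrable setT (fun w => (g (\row_i X w i))%:E).
  exact: (bounded_integrable _ mg (fun w => gC _)).
have ih : P.-integrable setT (fun w => (h (X w))%:E).
  exact: (bounded_integrable _ mh (fun w => hC _)).
have iX i : P.-integrable setT (fun w => (`|X w i|)%:E).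
  apply/integrableP; split.
    by apply/measurable_EFinP; exact: measurableT_comp.
  under eq_integral do rewrite gee0_abs ?lee_fin//.
  by rewrite (le_lt_trans (XB i))// ltry.
have C0 : 0 <= C by exact: le_trans (gC 0).
rewrite -RintegralB//.
pose K w := e + 2 * C / L * \sum_i `|X w i|.
have isum : P.-integrable setT (EFin \o (fun w => \sum_i `|X w i|)).
  have := @integrable_sum _ _ _ P _ measurableT 'I_k (index_enum 'I_k) predT (fun i w => (`|X w i|)%:E) (fun i _ => iX i).
  apply: eq_integrable => // w _ /=.
  by rewrite sumEFin.
have isc : P.-integrable setT (EFin \o (fun w => 2 * C / L * \sum_i `|X w i|)).
  have := integrableZl measurableT (2 * C / L) isum.
  by apply: eq_integrable => // w _ /=; rewrite EFinM.
have ie : P.-integrable setT (EFin \o (fun w : T => e)).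
  by apply: (@bounded_integrable _ _ _ _ _ `|e|).
apply: (@le_trans _ _ (\int[P]_w K w)).
  apply: le_norm_Rintegral => //; first exact: measurable_funB.
    move=> w; rewrite /K.
    have [near|/existsNP[i /negP]] := pselect (forall i, `|X w i| <= L).
      rewrite distrC (le_trans (Hh _ near))// lerDl mulr_ge0//.
        by rewrite divr_ge0 ?mulr_ge0// ltW.
      by rewrite sumr_ge0.
    rewrite -ltNge => far.
    apply: (@le_trans _ _ (2 * C)).
      by rewrite (le_trans (ler_normB _ _))// (le_trans (lerD (gC _) (hC _)))//; lra.
    rewrite ler_wpDl// -mulrA ler_peMr//; first by rewrite mulr_ge0.
    rewrite mulrC ler_pdivlMr// mul1r (bigD1 i)//= ler_wpDr ?sumr_ge0//.
    exact: ltW.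
  rewrite (_ : EFin \o K = ((EFin \o (fun w : T => e)) \+
     (EFin \o (fun w => (2 * C / L * \sum_i `|X w i|)%R)))%E); first exact: integrableD.
  by apply/funext => w; rewrite /= EFinD.
rewrite RintegralD// Rintegral_cst1 lerD2l RintegralZl// ler_wpM2l//.
  by rewrite divr_ge0 ?mulr_ge0// ltW.
rewrite /Rintegral.
under eq_integral do rewrite -sumEFin.
rewrite integral_sum//=.
rewrite -lee_fin fineK; last first.
  apply/sum_fin_numP => i _ _; exact: (integrable_fin_num _ (iX i)).
rewrite (@le_trans _ _ (\sum_(i < k) B%:E)%E)//; first exact: lee_sum.
by rewrite sumEFin lee_fin sumr_const card_ord -[leLHS]mulr_natl.
Qed.

(* Tightness comes for free from the first-moment bound. *)
Lemma levy_continuity (R : realType) (J : Type) (F : set_system J) {FF : Filter F}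
  (dT : measure_display) (T : J -> measurableType dT) (P : forall j, probability (T j) R)
  (dT' : measure_display) (T' : measurableType dT') (P' : probability T' R)
  (k : nat) (X : forall j, T j -> 'I_k -> R) (Y : T' -> 'I_k -> R) (B : R) :
  (forall j i, measurable_fun setT (fun w => X j w i)) ->
  (forall i, measurable_fun setT (fun w => Y w i)) ->
  (\forall j \near F, forall i, (\int[P j]_w (`|X j w i|)%:E <= B%:E)%E) ->
  (forall i, (\int[P']_w (`|Y w i|)%:E <= B%:E)%E) ->
  (forall t, \int[P j]_w cos (pairing t (X j w)) @[j --> F] -->
             \int[P']_w cos (pairing t (Y w))) ->
  (forall t, \int[P j]_w sin (pairing t (X j w)) @[j --> F] -->
             \int[P']_w sin (pairing t (Y w))) ->
  cvg_in_distribution P P' F (fun j w => \row_i X j w i) (fun w => \row_i Y w i).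
Proof.
move=> mX mY XB YB ccos csin.
have ctrig h : trig_poly h -> \int[P j]_w h (X j w) @[j --> F] --> \int[P']_w h (Y w).
  elim=> [//|//|h1 h2 t1 c1 t2 c2|a h1 t1 c1].
  - have [[C1 b1] [C2 b2]] := (trig_poly_bounded t1, trig_poly_bounded t2).
    rewrite RintegralD//; last 2 first.
    + exact: (bounded_integrable _ (measurable_trig_poly mY t1) (fun=> b1 _)).
    + exact: (bounded_integrable _ (measurable_trig_poly mY t2) (fun=> b2 _)).
    rewrite (_ : (fun j => _) = (fun j =>
      \int[P j]_w h1 (X j w) + \int[P j]_w h2 (X j w))); first exact: cvgD.
    apply/funext => j; rewrite RintegralD//.
    + exact: (bounded_integrable _ (measurable_trig_poly (mX j) t1) (fun=> b1 _)).
    + exact: (bounded_integrable _ (measurable_trig_poly (mX j) t2) (fun=> b2 _)).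
  - have [C1 b1] := trig_poly_bounded t1.
    rewrite RintegralZl//; last first.
      exact: (bounded_integrable _ (measurable_trig_poly mY t1) (fun=> b1 _)).
    rewrite (_ : (fun j => _) = (fun j =>
      a * \int[P j]_w h1 (X j w))); first by apply: cvgM => //; exact: cvg_cst.
    apply/funext => j; rewrite RintegralZl//.
    exact: (bounded_integrable _ (measurable_trig_poly (mX j) t1) (fun=> b1 _)).
move=> g cg [C gC].
have C0 : 0 <= C by exact: le_trans (gC 0).
apply/cvgrPdist_le => e e0.
(* The absolute value is there because the sign of [B] is not assumed. [L] is then taken so large
   that the mass outside the cube costs at most [e / 8] for all [j] at once. *)
pose D := 2 * C * (k%:R * `|B|).
have D0 : 0 <= D by rewrite !mulr_ge0.
pose L := (D + 1) / (e / 8).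
have L0 : 0 < L by rewrite !divr_gt0//; lra.
have e8 : 0 < e / 8 by rewrite divr_gt0.
have [h [th hC Hh]] := trig_poly_approx cg gC L0 e8.
have DL : 2 * C / L * (k%:R * B) <= e / 8.
  rewrite (@le_trans _ _ (D / L))//.
    rewrite /D mulrAC ler_wpM2r// ?invr_ge0 ?(ltW L0)// ler_wpM2l ?mulr_ge0//.
    by rewrite ler_wpM2l// ler_norm.
  by rewrite ler_pdivrMr// /L mulrCA divff ?gt_eqF// mulr1; lra.
have errY := row_trig_error mY YB cg gC th hC L0 (ltW e8) Hh.
near=> j.
have XBj : forall i, (\int[P j]_w (`|X j w i|)%:E <= B%:E)%E by near: j.
have errX := row_trig_error (mX j) XBj cg gC th hC L0 (ltW e8) Hh.
have mid : `|\int[P']_w h (Y w) - \int[P j]_w h (X j w)| <= e / 8.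
  by near: j; move: (ctrig _ th) => /cvgrPdist_le/(_ _ e8).
move: errX errY mid.
set a := \int[P']_w _; set b := \int[P']_w _.
set c := \int[P j]_w _; set a' := \int[P j]_w _.
rewrite !ler_norml => /andP[? ?] /andP[? ?] /andP[? ?].
by apply/andP; split; lra.
Unshelve. all: by end_near. Qed.

(** * First moments from characteristic functions *)

Lemma dyadic_bracket (R : realType) (x : R) : 1 < x ->
  exists n : nat, 2 ^+ n <= x < 2 ^+ n.+1.
Proof.
move=> x1.
have ex : exists n, x < 2 ^+ n.+1.
  exists (Num.truncn x); apply: lt_le_trans (truncnS_gt _) _.
  by rewrite -natrX ler_nat; exact/ltnW/ltn_expl.
exists (ex_minn ex); case: ex_minnP => n xn nmin; rewrite xn andbT.
case: n xn nmin => [|n] xn nmin; first by rewrite expr0 ltW.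
by rewrite leNgt; apply/negP => /nmin; rewrite ltnn.
Qed.

Section dyadic_moment.
Context {R : realType}.

Let cos1 : 0 < 1 - cos (1 : R).
Proof.
rewrite subr_gt0 [ltRHS](esym (@cos0 R)) ltr_cos ?in_itv//=.
  by have := pi_ge2 R; lra.
by have := pi_ge2 R; lra.
Qed.

(** The constant is chosen so that, when [1 - cos (x / 2^n)] is at least [1 - cos 1], the term is at
    least [2^(n + 1)]. *)
Definition dyadic_term (x : R) n : R :=
  2 / (1 - cos 1) * 2 ^+ n * (1 - cos ((2 ^+ n)^-1 * x)).

Lemma dyadic_term_ge0 x n : 0 <= dyadic_term x n.
Proof.
by rewrite /dyadic_term !mulr_ge0 ?divr_ge0 ?exprn_ge0 ?(ltW cos1)// subr_ge0 cos_le1.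
Qed.

(** All terms being nonnegative, the one with [2^n <= |x| < 2^(n + 1)] suffices: [|x| / 2^n] then
    lies in [[1, 2[], where the cosine is at most [cos 1] because [2 <= pi]. The summand 1 covers
    [|x| <= 1], which has no such scale. *)
Lemma le_dyadic_sum (x : R) :
  (`|x|%:E <= 1 + \sum_(0 <= n <oo) (dyadic_term x n)%:E)%E.
Proof.
have s0 : (0 <= \sum_(0 <= n <oo) (dyadic_term x n)%:E)%E.
  by apply: nneseries_ge0 => n _ _; rewrite lee_fin dyadic_term_ge0.
have [x1|x1] := leP `|x| 1.
  by rewrite (@le_trans _ _ 1%E) ?lee_fin// leeDl.
have [n /andP[n1 n2]] := dyadic_bracket x1.
rewrite (@le_trans _ _ (dyadic_term x n)%:E)//; last first.
  rewrite (@le_trans _ _ (\sum_(0 <= n <oo) (dyadic_term x n)%:E)%E)//; last by rewrite leeDr.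
  apply: le_trans (@nneseries_lim_ge _ _ xpredT 0 n.+1 _); last first.
    by move=> m _ _; rewrite lee_fin dyadic_term_ge0.
  rewrite big_nat_recr//= leeDr// sume_ge0// => m _.
  by rewrite lee_fin dyadic_term_ge0.
rewrite lee_fin /dyadic_term.
have p2 : 0 < 2 ^+ n :> R by rewrite exprn_gt0.
have y1 : 1 <= (2 ^+ n)^-1 * `|x| by rewrite mulrC ler_pdivlMr ?mul1r.
have y2 : (2 ^+ n)^-1 * `|x| < 2 by rewrite mulrC ltr_pdivrMr// -exprS.
have -> : cos ((2 ^+ n)^-1 * x) = cos ((2 ^+ n)^-1 * `|x|).
  have [x0|x0] := ler0P x; last by [].
  by rewrite mulrN cosN.
have cle : cos ((2 ^+ n)^-1 * `|x|) <= cos 1.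
  have : 1 <= (2 ^+ n)^-1 * `|x| by [].
  rewrite le_eqVlt => /predU1P[<-//|h].
  by rewrite ltW// ltr_cos// in_itv/=; have := pi_ge2 R; lra.
apply: (@le_trans _ _ (2 / (1 - cos 1) * 2 ^+ n * (1 - cos 1))); last first.
  by rewrite ler_wpM2l ?lerB// mulr_ge0 ?divr_ge0 ?ltW.
have -> : 2 / (1 - cos 1) * 2 ^+ n * (1 - cos 1) = 2 ^+ n.+1 :> R.
  by rewrite exprS; field; rewrite gt_eqF.
exact: ltW.
Qed.

(** Term by term the expectation is of order [2^n (2^-n)^alpha], a geometric series of ratio
    [q = 2^(1 - alpha) < 1]. [K] is quantified before the space and the variable, which makes the
    bound uniform over changing probability spaces. *)
Lemma dyadic_moment_bound (alpha : R) : 1 < alpha -> exists2 K : R, 0 <= K &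
  forall d (T : measurableType d) (P : probability T R) (X : T -> R) (C : R),
  measurable_fun setT X -> 0 <= C ->
  (forall n, (\int[P]_w (1 - cos ((2 ^+ n)^-1 * X w)) <= C * ((2 ^+ n)^-1) `^ alpha)) ->
  (\int[P]_w (`|X w|)%:E <= (1 + K * C)%:E)%E.
Proof.
move=> a1; pose q : R := 2 `^ (1 - alpha).
have q0 : 0 < q by rewrite powR_gt0.
have q1 : q < 1.
  rewrite lt_neqAle; apply/andP; split.
    rewrite /q powR_eq1 !negb_or; apply/and3P; split.
    - by rewrite pnatr_eq1.
    - by rewrite -leNgt.
    - by rewrite subr_eq0 lt_eqF.
  by rewrite /q -[leRHS](powRr0 2) ler_powR ?ler1n//; lra.
pose K1 := 2 / (1 - cos (1 : R)).
have K10 : 0 <= K1 by rewrite divr_ge0 ?ltW.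
exists (K1 / (1 - q)); first by rewrite divr_ge0// subr_ge0 ltW.
move=> d T P X C mX C0 HC.
have mcos n : measurable_fun setT (fun w => 1 - cos ((2 ^+ n)^-1 * X w)).
  apply: measurable_funB => //.
  apply: measurableT_comp; first exact: continuous_measurable_fun (@continuous_cos R).
  exact: measurable_funM.
have mdt n : measurable_fun setT (fun w => (dyadic_term (X w) n)%:E).
  by apply/measurable_EFinP; apply: measurable_funM.
have dt0 n w : (0 <= (dyadic_term (X w) n)%:E)%E by rewrite lee_fin dyadic_term_ge0.
apply: (@le_trans _ _ (\int[P]_w (1 + \sum_(0 <= n <oo) (dyadic_term (X w) n)%:E))%E).
  apply: ge0_le_integral => //.
  - apply/measurable_EFinP; exact: measurableT_comp.
  - apply: emeasurable_funD => //; apply: ge0_emeasurable_sum => // n _ _ //.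
  - by move=> w _; exact: le_dyadic_sum.
rewrite ge0_integralD//; last 2 first.
  - by move=> w _; apply: nneseries_ge0.
  - by apply: ge0_emeasurable_sum.
rewrite EFinD; apply: leeD.
  rewrite integral_cst// mul1e; exact: probability_le1.
rewrite integral_nneseries//.
have dtE n : (\int[P]_w (dyadic_term (X w) n)%:E <= (K1 * C * q ^+ n)%:E)%E.
  have int : P.-integrable setT (fun w => (1 - cos ((2 ^+ n)^-1 * X w))%:E).
    apply: (@bounded_integrable _ _ _ _ _ 2) => // w.
    have := cos_geN1 ((2 ^+ n)^-1 * X w); have := cos_le1 ((2 ^+ n)^-1 * X w).
    by move=> ? ?; rewrite ler_norml; apply/andP; split; lra.
  under eq_integral do rewrite /dyadic_term EFinM.
  rewrite integralZl//.
  rewrite -[X in (_ * X <= _)%E]fineK; last exact: (integrable_fin_num _ int).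
  rewrite -EFinM lee_fin.
  rewrite (@le_trans _ _ (K1 * 2 ^+ n * (C * ((2 ^+ n)^-1) `^ alpha)))//.
    by apply: ler_wpM2l; [exact: mulr_ge0|exact: HC].
  rewrite le_eqVlt; apply/orP; left; apply/eqP.
  have -> : ((2 ^+ n)^-1) `^ alpha = (2 `^ (- alpha)) ^+ n :> R.
    by rewrite -!powR_mulrn ?powR_ge0// -powRN -!powRrM; congr (_ `^ _); ring.
  rewrite (_ : q ^+ n = 2 ^+ n * (2 `^ (- alpha)) ^+ n); first ring.
  rewrite -exprMn; congr (_ ^+ _); rewrite /q powRD ?powRr1//.
  by apply/implyP => _; rewrite pnatr_eq0.
apply: lime_le; first by apply: is_cvg_nneseries => n _ _; apply: integral_ge0.
apply: nearW => n.
rewrite (@le_trans _ _ (\sum_(0 <= i < n) (K1 * C * q ^+ i)%:E)%E)//.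
  by apply: lee_sum.
rewrite sumEFin lee_fin -mulr_sumr.
rewrite (_ : K1 / (1 - q) * C = K1 * C * (1 - q)^-1); last by rewrite mulrAC.
apply: ler_wpM2l; first exact: mulr_ge0.
have -> : \sum_(0 <= i < n) q ^+ i = (1 - q ^+ n) / (1 - q).
  have := @geometric_seriesE R 1 q; rewrite lt_eqF// => /(_ isT)/(congr1 (fun f => f n)).
  rewrite /series/= mul1r => <-; apply: eq_bigr => i _; by rewrite mul1r.
by rewrite ler_piMl ?invr_ge0 ?subr_ge0 ?(ltW q1)// gerBl exprn_ge0// ltW.
Qed.

End dyadic_moment.

Lemma measurable_cos_comp d (T : measurableType d) (R : realType) (h : T -> R) :
  measurable_fun setT h -> measurable_fun setT (fun x => cos (h x)).
Proof.
by move=> mh; apply: measurableT_comp mh; exact: continuous_measurable_fun (@continuous_cos R).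
Qed.

Lemma measurable_sin_comp d (T : measurableType d) (R : realType) (h : T -> R) :
  measurable_fun setT h -> measurable_fun setT (fun x => sin (h x)).
Proof.
by move=> mh; apply: measurableT_comp mh; exact: continuous_measurable_fun (@continuous_sin R).
Qed.

Lemma norm_cos_le1 (R : realType) (x : R) : `|cos x| <= 1.
Proof. by rewrite ler_norml cos_geN1 cos_le1. Qed.

Lemma norm_sin_le1 (R : realType) (x : R) : `|sin x| <= 1.
Proof. by rewrite ler_norml sin_geN1 sin_le1. Qed.

(** * Characteristic functions of Poisson integrals *)

Section decoupling.
Context d (T : measurableType d) d' (T' : measurableType d') (R : realType).
Variables (P : probability T R) (W : T -> R) (Z : T -> T') (c D : R).
Hypotheses (mW : measurable_fun setT W) (WD : forall w, `|W w| <= D).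
Hypothesis mZ : measurable_fun setT Z.
Hypothesis WZ : forall B, measurable B ->
  \int[P]_w (W w * \1_B (Z w)) = c * fine (P (Z @^-1` B)).

Let iW : P.-integrable setT (EFin \o W).
Proof. exact: bounded_integrable mW WD. Qed.

Let cE : \int[P]_w W w = c.
Proof.
have := WZ measurableT; rewrite preimage_setT.
rewrite (congr1 fine (probability_setT P)) mulr1 => <-.
by apply: eq_Rintegral => w _; rewrite indicT mulr1.
Qed.

(** [W] and [H] are signed, so they are shifted: [WZ] says that the image of [(W + D) P] under [Z]
    is [c + D] times the law of [Z]. Integrating [H + E] against it and expanding leaves the
    identity for [W] and [H]. *)
Lemma decoupling (H : T' -> R) (E : R) :
  measurable_fun setT H -> (forall z, `|H z| <= E) ->
  \int[P]_w (W w * H (Z w)) = c * \int[P]_w H (Z w).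
Proof.
move=> mH HE.
have mHZ : measurable_fun setT (H \o Z) by exact: measurableT_comp.
have iH : P.-integrable setT (fun w => (H (Z w))%:E).
  exact: (bounded_integrable _ mHZ (fun w => HE _)).
have mWH : measurable_fun setT (fun w => W w * H (Z w)) by exact: measurable_funM.
have WHDE w : `|W w * H (Z w)| <= D * E.
  by rewrite normrM ler_pM.
have iWH : P.-integrable setT (fun w => (W w * H (Z w))%:E).
  exact: (bounded_integrable _ mWH WHDE).
have WD0 w : 0 <= W w + D by have := WD w; rewrite ler_norml => /andP[]; lra.
have HE0 z : 0 <= H z + E by have := HE z; rewrite ler_norml => /andP[]; lra.
have icst (e : R) : P.-integrable setT (fun=> e%:E).
  by apply: (@bounded_integrable _ _ _ _ _ `|e|).
have iWDp : P.-integrable setT (fun w => (W w + D)%:E).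
  have := integrableD measurableT iW (icst D).
  by apply: eq_integrable => // w _; rewrite /= EFinD.
have cD0 : 0 <= c + D.
  rewrite -cE -[D in X in _ <= X](Rintegral_cst1 P) -RintegralD//; last exact: icst.
  by apply: Rintegral_ge0 => w _.
pose eta0 : {measure set T' -> \bar R} := mscale (NngNum cD0) (pushforward P Z).
pose eta := eta0 mZ.
have etaE U : measurable U ->
    eta U = (\int[P]_x ((W x + D)%:E * (\1_U (Z x))%:E))%E.
  move=> mU; rewrite /eta /eta0 /mscale/= /pushforward.
  have mi : measurable_fun setT (fun w => \1_U (Z w) : R).
    by apply: measurableT_comp.
  have ii : P.-integrable setT (fun w => (\1_U (Z w) : R)%:E).
    by apply: (@bounded_integrable _ _ _ _ _ 1) => // w;
       rewrite indicE; case: (_ \in _); rewrite ?normr1 ?normr0.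
  have iWi : P.-integrable setT (fun w => (W w * \1_U (Z w))%:E).
    apply: (@bounded_integrable _ _ _ _ _ (D * 1)) => //.
      exact: measurable_funM.
    move=> w; rewrite normrM ler_pM// indicE; case: (_ \in _); rewrite ?normr1 ?normr0//.
  have PU : (\int[P]_w (\1_U (Z w))%:E = P (Z @^-1` U))%E.
    have mZU : measurable (Z @^-1` U).
      by rewrite -[X in measurable X]setTI; exact: mZ.
    transitivity (\int[P]_w (\1_(Z @^-1` U) w)%:E)%E.
      by apply: eq_integral => w _; rewrite !indicE.
    by rewrite integral_indic// setIT.
  have Pfin : P (Z @^-1` U) \is a fin_num.
    by rewrite -PU; exact: (integrable_fin_num _ ii).
  transitivity ((c + D)%:E * P (Z @^-1` U))%E; first by [].
  rewrite -(fineK Pfin) -EFinM.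
  have -> : (c + D) * fine (P (Z @^-1` U)) =
      \int[P]_w (W w * \1_U (Z w)) + D * \int[P]_w (\1_U (Z w)).
    by rewrite WZ// /Rintegral PU mulrDl.
  rewrite -RintegralZl// -RintegralD//; last first.
    by have := integrableZl measurableT D ii; apply: eq_integrable.
  rewrite /Rintegral fineK; first by apply: eq_integral => w _; rewrite -EFinM mulrDl.
  apply: integrable_fin_num => //.
  have := integrableD measurableT iWi (integrableZl measurableT D ii).
  by apply: eq_integrable => // w _; rewrite /= EFinD EFinM.
have := @ge0_integral_weighted _ _ _ P (fun w => W w + D)
  (measurable_funD mW (measurable_cst _)) WD0 _ _ Z eta (fun z => (H z + E)%:E) mZ etaE.
have mHEp : measurable_fun setT (fun z => (H z + E)%:E).
  by apply/measurable_EFinP; apply: measurable_funD.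
move=> /(_ mHEp); have HE0' z : (0 <= (H z + E)%:E)%E by rewrite lee_fin.
move=> /(_ HE0').
rewrite ge0_integral_mscale//= ge0_integral_pushforward//=.
rewrite preimage_setT => /(congr1 fine).
have iHEp : P.-integrable setT (fun w => (H (Z w) + E)%:E).
  have := integrableD measurableT iH (icst E).
  by apply: eq_integrable => // w _; rewrite /= EFinD.
rewrite fineM//; last exact: (integrable_fin_num _ iHEp).
have -> : fine (\int[P]_x (H (Z x) + E)%:E) = \int[P]_w H (Z w) + E.
  by rewrite -[X in _ + X](Rintegral_cst1 P) -RintegralD//; exact: icst.
rewrite /=.
have -> : fine (\int[P]_x ((W x + D)%:E * (H (Z x) + E)%:E)) =
   \int[P]_w (W w * H (Z w)) + (E * \int[P]_w W w + (D * \int[P]_w H (Z w) + D * E)).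
  have iEW : P.-integrable setT (fun w => (E * W w)%:E).
    by have := integrableZl measurableT E iW; apply: eq_integrable.
  have iDH : P.-integrable setT (fun w => (D * H (Z w))%:E).
    by have := integrableZl measurableT D iH; apply: eq_integrable.
  have i1 : P.-integrable setT (fun w => (D * H (Z w) + D * E)%:E).
    have := integrableD measurableT iDH (icst (D * E)).
    by apply: eq_integrable => // w _; rewrite /= EFinD.
  have i2 : P.-integrable setT (fun w => (E * W w + (D * H (Z w) + D * E))%:E).
    have := integrableD measurableT iEW i1.
    by apply: eq_integrable => // w _; rewrite /= EFinD.
  rewrite -!RintegralZl// -[D * E](Rintegral_cst1 P) -!RintegralD//; last exact: icst.
  by rewrite /Rintegral; congr fine; apply: eq_integral => w _; rewrite -EFinM; congr (_%:E); ring.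
rewrite cE => h; lra.
Qed.

End decoupling.

Section independent_sums.
Context d (T : measurableType d) d' (T' : measurableType d') (R : realType).
Variables (P : probability T R) (k : nat) (X : 'I_k -> T -> T').
Hypothesis mX : forall i, measurable_fun setT (X i).
Hypothesis indep : mutually_independent P X.
Variables (h : 'I_k -> T' -> R) (a b : 'I_k -> R).
Hypothesis mh : forall i, measurable_fun setT (h i).
Hypothesis cosE : forall i, \int[P]_w cos (h i (X i w)) = expR (a i) * cos (b i).
Hypothesis sinE : forall i, \int[P]_w sin (h i (X i w)) = expR (a i) * sin (b i).

(** State [j] of an interpolation: indices below [j] contribute their phase to [S], those from [j]
    on contribute the indicator of [B i] to [V]; [A], [C] and [Q] are the matching exponents, phases
    and probabilities. *)
Let S j w := \sum_(i < k | (i < j)%N) h i (X i w).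
Let V (B : 'I_k -> set T') j w : R := \prod_(i < k | (j <= i)%N) \1_(B i) (X i w).
Let Q (B : 'I_k -> set T') j := \prod_(i < k | (j <= i)%N) fine (P (X i @^-1` B i)).
Let A j := \sum_(i < k | (i < j)%N) a i.
Let C j := \sum_(i < k | (i < j)%N) b i.


Let mS j : measurable_fun setT (S j).
Proof.
rewrite (_ : S j = fun w => \sum_(i <- [seq i : 'I_k <- index_enum 'I_k | (i < j)%N]) h i (X i w)).
  by apply: measurable_sum => i; exact: measurableT_comp.
by apply/funext => w; rewrite big_filter.
Qed.

Let mV B j : (forall i, measurable (B i)) -> measurable_fun setT (V B j).
Proof.
move=> mB.
rewrite (_ : V B j = fun w => \prod_(i <- [seq i : 'I_k <- index_enum 'I_k | (j <= i)%N]) (\1_(B i) (X i w) : R)).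
  apply: measurable_prod => i _.
  exact: (measurableT_comp (f := (\1_(B i) : T' -> R))).
by apply/funext => w; rewrite big_filter.
Qed.

Let V1 B j w : `|V B j w| <= 1.
Proof.
rewrite /V normr_prod; apply: prodr_ile1 => i _.
by rewrite indicE; case: (_ \in _); rewrite ?normr1 ?normr0 ?lexx ?ler01.
Qed.

Let cosS_le B j j' w : `|cos (S j w) * V B j' w| <= 1.
Proof. by rewrite normrM mulr_ile1//; exact: norm_cos_le1. Qed.

Let sinS_le B j j' w : `|sin (S j w) * V B j' w| <= 1.
Proof. by rewrite normrM mulr_ile1//; exact: norm_sin_le1. Qed.

Let ltnS_neq j (jk : (j < k)%N) (i : 'I_k) :
  ((i < j.+1)%N && (i != Ordinal jk)) = (i < j)%N.
Proof. by rewrite ltnS -val_eqE /= [RHS]ltn_neqAle andbC. Qed.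

Let leq_neq j (jk : (j < k)%N) (i : 'I_k) :
  ((j <= i)%N && (i != Ordinal jk)) = (j < i)%N.
Proof. by rewrite -val_eqE /= [RHS]ltn_neqAle andbC eq_sym. Qed.

(* The indicators are replaced by the exponentials one index at a time. *)
Let interpolate j : (j <= k)%N -> forall B, (forall i, measurable (B i)) ->
  \int[P]_w (cos (S j w) * V B j w) = expR (A j) * cos (C j) * Q B j /\
  \int[P]_w (sin (S j w) * V B j w) = expR (A j) * sin (C j) * Q B j.
Proof.
elim: j => [|j IH] jk B mB.
  have S0 w : S 0 w = 0 by rewrite /S big_pred0.
  rewrite /A /C !big_pred0// expR0 cos0 sin0 !mul1r mul0r.
  split; last first.
    by under eq_Rintegral do rewrite S0 sin0 mul0r; rewrite Rintegral_cst1.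
  under eq_Rintegral do rewrite S0 cos0 mul1r.
  have mcap : measurable (\bigcap_(i in setT) X i @^-1` B i).
    apply: fin_bigcap_measurable => // i _.
    by rewrite -[X in measurable X]setTI; exact: mX.
  have VE : (fun w => V B 0 w) = \1_(\bigcap_(i in setT) X i @^-1` B i).
    apply/funext => w; rewrite /V /=.
    have [h1|h1] := pselect (forall i, B i (X i w)).
      have -> : \1_(\bigcap_(i in setT) X i @^-1` B i) w = 1 :> R.
        by rewrite indicE mem_set// => i _; exact: h1.
      by rewrite big1// => i _; rewrite indicE mem_set//; exact: h1.
    have -> : \1_(\bigcap_(i in setT) X i @^-1` B i) w = 0 :> R.
      by rewrite indicE memNset// => H; apply: h1 => i; exact: H.
    have /existsNP[i Bi] := h1.
    by rewrite (bigD1 i)//= indicE memNset// mul0r.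
  rewrite VE /Rintegral integral_indic// setIT.
  by apply: (etrans (congr1 fine (indep mB))); rewrite /Q.
have {}IH := IH (ltnW jk).
pose jo := Ordinal jk.
have SE w : S j.+1 w = S j w + h jo (X jo w).
  rewrite /S (bigD1 jo)//= addrC; congr (_ + _).
  by apply: eq_bigl => i; exact: ltnS_neq.
have AE : A j.+1 = A j + a jo.
  rewrite /A (bigD1 jo)//= addrC; congr (_ + _).
  by apply: eq_bigl => i; exact: ltnS_neq.
have CE : C j.+1 = C j + b jo.
  rewrite /C (bigD1 jo)//= addrC; congr (_ + _).
  by apply: eq_bigl => i; exact: ltnS_neq.
have VE B' U w : (forall i, i != jo -> B' i = B i) -> B' jo = U ->
    V B' j w = V B j.+1 w * \1_U (X jo w).
  move=> BB <-; rewrite /V (bigD1 jo)//= mulrC; congr (_ * _).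
  transitivity (\prod_(i < k | (j < i)%N && (i != jo)) (\1_(B' i) (X i w) : R)).
    apply: eq_bigl => i; rewrite -(leq_neq jk i) -andbA.
    by case: (i != _); rewrite ?andbF ?andbT.
  transitivity (\prod_(i < k | (j < i)%N && (i != jo)) (\1_(B i) (X i w) : R)).
    by apply: eq_bigr => i /andP[_ ij]; rewrite BB.
  apply: eq_bigl => i; rewrite -(leq_neq jk i) -andbA.
  by case: (i != _); rewrite ?andbF ?andbT.
have QE B' U : (forall i, i != jo -> B' i = B i) -> B' jo = U ->
    Q B' j = Q B j.+1 * fine (P (X jo @^-1` U)).
  move=> BB <-; rewrite /Q (bigD1 jo)//= mulrC; congr (_ * _).
  transitivity (\prod_(i < k | (j < i)%N && (i != jo)) fine (P (X i @^-1` B' i))).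
    apply: eq_bigl => i; rewrite -(leq_neq jk i) -andbA.
    by case: (i != _); rewrite ?andbF ?andbT.
  transitivity (\prod_(i < k | (j < i)%N && (i != jo)) fine (P (X i @^-1` B i))).
    by apply: eq_bigr => i /andP[_ ij]; rewrite BB.
  apply: eq_bigl => i; rewrite -(leq_neq jk i) -andbA.
  by case: (i != _); rewrite ?andbF ?andbT.
(* The induction hypothesis holds for every family [B]; letting the set at [jo] be an arbitrary [U]
   yields the hypothesis [WZ] of [decoupling]. *)
pose B2 U i := if i == jo then U else B i.
have B2E U i : i != jo -> B2 U i = B i by rewrite /B2 => /negbTE ->.
have B2j U : B2 U jo = U by rewrite /B2 eqxx.
have mB2 U : measurable U -> forall i, measurable (B2 U i).
  by move=> mU i; rewrite /B2; case: ifP.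
have mc j' : measurable_fun setT (fun w => cos (S j w) * V B j' w).
  by apply: measurable_funM; [exact/measurable_cos_comp/mS|exact: mV].
have ms j' : measurable_fun setT (fun w => sin (S j w) * V B j' w).
  by apply: measurable_funM; [exact/measurable_sin_comp/mS|exact: mV].
have dec_cos := @decoupling _ _ _ _ _ P (fun w => cos (S j w) * V B j.+1 w) (X jo)
  (expR (A j) * cos (C j) * Q B j.+1) 1 (mc _) (@cosS_le B j j.+1) (mX jo).
have dec_sin := @decoupling _ _ _ _ _ P (fun w => sin (S j w) * V B j.+1 w) (X jo)
  (expR (A j) * sin (C j) * Q B j.+1) 1 (ms _) (@sinS_le B j j.+1) (mX jo).
have hc : forall U, measurable U ->
   \int[P]_w (cos (S j w) * V B j.+1 w * \1_U (X jo w)) =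
   expR (A j) * cos (C j) * Q B j.+1 * fine (P (X jo @^-1` U)).
  move=> U mU; have [Hc _] := IH _ (mB2 _ mU).
  rewrite -[RHS]mulrA -(QE (B2 U) U (@B2E U) (B2j U)) -Hc.
  by apply: eq_Rintegral => w _; rewrite -mulrA (VE (B2 U) U w (@B2E U) (B2j U)).
have hs : forall U, measurable U ->
   \int[P]_w (sin (S j w) * V B j.+1 w * \1_U (X jo w)) =
   expR (A j) * sin (C j) * Q B j.+1 * fine (P (X jo @^-1` U)).
  move=> U mU; have [_ Hc] := IH _ (mB2 _ mU).
  rewrite -[RHS]mulrA -(QE (B2 U) U (@B2E U) (B2j U)) -Hc.
  by apply: eq_Rintegral => w _; rewrite -mulrA (VE (B2 U) U w (@B2E U) (B2j U)).
have mch := measurable_cos_comp (mh jo).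
have msh := measurable_sin_comp (mh jo).
have ch1 z := @norm_cos_le1 R (h jo z).
have sh1 z := @norm_sin_le1 R (h jo z).
have icc : P.-integrable setT (fun w => (cos (S j w) * V B j.+1 w * cos (h jo (X jo w)))%:E).
  apply: (@bounded_integrable _ _ _ _ _ 1).
    by apply: measurable_funM => //; exact: (measurableT_comp mch).
  by move=> w; rewrite normrM mulr_ile1.
have iss : P.-integrable setT (fun w => (sin (S j w) * V B j.+1 w * sin (h jo (X jo w)))%:E).
  apply: (@bounded_integrable _ _ _ _ _ 1).
    by apply: measurable_funM => //; exact: (measurableT_comp msh).
  by move=> w; rewrite normrM mulr_ile1.
have ics : P.-integrable setT (fun w => (cos (S j w) * V B j.+1 w * sin (h jo (X jo w)))%:E).
  apply: (@bounded_integrable _ _ _ _ _ 1).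
    by apply: measurable_funM => //; exact: (measurableT_comp msh).
  by move=> w; rewrite normrM mulr_ile1.
have isc : P.-integrable setT (fun w => (sin (S j w) * V B j.+1 w * cos (h jo (X jo w)))%:E).
  apply: (@bounded_integrable _ _ _ _ _ 1).
    by apply: measurable_funM => //; exact: (measurableT_comp mch).
  by move=> w; rewrite normrM mulr_ile1.
rewrite AE CE expRD cosD sinD; split.
- transitivity (\int[P]_w (cos (S j w) * V B j.+1 w * cos (h jo (X jo w)) -
      sin (S j w) * V B j.+1 w * sin (h jo (X jo w)))).
    by apply: eq_Rintegral => w _; rewrite SE cosD; ring.
  rewrite RintegralB// (dec_cos hc _ 1 mch ch1) (dec_sin hs _ 1 msh sh1) cosE sinE; ring.
- transitivity (\int[P]_w (sin (S j w) * V B j.+1 w * cos (h jo (X jo w)) +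
      cos (S j w) * V B j.+1 w * sin (h jo (X jo w)))).
    by apply: eq_Rintegral => w _; rewrite SE sinD; ring.
  rewrite RintegralD// (dec_sin hs _ 1 mch ch1) (dec_cos hc _ 1 msh sh1) cosE sinE; ring.
Qed.

Lemma independent_cos_sum :
  \int[P]_w cos (\sum_i h i (X i w)) = expR (\sum_i a i) * cos (\sum_i b i).
Proof.
have [+ _] := @interpolate k (leqnn k) (fun=> setT) (fun=> measurableT).
rewrite /Q big_pred0 ?mulr1; last by move=> i; rewrite leqNgt ltn_ord.
have full (F : 'I_k -> R) : \sum_(i < k | (i < k)%N) F i = \sum_i F i.
  by apply: eq_bigl => i; rewrite ltn_ord.
rewrite /A /C !full => <-; apply: eq_Rintegral => w _.
rewrite /S full (_ : V _ k w = 1) ?mulr1//.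
by rewrite /V big_pred0// => i; rewrite leqNgt ltn_ord.
Qed.

Lemma independent_sin_sum :
  \int[P]_w sin (\sum_i h i (X i w)) = expR (\sum_i a i) * sin (\sum_i b i).
Proof.
have [_ +] := @interpolate k (leqnn k) (fun=> setT) (fun=> measurableT).
rewrite /Q big_pred0 ?mulr1; last by move=> i; rewrite leqNgt ltn_ord.
have full (F : 'I_k -> R) : \sum_(i < k | (i < k)%N) F i = \sum_i F i.
  by apply: eq_bigl => i; rewrite ltn_ord.
rewrite /A /C !full => <-; apply: eq_Rintegral => w _.
rewrite /S full (_ : V _ k w = 1) ?mulr1//.
by rewrite /V big_pred0// => i; rewrite leqNgt ltn_ord.
Qed.

End independent_sums.

(** * Exponential series with a phase, and the Poisson law *)

Section exponential_series.
Context {R : realType}.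
Variable c : R.

(** The two series are the real and imaginary parts of [exp (x e^(i c))]. They are identified
    through the linear differential system they satisfy, whose matrix is multiplication by
    [e^(i c)]. *)
Let ccoef (n : nat) : R := cos (n%:R * c) / n`!%:R.
Let scoef (n : nat) : R := sin (n%:R * c) / n`!%:R.

Let is_cvg_bounded_exp (h : nat -> R) (x : R) : (forall n, `|h n| <= 1) ->
  cvgn (pseries (fun n => h n / n`!%:R) x).
Proof.
move=> h1; apply: normed_cvg.
apply: (series_le_cvg (v_ := exp_coeff `|x|)).
- by move=> n /=.
- by move=> n; exact: exp_coeff_ge0.
- move=> n /=; rewrite /exp_coeff /= !normrM normrX normfV (ger0_norm (ler0n _ _)).
  by rewrite mulrC ler_wpM2l ?exprn_ge0// ler_piMl ?invr_ge0 ?ler0n.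
- exact: is_cvg_series_exp_coeff.
Qed.

Let diffsE (h : nat -> R) : pseries_diffs (fun n => h n / n`!%:R) = (fun n => h n.+1 / n`!%:R).
Proof.
apply/funext => n; rewrite /pseries_diffs factS natrM; field.
apply/andP; split; first by rewrite pnatr_eq0 -lt0n fact_gt0.
by rewrite addrC natr1 pnatr_eq0.
Qed.

Let is_derive_bounded_exp (h : nat -> R) (x : R) : (forall n, `|h n| <= 1) ->
  is_derive x (1 : R) (fun x => limn (pseries (fun n => h n / n`!%:R) x))
    (limn (pseries (fun n => h n.+1 / n`!%:R) x)).
Proof.
move=> h1; rewrite -diffsE; apply: (@pseries_snd_diffs _ _ (`|x| + 1)).
- exact: is_cvg_bounded_exp.
- by rewrite diffsE; exact: (@is_cvg_bounded_exp (fun n => h n.+1)).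
- rewrite diffsE (diffsE (fun n => h n.+1)).
  exact: (@is_cvg_bounded_exp (fun n => h n.+2)).
- by rewrite [ltRHS]ger0_norm ?addr_ge0// ltrDl.
Qed.

Let U x := limn (pseries ccoef x).
Let V x := limn (pseries scoef x).

Let cos1 (n : nat) : `|cos (n%:R * c)| <= 1.
Proof. by rewrite ler_norml cos_geN1 cos_le1. Qed.
Let sin1 (n : nat) : `|sin (n%:R * c)| <= 1.
Proof. by rewrite ler_norml sin_geN1 sin_le1. Qed.

Let dU x : is_derive x (1 : R) U (cos c * U x - sin c * V x).
Proof.
have := is_derive_bounded_exp x cos1.
rewrite (_ : limn _ = cos c * U x - sin c * V x)//.
have cU : cvgn (pseries ccoef x) by exact: is_cvg_bounded_exp.
have cV : cvgn (pseries scoef x) by exact: is_cvg_bounded_exp.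
apply/cvg_lim => //.
rewrite (_ : pseries _ x = (fun n => cos c * pseries ccoef x n - sin c * pseries scoef x n)).
  by apply: cvgB; apply: cvgM => //; exact: cvg_cst.
apply/funext => n; rewrite /pseries /series/= !mulr_sumr -sumrB.
apply: eq_bigr => i _; rewrite /ccoef /scoef -natr1 mulrDl mul1r cosD; ring.
Qed.

Let dV x : is_derive x (1 : R) V (sin c * U x + cos c * V x).
Proof.
have := is_derive_bounded_exp x sin1.
rewrite (_ : limn _ = sin c * U x + cos c * V x)//.
have cU : cvgn (pseries ccoef x) by exact: is_cvg_bounded_exp.
have cV : cvgn (pseries scoef x) by exact: is_cvg_bounded_exp.
apply/cvg_lim => //.
rewrite (_ : pseries _ x = (fun n => sin c * pseries ccoef x n + cos c * pseries scoef x n)).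
  by apply: cvgD; apply: cvgM => //; exact: cvg_cst.
apply/funext => n; rewrite /pseries /series/= !mulr_sumr -big_split/=.
apply: eq_bigr => i _; rewrite /ccoef /scoef -natr1 mulrDl mul1r sinD; ring.
Qed.

Let U0 : U 0 = 1.
Proof.
apply/cvg_lim => //; rewrite -cvg_shiftS /=.
rewrite (_ : (fun n => _) = fun=> 1); first exact: cvg_cst.
apply/funext => n; rewrite /pseries /series/= big_nat_recl//= /ccoef.
rewrite mul0r cos0 fact0 expr0 divr1 mulr1 big1 ?addr0// => i _.
by rewrite expr0n/= mulr0.
Qed.

Let V0 : V 0 = 0.
Proof.
apply/cvg_lim => //; rewrite -cvg_shiftS /=.
rewrite (_ : (fun n => _) = fun=> 0); first exact: cvg_cst.
apply/funext => n; rewrite /pseries /series/= big_nat_recl//= /scoef.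
rewrite mul0r sin0 mul0r mul0r big1 ?addr0// => i _.
by rewrite expr0n/= mulr0.
Qed.

Let E x : R := expR (- cos c * x).
Let dE x : is_derive x (1 : R) E (- cos c * E x).
Proof.
rewrite /E; apply: is_derive_eq.
by rewrite /GRing.scale /=; ring.
Qed.

Let Cx x : R := cos (sin c * x).
Let dC x : is_derive x (1 : R) Cx (- sin c * sin (sin c * x)).
Proof.
rewrite /Cx; apply: is_derive_eq.
by rewrite /GRing.scale /=; ring.
Qed.

Let Sx x : R := sin (sin c * x).
Let dS x : is_derive x (1 : R) Sx (sin c * cos (sin c * x)).
Proof.
rewrite /Sx; apply: is_derive_eq.
by rewrite /GRing.scale /=; ring.
Qed.

(** The real part of [exp (- x e^(i c)) (U + i V)], which is constant along the system;
    [second_integral] is its imaginary part. Together they determine [U] and [V]. *)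
Let first_integral x : E x * (U x * Cx x + V x * Sx x) = 1.
Proof.
have -> : 1 = E 0 * (U 0 * Cx 0 + V 0 * Sx 0).
  by rewrite /E /Cx /Sx U0 V0 !mulr0 cos0 expR0 mul0r addr0 !mulr1.
apply: (@is_derive_0_is_cst _ (fun x => E x * (U x * Cx x + V x * Sx x))) => y.
have /is_derive_eq := is_deriveM (dE y) (is_deriveD (is_deriveM (dU y) (dC y))
  (is_deriveM (dV y) (dS y))); apply.
rewrite (_ : (U * Cx + V * Sx) y = U y * Cx y + V y * Sx y)//.
by rewrite /GRing.scale /= /Cx /Sx; ring.
Qed.

Let second_integral x : E x * (V x * Cx x - U x * Sx x) = 0.
Proof.
have -> : 0 = E 0 * (V 0 * Cx 0 - U 0 * Sx 0).
  by rewrite /E /Cx /Sx U0 V0 !mulr0 sin0 mulr0 mul0r subrr mulr0.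
apply: (@is_derive_0_is_cst _ (fun x => E x * (V x * Cx x - U x * Sx x))) => y.
have /is_derive_eq := is_deriveM (dE y) (is_deriveB (is_deriveM (dV y) (dC y))
  (is_deriveM (dU y) (dS y))); apply.
rewrite (_ : (V * Cx - U * Sx) y = V y * Cx y - U y * Sx y)//.
by rewrite /GRing.scale /= /Cx /Sx; ring.
Qed.

Let EN x : E x * expR (x * cos c) = 1.
Proof. by rewrite /E -expRD (_ : _ + _ = 0) ?expR0//; ring. Qed.

Lemma cvg_cos_exp_series x :
  series (fun n => cos (n%:R * c) * x ^+ n / n`!%:R) @ \oo -->
  expR (x * cos c) * cos (x * sin c).
Proof.
have -> : expR (x * cos c) * cos (x * sin c) = U x.
  have h1 := first_integral x; have h2 := second_integral x; have h3 := EN x.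
  have h4 := cos2Dsin2 (sin c * x).
  rewrite /Cx /Sx in h1 h2; rewrite (mulrC x (sin c)).
  apply: (@mulfI _ (E x)); first by rewrite gt_eqF// expR_gt0.
  transitivity (cos (sin c * x)); first by rewrite mulrA h3 mul1r.
  transitivity (E x * U x * (cos (sin c * x) ^+ 2 + sin (sin c * x) ^+ 2)); last by rewrite h4 mulr1.
  rewrite -[LHS]mulr1 -{1}h1 -[LHS]subr0 -(mulr0 (sin (sin c * x))) -{1}h2; ring.
have : cvgn (pseries ccoef x) by exact: is_cvg_bounded_exp.
rewrite (_ : series _ = pseries ccoef x)//.
by apply/funext => n; rewrite /pseries /series/=; apply: eq_bigr => i _; rewrite /ccoef mulrAC.
Qed.

Lemma cvg_sin_exp_series x :
  series (fun n => sin (n%:R * c) * x ^+ n / n`!%:R) @ \oo -->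
  expR (x * cos c) * sin (x * sin c).
Proof.
have -> : expR (x * cos c) * sin (x * sin c) = V x.
  have h1 := first_integral x; have h2 := second_integral x; have h3 := EN x.
  have h4 := cos2Dsin2 (sin c * x).
  rewrite /Cx /Sx in h1 h2; rewrite (mulrC x (sin c)).
  apply: (@mulfI _ (E x)); first by rewrite gt_eqF// expR_gt0.
  transitivity (sin (sin c * x)); first by rewrite mulrA h3 mul1r.
  transitivity (E x * V x * (cos (sin c * x) ^+ 2 + sin (sin c * x) ^+ 2)); last by rewrite h4 mulr1.
  rewrite -[LHS]mulr1 -{1}h1 -[LHS]addr0 -(mulr0 (cos (sin c * x))) -{1}h2; ring.
have : cvgn (pseries scoef x) by exact: is_cvg_bounded_exp.
rewrite (_ : series _ = pseries scoef x)//.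
by apply/funext => n; rewrite /pseries /series/=; apply: eq_bigr => i _; rewrite /scoef mulrAC.
Qed.

End exponential_series.

Section poisson_law.
Context d (T : measurableType d) {R : realType} (P : probability T R).
Variables (X : T -> \bar R) (m : R).
Hypotheses (mX : measurable_fun setT X) (m0 : 0 <= m).
Hypothesis PX : has_poisson_law P X m%:E.

Let p n := expR (- m) * m ^+ n / n`!%:R.
Let A n := [set w | X w = n%:R%:E].

Let mA n : measurable (A n).
Proof.
by have := @mX measurableT [set n%:R%:E] (emeasurable_set1 n%:R%:E); rewrite setTI.
Qed.

Let PA n : P (A n) = (p n)%:E.
Proof. by move: PX; rewrite /has_poisson_law; exact. Qed.

Let sum_p : series p @ \oo --> (1 : R).
Proof.
have -> : (1 : R) = expR (- m) * expR m by rewrite mulrC expRxMexpNx_1.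
have -> : expR m = limn (pseries (fun n => n`!%:R^-1) m) by rewrite expRE.
rewrite (_ : series p = (fun n => expR (- m) * pseries (fun n => n`!%:R^-1) m n)).
  apply: cvgM; first exact: cvg_cst.
  have := is_cvg_series_exp_coeff m.
  rewrite (_ : series (exp_coeff m) = pseries (fun n => n`!%:R^-1) m)//.
  by apply/funext => n; rewrite /series /pseries /series/=; apply: eq_bigr => i _; rewrite mulrC.
apply/funext => n; rewrite /series /pseries /series/= mulr_sumr; apply: eq_bigr => i _.
by rewrite /p; ring.
Qed.

Let A_inj n n' w : A n w -> A n' w -> n = n'.
Proof.
by rewrite /A /= => -> [] /eqP; rewrite eqr_nat => /eqP.
Qed.

Let sum_indic (H : nat -> R) N w n : A n w ->
  \sum_(0 <= i < N) H i * \1_(A i) w = if (n < N)%N then H n else 0.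
Proof.
move=> An; case: ltnP => nN.
  rewrite (bigD1_seq n) ?mem_index_iota ?iota_uniq//=.
  rewrite indicE mem_set// mulr1 big1 ?addr0// => i ni.
  rewrite indicE memNset ?mulr0// => Ai; move/eqP : ni; apply; exact: A_inj Ai An.
rewrite big_nat_cond big1// => i; rewrite andbT => /andP[_ iN].
rewrite indicE memNset ?mulr0// => Ai.
by move: (A_inj Ai An) iN => ->; rewrite ltnNge nN.
Qed.

Let sum_indic0 (H : nat -> R) N w : (forall n, ~ A n w) ->
  \sum_(0 <= i < N) H i * \1_(A i) w = 0.
Proof.
by move=> nA; rewrite big1// => i _; rewrite indicE memNset ?mulr0//; exact: nA.
Qed.

Let int_indic i : P.-integrable setT (EFin \o (\1_(A i) : T -> R)).
Proof.
apply: (@bounded_integrable _ _ _ _ _ 1) => //.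
by move=> w; rewrite indicE; case: (_ \in _); rewrite ?normr1 ?normr0.
Qed.

Let int_sum (H : nat -> R) N : P.-integrable setT (EFin \o (fun w => \sum_(0 <= i < N) H i * \1_(A i) w)) /\
  \int[P]_w (\sum_(0 <= i < N) H i * \1_(A i) w) = \sum_(0 <= i < N) H i * p i.
Proof.
elim: N => [|N [IH1 IH2]].
  split.
    apply: (@bounded_integrable _ _ _ _ _ 0); first by rewrite (_ : (fun w => _) = cst 0)//; apply/funext => w; rewrite big_nil.
    by move=> w; rewrite big_nil normr0.
  by rewrite big_nil; under eq_Rintegral do rewrite big_nil; rewrite Rintegral_cst1.
have iH : P.-integrable setT (EFin \o (fun w => H N * \1_(A N) w)).
  by have := integrableZl measurableT (H N) (int_indic N); apply: eq_integrable.
split.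
  have := integrableD measurableT IH1 iH; apply: eq_integrable => // w _.
  by rewrite /= big_nat_recr//= EFinD.
rewrite big_nat_recr//= -IH2.
under eq_Rintegral do rewrite big_nat_recr//=.
rewrite RintegralD// RintegralZl//; congr (_ + _ * _).
by rewrite /Rintegral integral_indic// setIT; exact: (congr1 fine (PA N)).
Qed.

(** The error after [N] terms is dominated by [1] minus the indicators of the events [X = n] with
    [n < N], whose integral tends to 0 because the weights sum to 1. The event that [X] is not an
    integer is dominated in the same way and needs no separate treatment. *)
Lemma poisson_law_cvg (H : R -> R) : measurable_fun setT H -> (forall x, `|H x| <= 1) ->
  series (fun n => H n%:R * p n) @ \oo --> \int[P]_w H (fine (X w)).
Proof.
move=> mH H1.
have mHX : measurable_fun setT (fun w => H (fine (X w))).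
  apply: measurableT_comp => //; exact: (measurableT_comp (fine_measurable measurableT)).
have iHX : P.-integrable setT (fun w => (H (fine (X w)))%:E).
  by apply: (@bounded_integrable _ _ _ _ _ 1).
apply/cvgrPdist_le => e e0.
have /cvgrPdist_le/(_ e e0) := sum_p; apply: filterS => N hN.
apply: le_trans hN.
have [i1 e1] := int_sum (fun n => H n%:R) N.
have [i2 e2] := int_sum (fun=> 1) N.
rewrite /series /= -e1 -RintegralB//.
have -> : \sum_(0 <= k < N) p k = \sum_(0 <= k < N) 1 * p k.
  by apply: eq_bigr => i _; rewrite mul1r.
rewrite -e2 -[X in `|X - _|](Rintegral_cst1 P) -RintegralB//; last first.
  by apply: (@bounded_integrable _ _ _ _ _ 1) => // w; rewrite normr1.
apply: le_trans (ler_norm _).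
apply: le_norm_Rintegral.
- by apply: measurable_funB => //; have /measurable_int/measurable_EFinP := i1.
- move=> w; have [[n An]|nA] := pselect (exists n, A n w).
    rewrite !(sum_indic _ _ An); case: ifPn => nN; last by rewrite !subr0.
    have -> : fine (X w) = n%:R by rewrite An.
    by rewrite !subrr normr0.
  have {}nA n : ~ A n w by move=> An; apply: nA; exists n.
  by rewrite !sum_indic0// !subr0.
- have ic : P.-integrable setT (EFin \o (fun=> 1)).
    by apply: (@bounded_integrable _ _ _ _ _ 1) => // w; rewrite normr1.
  have := integrableB measurableT ic i2; apply: eq_integrable => // w _.
Qed.

Lemma poisson_law_cos c :
  \int[P]_w cos (c * fine (X w)) = expR (m * (cos c - 1)) * cos (m * sin c).
Proof.
have mH : measurable_fun setT (fun x : R => cos (c * x)).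
  apply: measurableT_comp; first exact: continuous_measurable_fun (@continuous_cos R).
  exact: measurable_funM.
have H1 (x : R) : `|cos (c * x)| <= 1 by rewrite ler_norml cos_geN1 cos_le1.
apply: cvg_unique (poisson_law_cvg mH H1) _ => //.
have -> : expR (m * (cos c - 1)) * cos (m * sin c) =
    expR (- m) * (expR (m * cos c) * cos (m * sin c)).
  by rewrite mulrA -expRD; congr (expR _ * _); ring.
rewrite (_ : series _ = (fun N => expR (- m) *
    series (fun n => cos (n%:R * c) * m ^+ n / n`!%:R) N)).
  by apply: cvgM; [exact: cvg_cst|exact: cvg_cos_exp_series].
apply/funext => N; rewrite /series/= mulr_sumr; apply: eq_bigr => i _.
by rewrite /p (mulrC c); ring.
Qed.

Lemma poisson_law_sin c :
  \int[P]_w sin (c * fine (X w)) = expR (m * (cos c - 1)) * sin (m * sin c).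
Proof.
have mH : measurable_fun setT (fun x : R => sin (c * x)).
  apply: measurableT_comp; first exact: continuous_measurable_fun (@continuous_sin R).
  exact: measurable_funM.
have H1 (x : R) : `|sin (c * x)| <= 1 by rewrite ler_norml sin_geN1 sin_le1.
apply: cvg_unique (poisson_law_cvg mH H1) _ => //.
have -> : expR (m * (cos c - 1)) * sin (m * sin c) =
    expR (- m) * (expR (m * cos c) * sin (m * sin c)).
  by rewrite mulrA -expRD; congr (expR _ * _); ring.
rewrite (_ : series _ = (fun N => expR (- m) *
    series (fun n => sin (n%:R * c) * m ^+ n / n`!%:R) N)).
  by apply: cvgM; [exact: cvg_cst|exact: cvg_sin_exp_series].
apply/funext => N; rewrite /series/= mulr_sumr; apply: eq_bigr => i _.
by rewrite /p (mulrC c); ring.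
Qed.

Lemma poisson_law_mean : (forall w, (0 <= X w)%E) -> (\int[P]_w X w = m%:E)%E.
Proof.
move=> X0.
have tA : trivIset setT A.
  by move=> n n' _ _ [w [Aw A'w]]; exact: A_inj Aw A'w.
have mU : measurable (\bigcup_n A n) by exact: bigcup_measurable.
have PU : P (\bigcup_n A n) = 1%E.
  rewrite measure_bigcup//=.
  apply/cvg_lim => //.
  rewrite (_ : (fun n => _) = EFin \o series p).
    by apply: cvg_EFin; [exact: nearW|exact: sum_p].
  apply/funext => n; rewrite /series /= -sumEFin.
  transitivity (\sum_(0 <= i < n) P (A i))%E; last by apply: eq_bigr => i _; exact: PA.
  by apply: eq_bigl => i; rewrite in_setT.
have -> : (\int[P]_w X w = \int[P]_w (\sum_(0 <= n <oo) (n%:R * \1_(A n) w)%:E))%E.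
  apply: ge0_ae_eq_integral => //.
  - by apply: ge0_emeasurable_sum => n; [move=> w _ _; rewrite lee_fin mulr_ge0|move=> _; apply/measurable_EFinP; exact: measurable_funM].
  - by move=> w _; apply: nneseries_ge0 => n _ _; rewrite lee_fin mulr_ge0.
  - exists (~` (\bigcup_n A n)); split; first exact: measurableC.
      transitivity (1 - P (\bigcup_n A n))%E; last by rewrite PU subee.
      exact: probability_setC.
    move=> w /= Hw [n _ An]; apply: Hw => _.
    rewrite An; apply/esym/cvg_lim => //.
    apply: cvg_near_cst; exists n.+1 => // N /= nN.
    by rewrite sumEFin (sum_indic (fun n => n%:R) _ An) nN.
rewrite integral_nneseries//; last first.
  by move=> n; apply/measurable_EFinP; exact: measurable_funM.
apply/cvg_lim => //; rewrite -cvg_shiftS/=.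
rewrite (_ : (fun n => _) = EFin \o (fun n => m * series p n)).
  apply: cvg_EFin; first exact: nearW.
  rewrite -[X in _ --> X]mulr1; apply: cvgM; [exact: cvg_cst|exact: sum_p].
apply/funext => N /=.
transitivity (\sum_(0 <= i < N.+1) i%:R * p i)%:E.
  rewrite -sumEFin; apply: eq_bigr => i _.
  under eq_integral do rewrite EFinM.
  by rewrite (integralZl measurableT (int_indic i)) integral_indic// setIT EFinM; congr (_ * _)%E; exact: PA.
congr (_%:E); rewrite big_nat_recl//= mul0r add0r mulr_sumr.
apply: eq_bigr => i _; rewrite /p factS natrM exprS; field.
apply/andP; split; first by rewrite pnatr_eq0 -lt0n fact_gt0.
by rewrite addrC natr1 pnatr_eq0.
Qed.

End poisson_law.

(** Infinite means are included so that the intensity of every measurable set, of finite measure or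
    not, is the expectation of the random measure. *)
Lemma has_poisson_law_mean d (T : measurableType d) {R : realType} (P : probability T R)
  (X : T -> \bar R) (m : \bar R) : measurable_fun setT X -> (forall w, 0 <= X w)%E ->
  (0 <= m)%E -> has_poisson_law P X m -> (\int[P]_w X w = m)%E.
Proof.
move=> mX X0 m0; case: m m0 => [m m0 PX|_|//]; first exact: poisson_law_mean.
rewrite /has_poisson_law eqxx => Poo.
have mA : measurable [set w | X w = +oo%E].
  by have := @mX measurableT [set +oo%E] (emeasurable_set1 +oo%E); rewrite setTI.
apply/eqP; rewrite -leye_eq.
have <- : (\int[P]_(w in [set w | X w = +oo%E]) X w = +oo)%E.
  transitivity (\int[P]_(w in [set w | X w = +oo]) (cst +oo w))%E.
    by apply: eq_integral => w; rewrite in_setE/=.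
  by rewrite integral_cst// -[RHS]mule1; congr (_ * _)%E; exact: Poo.
by apply: ge0_subset_integral.
Qed.

(** * Lipschitz bounds, finite decompositions and dominated convergence *)

Section trig_lipschitz.
Context {R : realType}.
Implicit Types x y : R.

Lemma lipschitz1 (f f' : R -> R) : (forall x, is_derive x (1 : R) f (f' x)) ->
  (forall x, `|f' x| <= 1) -> forall x y, `|f x - f y| <= `|x - y|.
Proof.
move=> df f'1 x y; wlog xy : x y / y <= x.
  move=> H; have [yx|/ltW xy] := leP y x; first exact: H.
  by rewrite distrC (distrC x); exact: H.
have [|c _ ->] := @MVT_segment _ f f' _ _ xy.
  by apply: derivable_within_continuous => z _; exact: ex_derive.
by rewrite normrM ler_piMl.
Qed.

Lemma cos_lipschitz x y : `|cos x - cos y| <= `|x - y|.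
Proof.
by apply: (@lipschitz1 _ (fun x => - sin x)) => z; rewrite normrN ler_norml sin_geN1 sin_le1.
Qed.

Lemma sin_lipschitz x y : `|sin x - sin y| <= `|x - y|.
Proof.
by apply: (@lipschitz1 _ cos) => z; rewrite ler_norml cos_geN1 cos_le1.
Qed.

Lemma norm_cosB1_le x : `|cos x - 1| <= `|x|.
Proof. by have := cos_lipschitz x 0; rewrite cos0 subr0. Qed.

Lemma norm_sin_le x : `|sin x| <= `|x|.
Proof. by have := sin_lipschitz x 0; rewrite sin0 !subr0. Qed.

End trig_lipschitz.

(** The value [v0], in practice 0, is left out because its level set may have infinite measure. [V]
    is general so as to cover real simple functions as well as vectors of several simple
    functions. *)
Lemma finite_range_decomposition (R : realType) (E : Type) (V : choiceType)
    (s : E -> V) (v0 : V) : finite_set (range s) ->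
  exists k (c : 'I_k -> V), [/\ injective c, (forall i, c i != v0),
    (forall i, range s (c i)) &
    forall (H : V -> R), H v0 = 0 ->
      forall z, H (s z) = \sum_i H (c i) * \1_(s @^-1` [set c i]) z].
Proof.
move=> /finite_fsetP[F FE].
pose r := [seq v <- enum_fset F | v != v0].
have ur : uniq r by rewrite filter_uniq// fset_uniq.
exists (size r), (tnth (in_tuple r)); split.
- by move=> i j; rewrite !(tnth_nth v0) => /eqP; rewrite nth_uniq// => /eqP/val_inj.
- by move=> i; have := mem_tnth i (in_tuple r); rewrite mem_filter => /andP[].
- by move=> i; have := mem_tnth i (in_tuple r); rewrite mem_filter FE => /andP[].
move=> H H0 z.
have [sz|sz] := eqVneq (s z) v0.
  rewrite sz H0 big1// => i _; rewrite indicE memNset ?mulr0//= => szi.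
  have := mem_tnth i (in_tuple r); rewrite mem_filter => /andP[].
  by rewrite -szi sz eqxx.
have szr : s z \in r.
  rewrite mem_filter sz/=.
  by have : range s (s z) by []; rewrite FE.
have /tnthP[i iE] : s z \in in_tuple r by [].
rewrite (bigD1 i)//= indicE mem_set//= mulr1 -iE big1 ?addr0// => j ji.
rewrite indicE memNset ?mulr0//= => szj.
move/eqP : ji; apply; apply/val_inj/eqP.
have := nth_uniq v0 (ltn_ord j) (ltn_ord i) ur.
by rewrite -!(tnth_nth v0 (in_tuple r)) -iE -szj eqxx => <-.
Qed.

Lemma Rintegral_dominated_cvg d (T : measurableType d) (R : realType)
    (m : {measure set T -> \bar R}) (u : nat -> T -> R) (f g : T -> R) :
  (forall n, measurable_fun setT (u n)) -> measurable_fun setT f ->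
  {ae m, forall x, u n x @[n --> \oo] --> f x} ->
  m.-integrable setT (EFin \o g) ->
  {ae m, forall x, forall n, `|u n x| <= g x} ->
  \int[m]_x u n x @[n --> \oo] --> \int[m]_x f x.
Proof.
move=> mu mf uf ig ug.
have emu n : measurable_fun setT (EFin \o u n) by exact/measurable_EFinP.
have emf : measurable_fun setT (EFin \o f) by exact/measurable_EFinP.
have euf : {ae m, forall x, setT x -> (EFin \o u n) x @[n --> \oo] --> (EFin \o f) x}.
  by apply: filterS uf => x ux _; apply: cvg_EFin; [exact: nearW|exact: ux].
have eug : {ae m, forall x n, setT x -> (`|(EFin \o u n) x| <= (EFin \o g) x)%E}.
  by apply: filterS ug => x ux n _; rewrite /= lee_fin; exact: ux.
have [iF _ h] := dominated_convergence measurableT emu emf euf ig eug.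
by apply: fine_cvg; rewrite fineK; [exact: h|exact: integrable_fin_num].
Qed.

Section simple_approximation.
Context d (T : measurableType d) (R : realType) (f : T -> R).
Hypothesis mf : measurable_fun setT f.
Import HBNNSimple HBSimple.

(** Positive and negative parts are approximated from below. The bound by [|f|] makes the level sets
    away from 0 of finite measure and provides the majorant for passing to the limit. *)
Lemma simple_function_approximation : exists u : nat -> T -> R,
  [/\ forall n, measurable_fun setT (u n),
      forall n, finite_set (range (u n)),
      forall n x, `|u n x| <= `|f x| &
      forall x, u n x @[n --> \oo] --> f x].
Proof.
pose fp := f^\+; pose fn := f^\-.
have mfp : measurable_fun setT (EFin \o fp).
  by apply/measurable_EFinP; exact: measurable_funrpos.
have mfn : measurable_fun setT (EFin \o fn).
  by apply/measurable_EFinP; exact: measurable_funrneg.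
have fp0 x : (0 <= (EFin \o fp) x)%E by rewrite lee_fin funrpos_ge0.
have fn0 x : (0 <= (EFin \o fn) x)%E by rewrite lee_fin funrneg_ge0.
pose p := nnsfun_approx measurableT mfp.
pose q := nnsfun_approx measurableT mfn.
have pf n x : p n x <= fp x.
  rewrite -lee_fin /p nnsfun_approxE.
  exact: (@le_approx _ _ _ setT (EFin \o fp) n x).
have qf n x : q n x <= fn x.
  rewrite -lee_fin /q nnsfun_approxE.
  exact: (@le_approx _ _ _ setT (EFin \o fn) n x).
exists (fun n x => p n x - q n x); split.
- by move=> n; apply: measurable_funB.
- move=> n.
  apply: (@sub_finite_set _ _ [set y.1 - y.2 | y in range (p n) `*` range (q n)]).
    by move=> _ [x _ <-]; exists (p n x, q n x) => //; split; exists x.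
  apply: finite_image; apply: finite_setX; exact: fimfunP.
- move=> n x; rewrite (_ : `|f x| = fp x + fn x).
    by rewrite (le_trans (ler_normB _ _))// lerD// ger0_norm.
  by rewrite -[LHS]/((Num.norm \o f) x) -funrposDneg.
- move=> x; rewrite (_ : f x = fp x - fn x); last first.
    by rewrite -[in LHS](funrposBneg f).
  apply: cvgB.
  + have /fine_cvg := @cvg_nnsfun_approx _ _ _ _ measurableT _ mfp (fun x _ => fp0 x) x I.
    exact.
  + have /fine_cvg := @cvg_nnsfun_approx _ _ _ _ measurableT _ mfn (fun x _ => fn0 x) x I.
    exact.
Qed.

End simple_approximation.

(** * Poisson integrals *)

Section poisson_integrals.
Context d (T : measurableType d) d' (E : measurableType d') (R : realType).
Variables (P : probability T R) (N : R.-ker T ~> E) (nu : {measure set E -> \bar R}).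
Hypothesis hN : poisson_random_measure P N nu.

Let mN A : measurable A -> measurable_fun setT (fun w => N w A).
Proof. exact: measurable_kernel. Qed.

(** This exhibits [nu] as the mixture of the random measures [N w], so that Campbell's formula is a
    case of [ge0_integral_mixture]. *)
Let meanN A : measurable A -> nu A = (\int[P]_w N w A)%E.
Proof.
move=> mA; apply/esym/(@has_poisson_law_mean _ _ _ P) => //; first exact: mN.
by have [+ _] := hN; exact.
Qed.

Lemma campbell (f : E -> \bar R) : measurable_fun setT f -> (forall z, 0 <= f z)%E ->
  (\int[nu]_z f z = \int[P]_w \int[N w]_z f z)%E.
Proof. by move=> mf f0; apply: ge0_integral_mixture => //; exact: mN. Qed.

Lemma measurable_poisson_integral (f : E -> \bar R) : measurable_fun setT f ->
  (forall z, 0 <= f z)%E -> measurable_fun setT (fun w => \int[N w]_z f z)%E.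
Proof. by move=> mf f0; apply: measurable_fun_integral_kernel => //; exact: mN. Qed.

Lemma measurable_poisson_Rintegral (f : E -> R) : measurable_fun setT f ->
  measurable_fun setT (fun w => \int[N w]_z f z).
Proof.
move=> mf; rewrite /Rintegral.
apply: (measurableT_comp (fine_measurable measurableT)).
have -> : (fun w => (\int[N w]_z (f z)%:E)%E) =
   (fun w => (\int[N w]_z ((EFin \o f)^\+ z)) - (\int[N w]_z ((EFin \o f)^\- z)))%E.
  by apply/funext => w; rewrite integralE.
have emf : measurable_fun setT (EFin \o f) by exact/measurable_EFinP.
apply: emeasurable_funB; apply: measurable_poisson_integral => //.
- exact: measurable_funepos.
- exact: measurable_funeneg.
Qed.

Section integrable.
Variable f : E -> R.
Hypothesis intf : nu.-integrable setT (EFin \o f).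

Let mf : measurable_fun setT f.
Proof. by have /measurable_int/measurable_EFinP := intf. Qed.

Lemma poisson_integrable : {ae P, forall w, (N w).-integrable setT (EFin \o f)}.
Proof.
have /integrableP[emf foo] := intf.
have mabs : measurable_fun setT (fun z => `|(EFin \o f) z|%E).
  exact: measurableT_comp.
have mI := measurable_poisson_integral mabs (fun z => abse_ge0 _).
have I0 w : (0 <= \int[N w]_z `|(EFin \o f) z|)%E by exact: integral_ge0.
have : P.-integrable setT (fun w => \int[N w]_z `|(EFin \o f) z|)%E.
  apply/integrableP; split => //.
  under eq_integral do rewrite gee0_abs//.
  by rewrite -campbell.
move=> /(integrable_ae measurableT); apply: filterS => w /(_ I) fin.
by apply/integrableP; split => //; rewrite -ge0_fin_numE.
Qed.

(** Campbell's formula is applied to the positive and negative parts; for almost every [w] both are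
    finite under [N w], so passing to real values loses nothing. *)
Lemma poisson_integral_mean :
  (\int[P]_w (\int[N w]_z f z)%R%:E = \int[nu]_z (f z)%:E)%E.
Proof.
have emf : measurable_fun setT (EFin \o f) by exact/measurable_EFinP.
have mp := measurable_funepos emf.
have mn := measurable_funeneg emf.
have p0 z : (0 <= (EFin \o f)^\+ z)%E by [].
have n0 z : (0 <= (EFin \o f)^\- z)%E by [].
have mIp := measurable_poisson_integral mp p0.
have mIn := measurable_poisson_integral mn n0.
have iIp : P.-integrable setT (fun w => \int[N w]_z (EFin \o f)^\+ z)%E.
  apply/integrableP; split => //.
  under eq_integral do rewrite gee0_abs ?integral_ge0//.
  by rewrite -campbell//; exact: integral_funepos_lt_pinfty.
have iIn : P.-integrable setT (fun w => \int[N w]_z (EFin \o f)^\- z)%E.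
  apply/integrableP; split => //.
  under eq_integral do rewrite gee0_abs ?integral_ge0//.
  by rewrite -campbell//; exact: integral_funeneg_lt_pinfty.
rewrite [RHS]integralE (campbell mp p0) (campbell mn n0) -integralB//.
apply: ae_eq_integral => //.
- exact/measurable_EFinP/measurable_poisson_Rintegral.
- exact: emeasurable_funB.
- apply: filterS poisson_integrable => w iw _.
  by rewrite /Rintegral fineK ?integrable_fin_num// integralE.
Qed.

End integrable.

Section simple.
Variables (k : nat) (c : 'I_k -> R) (A : 'I_k -> set E).
Hypotheses (mA : forall i, measurable (A i)) (tA : trivIset setT A)
  (finA : forall i, (nu (A i) < +oo)%E).

Let nuA i : nu (A i) = (fine (nu (A i)))%:E.
Proof. by rewrite fineK// ge0_fin_numE. Qed.

Lemma poisson_simple_cos :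
  \int[P]_w cos (\sum_i c i * fine (N w (A i))) =
  expR (\sum_i fine (nu (A i)) * (cos (c i) - 1)) *
  cos (\sum_i fine (nu (A i)) * sin (c i)).
Proof.
have [law ind] := hN.
apply: (@independent_cos_sum _ _ _ _ _ P k (fun i w => N w (A i)) (fun i => mN (mA i))
  (ind _ _ mA tA) (fun i x => c i * fine x)).
- by move=> i; apply: measurable_funM => //; exact: fine_measurable.
- move=> i; have h : has_poisson_law P (fun w => N w (A i)) (fine (nu (A i)))%:E.
    by rewrite -nuA; exact: law.
  exact: (poisson_law_cos (mN (mA i)) h).
- move=> i; have h : has_poisson_law P (fun w => N w (A i)) (fine (nu (A i)))%:E.
    by rewrite -nuA; exact: law.
  exact: (poisson_law_sin (mN (mA i)) h).
Qed.

Lemma poisson_simple_sin :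
  \int[P]_w sin (\sum_i c i * fine (N w (A i))) =
  expR (\sum_i fine (nu (A i)) * (cos (c i) - 1)) *
  sin (\sum_i fine (nu (A i)) * sin (c i)).
Proof.
have [law ind] := hN.
apply: (@independent_sin_sum _ _ _ _ _ P k (fun i w => N w (A i)) (fun i => mN (mA i))
  (ind _ _ mA tA) (fun i x => c i * fine x)).
- by move=> i; apply: measurable_funM => //; exact: fine_measurable.
- move=> i; have h : has_poisson_law P (fun w => N w (A i)) (fine (nu (A i)))%:E.
    by rewrite -nuA; exact: law.
  exact: (poisson_law_cos (mN (mA i)) h).
- move=> i; have h : has_poisson_law P (fun w => N w (A i)) (fine (nu (A i)))%:E.
    by rewrite -nuA; exact: law.
  exact: (poisson_law_sin (mN (mA i)) h).
Qed.

End simple.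
End poisson_integrals.

Lemma Rintegral_indic_sum d (T : measurableType d) (R : realType)
    (m : {measure set T -> \bar R}) k (c : 'I_k -> R) (A : 'I_k -> set T) :
  (forall i, measurable (A i)) -> (forall i, (m (A i) < +oo)%E) ->
  \int[m]_z (\sum_i c i * \1_(A i) z) = \sum_i c i * fine (m (A i)).
Proof.
move=> mA finA.
have ind i : m.-integrable setT (EFin \o (\1_(A i) : T -> R)).
  apply/integrableP; split; first exact/measurable_EFinP.
  under eq_integral do rewrite gee0_abs ?lee_fin//.
  by rewrite integral_indic// setIT.
rewrite /Rintegral.
transitivity (fine (\sum_i \int[m]_z ((c i * \1_(A i) z)%R%:E))%E).
  rewrite -integral_sum//; last first.
    by move=> i; have := integrableZl measurableT (c i) (ind i); exact: eq_integrable.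
  by congr fine; apply: eq_integral => z _; rewrite sumEFin.
transitivity (fine (\sum_i (c i * fine (m (A i)))%:E)); last by rewrite sumEFin.
congr fine; apply: eq_bigr => i _.
under eq_integral do rewrite EFinM.
rewrite (integralZl measurableT (ind i)) integral_indic// setIT EFinM fineK//.
by rewrite ge0_fin_numE.
Qed.

(** Chebyshev's inequality: on the level set [|f|] is at least [|c| > 0]. *)
Lemma integrable_levelset d (T : measurableType d) (R : realType)
    (m : {measure set T -> \bar R}) (u f : T -> R) (c : R) :
  measurable_fun setT u -> m.-integrable setT (EFin \o f) ->
  (forall x, `|u x| <= `|f x|) -> c != 0 -> (m (u @^-1` [set c]) < +oo)%E.
Proof.
move=> mu /integrableP[mf foo] uf c0.
have mA : measurable (u @^-1` [set c]).
  by rewrite -[X in measurable X]setTI; apply: mu => //; exact: measurable_set1.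
have c0' : 0 < `|c| by rewrite normr_gt0.
have : (`|c|%:E * m (u @^-1` [set c]) < +oo)%E.
  apply: le_lt_trans foo.
  rewrite -[X in m X]setIT -integral_indic// -ge0_integralZl_EFin//; last first.
    exact/measurable_EFinP.
  apply: ge0_le_integral => //.
  - by apply: emeasurable_funM => //; exact/measurable_EFinP.
  - exact: measurableT_comp.
  - move=> x _; rewrite -EFinM lee_fin indicE.
    have [/set_mem/= <-|_] := boolP (x \in _); rewrite ?mulr1 ?mulr0//.
case: (m _) (measure_ge0 m (u @^-1` [set c])) => // [r _ _|_]; first exact: ltry.
by rewrite gt0_muley// lte_fin.
Qed.

Lemma ae_eq_Rintegral d (T : measurableType d) (R : realType)
    (m : {measure set T -> \bar R}) (f g : T -> R) :
  measurable_fun setT f -> measurable_fun setT g ->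
  {ae m, forall x, f x = g x} -> \int[m]_x f x = \int[m]_x g x.
Proof.
move=> mf mg fg; rewrite /Rintegral; congr fine; apply: ae_eq_integral => //.
- exact/measurable_EFinP.
- exact/measurable_EFinP.
- by apply: filterS fg => x -> _.
Qed.

Section poisson_functional.
Context d (T : measurableType d) d' (E : measurableType d') (R : realType).
Variables (P : probability T R) (N : R.-ker T ~> E) (nu : {measure set E -> \bar R}).
Hypothesis hN : poisson_random_measure P N nu.

(** Level sets other than that of 0 have finite intensity, being controlled by the integrable [f].
    The integral of [u] is then a finite combination of independent Poisson variables, for those [w]
    for which [f] is integrable under [N w] too. *)
Let poisson_functional_finite_range (u f : E -> R) :
  measurable_fun setT u -> nu.-integrable setT (EFin \o f) ->
  (forall x, `|u x| <= `|f x|) -> finite_set (range u) ->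
  \int[P]_w cos (\int[N w]_z u z) =
    expR (\int[nu]_z (cos (u z) - 1)) * cos (\int[nu]_z sin (u z)) /\
  \int[P]_w sin (\int[N w]_z u z) =
    expR (\int[nu]_z (cos (u z) - 1)) * sin (\int[nu]_z sin (u z)).
Proof.
move=> mu intf uf fin_u.
have [k [c [c_inj c0 _ uE]]] := @finite_range_decomposition R E R u 0 fin_u.
pose A i := u @^-1` [set c i].
have mA i : measurable (A i).
  by rewrite -[X in measurable X]setTI; apply: mu => //; exact: measurable_set1.
have tA : trivIset setT A.
  by move=> i j _ _ [z [/= zi zj]]; apply: c_inj; rewrite -zi -zj.
have finA i : (nu (A i) < +oo)%E by exact: (integrable_levelset mu intf uf (c0 i)).
have -> : \int[nu]_z (cos (u z) - 1) = \sum_i fine (nu (A i)) * (cos (c i) - 1).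
  under eq_Rintegral do rewrite (uE (fun x => cos x - 1)) ?cos0 ?subrr//.
  by rewrite Rintegral_indic_sum//; apply: eq_bigr => i _; rewrite mulrC.
have -> : \int[nu]_z sin (u z) = \sum_i fine (nu (A i)) * sin (c i).
  under eq_Rintegral do rewrite (uE (fun x => sin x)) ?sin0//.
  by rewrite Rintegral_indic_sum//; apply: eq_bigr => i _; rewrite mulrC.
have NE : {ae P, forall w, \int[N w]_z u z = \sum_i c i * fine (N w (A i))}.
  apply: filterS (poisson_integrable hN intf) => w iw.
  under eq_Rintegral do rewrite (uE (fun x => x))//.
  rewrite Rintegral_indic_sum// => i.
  exact: (integrable_levelset mu iw uf (c0 i)).
have mS : measurable_fun setT (fun w => \sum_i c i * fine (N w (A i))).
  apply: measurable_sum => i; apply: measurable_funM => //.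
  apply: (measurableT_comp (fine_measurable measurableT)).
  exact: measurable_kernel.
have mI := measurable_poisson_Rintegral N mu.
split.
- rewrite -(poisson_simple_cos hN c mA tA finA); apply: ae_eq_Rintegral.
  + exact: measurable_cos_comp.
  + exact: measurable_cos_comp.
  + by apply: filterS NE => w ->.
- rewrite -(poisson_simple_sin hN c mA tA finA); apply: ae_eq_Rintegral.
  + exact: measurable_sin_comp.
  + exact: measurable_sin_comp.
  + by apply: filterS NE => w ->.
Qed.

(** Three limits are dominated: the exponents under [nu], by [|f|] since [|cos y - 1|] and [|sin y|]
    are at most [|y|]; the integrals under almost every [N w], by [|f|] again; and the expectations,
    by 1. *)
Lemma poisson_functional (f : E -> R) : nu.-integrable setT (EFin \o f) ->
  \int[P]_w cos (\int[N w]_z f z) =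
    expR (\int[nu]_z (cos (f z) - 1)) * cos (\int[nu]_z sin (f z)) /\
  \int[P]_w sin (\int[N w]_z f z) =
    expR (\int[nu]_z (cos (f z) - 1)) * sin (\int[nu]_z sin (f z)).
Proof.
move=> intf.
have mf : measurable_fun setT f by have /measurable_int/measurable_EFinP := intf.
have [u [mu fin_u uf ucvg]] := simple_function_approximation mf.
have iabs : nu.-integrable setT (EFin \o (fun z => `|f z|)).
  exact: (integrable_norm intf).
have Ncvg : {ae P, forall w, \int[N w]_z u n z @[n --> \oo] --> \int[N w]_z f z}.
  apply: filterS (poisson_integrable hN intf) => w iw.
  apply: (Rintegral_dominated_cvg mu mf _ (integrable_norm iw)).
  - by apply: aeW => z; exact: ucvg.
  - by apply: aeW => z n; exact: uf.
have i1 : P.-integrable setT (EFin \o (fun=> 1 : R)).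
  by apply: (@bounded_integrable _ _ _ _ _ 1) => // w; rewrite normr1.
have mI n := measurable_poisson_Rintegral N (mu n).
have mIf := measurable_poisson_Rintegral N mf.
have acvg : \int[nu]_z (cos (u n z) - 1) @[n --> \oo] --> \int[nu]_z (cos (f z) - 1).
  apply: (Rintegral_dominated_cvg _ _ _ iabs).
  - by move=> n; apply: measurable_funB => //; exact: measurable_cos_comp.
  - by apply: measurable_funB => //; exact: measurable_cos_comp.
  - apply: aeW => z; apply: cvgB; last exact: cvg_cst.
    by apply: continuous_cvg; [exact: continuous_cos|exact: ucvg].
  - by apply: aeW => z n; rewrite (le_trans (norm_cosB1_le _)).
have bcvg : \int[nu]_z sin (u n z) @[n --> \oo] --> \int[nu]_z sin (f z).
  apply: (Rintegral_dominated_cvg _ _ _ iabs).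
  - by move=> n; exact: measurable_sin_comp.
  - exact: measurable_sin_comp.
  - apply: aeW => z.
    by apply: continuous_cvg; [exact: continuous_sin|exact: ucvg].
  - by apply: aeW => z n; rewrite (le_trans (norm_sin_le _)).
split.
- have h1 : \int[P]_w cos (\int[N w]_z u n z) @[n --> \oo] -->
      \int[P]_w cos (\int[N w]_z f z).
    apply: (Rintegral_dominated_cvg _ _ _ i1).
    + by move=> n; exact: measurable_cos_comp.
    + exact: measurable_cos_comp.
    + apply: filterS Ncvg => w hw.
      by apply: continuous_cvg; [exact: continuous_cos|exact: hw].
    + by apply: aeW => w n; exact: norm_cos_le1.
  apply: (cvg_unique _ h1) => //.
  rewrite (_ : (fun n => _) = (fun n => expR (\int[nu]_z (cos (u n z) - 1)) *
    cos (\int[nu]_z sin (u n z)))).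
    apply: cvgM; apply: continuous_cvg => //; first exact: continuous_expR.
    exact: continuous_cos.
  by apply/funext => n; have [] := poisson_functional_finite_range (mu n) intf (uf n) (fin_u n).
- have h1 : \int[P]_w sin (\int[N w]_z u n z) @[n --> \oo] -->
      \int[P]_w sin (\int[N w]_z f z).
    apply: (Rintegral_dominated_cvg _ _ _ i1).
    + by move=> n; exact: measurable_sin_comp.
    + exact: measurable_sin_comp.
    + apply: filterS Ncvg => w hw.
      by apply: continuous_cvg; [exact: continuous_sin|exact: hw].
    + by apply: aeW => w n; exact: norm_sin_le1.
  apply: (cvg_unique _ h1) => //.
  rewrite (_ : (fun n => _) = (fun n => expR (\int[nu]_z (cos (u n z) - 1)) *
    sin (\int[nu]_z sin (u n z)))).
    apply: cvgM; apply: continuous_cvg => //; first exact: continuous_expR.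
    exact: continuous_sin.
  by apply/funext => n; have [] := poisson_functional_finite_range (mu n) intf (uf n) (fin_u n).
Qed.

(* Compensated form: the mean [\int f dnu] is absorbed into the phase. *)
Lemma compensated_poisson_functional (f : E -> R) : nu.-integrable setT (EFin \o f) ->
  let m := \int[nu]_z f z in
  let a := \int[nu]_z (cos (f z) - 1) in
  let b := \int[nu]_z (sin (f z) - f z) in
  \int[P]_w cos (\int[N w]_z f z - m) = expR a * cos b /\
  \int[P]_w sin (\int[N w]_z f z - m) = expR a * sin b.
Proof.
move=> intf m a b.
have mf : measurable_fun setT f by have /measurable_int/measurable_EFinP := intf.
have mI := measurable_poisson_Rintegral N mf.
have [Hc Hs] := poisson_functional intf.
have isin : nu.-integrable setT (EFin \o (fun z => sin (f z))).
  apply: le_integrable intf => //.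
    by apply/measurable_EFinP; exact: measurable_sin_comp.
  by move=> z _; rewrite lee_fin norm_sin_le.
have bE : b = \int[nu]_z sin (f z) - m by rewrite /b RintegralB.
have ic (e : R) : P.-integrable setT (EFin \o (fun w => e * cos (\int[N w]_z f z))).
  apply: (@bounded_integrable _ _ _ _ _ (`|e| * 1)).
    by apply: measurable_funM => //; exact: measurable_cos_comp.
  by move=> w; rewrite normrM ler_wpM2l// norm_cos_le1.
have iss (e : R) : P.-integrable setT (EFin \o (fun w => e * sin (\int[N w]_z f z))).
  apply: (@bounded_integrable _ _ _ _ _ (`|e| * 1)).
    by apply: measurable_funM => //; exact: measurable_sin_comp.
  by move=> w; rewrite normrM ler_wpM2l// norm_sin_le1.
have ic1 : P.-integrable setT (EFin \o (fun w => cos (\int[N w]_z f z))).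
  by have := ic 1; apply: eq_integrable => // w _; rewrite /= mul1r.
have is1 : P.-integrable setT (EFin \o (fun w => sin (\int[N w]_z f z))).
  by have := iss 1; apply: eq_integrable => // w _; rewrite /= mul1r.
rewrite bE cosB sinB; split.
- transitivity (\int[P]_w (cos m * cos (\int[N w]_z f z) + sin m * sin (\int[N w]_z f z))).
    by apply: eq_Rintegral => w _; rewrite cosB; ring.
  rewrite RintegralD//.
  by rewrite !RintegralZl// Hc Hs /a; ring.
- transitivity (\int[P]_w (cos m * sin (\int[N w]_z f z) - sin m * cos (\int[N w]_z f z))).
    by apply: eq_Rintegral => w _; rewrite sinB; ring.
  rewrite RintegralB//.
  by rewrite !RintegralZl// Hc Hs /a; ring.
Qed.

End poisson_functional.

(** * Real and imaginary parts of characteristic functions *)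

Section complex_parts.
Context {R : realType}.

Lemma le_Re_normc (z : R[i]) : `|complex.Re z| <= ComplexField.Normc.normc z.
Proof.
case: z => x y /=; rewrite -sqrtr_sqr ler_sqrt; last by rewrite addr_ge0 ?sqr_ge0.
by rewrite lerDl sqr_ge0.
Qed.

Lemma le_Im_normc (z : R[i]) : `|complex.Im z| <= ComplexField.Normc.normc z.
Proof.
case: z => x y /=; rewrite -sqrtr_sqr ler_sqrt; last by rewrite addr_ge0 ?sqr_ge0.
by rewrite lerDr sqr_ge0.
Qed.

Lemma stable_cfE (alpha sigma b theta : R) :
  stable_cf alpha sigma b 0 theta =
  (let A := sigma `^ alpha * `|theta| `^ alpha in
   let B := A * (b * Num.sg theta * tan (pi * alpha / 2)) in
   (expR (- A) * cos B) +i* (expR (- A) * sin B))%C.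
Proof.
by rewrite /stable_cf /cexp /stable_exponent /=; simpc.
Qed.

End complex_parts.

Lemma powR_div (R : realType) (x y r : R) : 0 <= x -> 0 <= y ->
  (x / y) `^ r = x `^ r / y `^ r.
Proof.
move=> x0 y0; rewrite powRM ?invr_ge0//; congr (_ * _).
by rewrite -powRN -powR_inv1// -powRrM mulN1r.
Qed.

Lemma norm_sinB_le (R : realType) (y : R) : `|sin y - y| <= y ^+ 2.
Proof.
wlog y0 : y / 0 <= y.
  move=> H; have [/H//|/ltW y0] := leP 0 y.
  have := H (- y); rewrite oppr_ge0 => /(_ y0).
  by rewrite sinN sqrrN -opprD normrN.
have dg (z : R) : is_derive z 1 (fun t : R => sin t - t) (cos z - 1).
  by apply: is_derive_eq.
have [|c /andP[c0 cy]] := @MVT_segment _ (fun t => sin t - t) (fun z => cos z - 1) 0 y y0 (fun z _ => dg z).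
  by apply: derivable_within_continuous => z _; exact: ex_derive.
rewrite sin0 subrr !subr0 => ->.
rewrite normrM (ger0_norm y0) expr2 ler_wpM2r// (le_trans (norm_cosB1_le _))//.
by rewrite ger0_norm.
Qed.

(** * Weights in the domain of attraction *)

Section domain_of_attraction.
Context {R : realType}.
Variables (alpha sigma b tau : R) (G : probability (measurableTypeR R) R).
Hypotheses (alpha1 : 1 < alpha).
Hypothesis hG : normal_domain_of_attraction alpha sigma b tau G.

Let kappa (x : R) := b * Num.sg x * tan (pi * alpha / 2).

Let parts : (\int[G]_x cos (theta * x) - 1 + sigma `^ alpha * `|theta| `^ alpha)
     / `|theta| `^ alpha @[theta --> 0^'] --> (0 : R) /\
  (\int[G]_x sin (theta * x) - theta * tau -
     sigma `^ alpha * `|theta| `^ alpha * kappa theta)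
     / `|theta| `^ alpha @[theta --> 0^'] --> (0 : R).
Proof.
split; apply/cvgrPdist_le => e e0.
- move: hG => /cvgrPdist_le/(_ e e0); apply: filterS => theta.
  rewrite !sub0r !normrN => h; apply: le_trans h.
  rewrite [leLHS]normrM [leRHS]normrM ler_wpM2r//.
  apply: le_trans (ler_norm _); apply: le_trans (le_Re_normc _).
  rewrite /charfun /stable_exponent; simpc; rewrite /=.
  by rewrite le_eqVlt; apply/orP; left; apply/eqP; congr (`|_|); ring.
- move: hG => /cvgrPdist_le/(_ e e0); apply: filterS => theta.
  rewrite !sub0r !normrN => h; apply: le_trans h.
  rewrite [leLHS]normrM [leRHS]normrM ler_wpM2r//.
  apply: le_trans (ler_norm _); apply: le_trans (le_Im_normc _).
  rewrite /charfun /stable_exponent; simpc; rewrite /= /kappa.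
  by rewrite le_eqVlt; apply/orP; left; apply/eqP; congr (`|_|); ring.
Qed.

Lemma measurable_idG : measurable_fun setT (fun x : measurableTypeR R => x : R).
Proof. exact: measurable_id. Qed.

Let mlin u : measurable_fun setT (fun x : measurableTypeR R => u * x : R).
Proof. by apply: measurable_funM => //; exact: measurable_idG. Qed.

Let icos u : G.-integrable setT (EFin \o (fun x => cos (u * x))).
Proof.
apply: (@bounded_integrable _ _ _ _ _ 1); first exact: measurable_cos_comp.
by move=> x; exact: norm_cos_le1.
Qed.

Let isin u : G.-integrable setT (EFin \o (fun x => sin (u * x))).
Proof.
apply: (@bounded_integrable _ _ _ _ _ 1); first exact: measurable_sin_comp.
by move=> x; exact: norm_sin_le1.
Qed.

Let i1 : G.-integrable setT (EFin \o (fun=> 1 : R)).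
Proof. by apply: (@bounded_integrable _ _ _ _ _ 1) => // w; rewrite normr1. Qed.

(** [weight_cos] and [weight_sin] are the real and imaginary parts of [psi]. *)
Definition weight_cos u : R := \int[G]_x (cos (u * x) - 1).
Definition weight_sin u : R := \int[G]_x (sin (u * x)) - u * tau.

Let weight_cosE u : weight_cos u = \int[G]_x cos (u * x) - 1.
Proof. by rewrite /weight_cos RintegralB// Rintegral_cst1. Qed.

Let norm_Rint_cos u : `|\int[G]_x cos (u * x)| <= 1.
Proof.
rewrite -[leRHS](Rintegral_cst1 G); apply: le_norm_Rintegral => //.
  exact: measurable_cos_comp.
by move=> x; exact: norm_cos_le1.
Qed.

Let norm_Rint_sin u : `|\int[G]_x sin (u * x)| <= 1.
Proof.
rewrite -[leRHS](Rintegral_cst1 G); apply: le_norm_Rintegral => //.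
  exact: measurable_sin_comp.
by move=> x; exact: norm_sin_le1.
Qed.

Let near0 (Q : R -> Prop) : (\forall t \near (0 : R)^', Q t) ->
  exists2 d, 0 < d & forall t, t != 0 -> `|t| < d -> Q t.
Proof.
move=> [d /= d0 H]; exists d => // t t0 td; apply: H => //=.
by rewrite sub0r normrN.
Qed.

(** Near 0 the expansion gives the order [|u|^alpha], with [C1] collecting the remainder, the stable
    term and its skewness. Away from 0 both quantities grow at most linearly, which [alpha > 1]
    allows to absorb into [C2 |u|^alpha]. *)
Lemma weight_bound : exists2 C, 0 <= C & forall u,
  `|weight_cos u| <= C * `|u| `^ alpha /\ `|weight_sin u| <= C * `|u| `^ alpha.
Proof.
have [/cvgrPdist_le/(_ 1 ltr01)/near0[d1 d10 H1]
      /cvgrPdist_le/(_ 1 ltr01)/near0[d2 d20 H2]] := parts.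
(* The cap at 1 gives [|u| <= |u| / d], and [|u| / d >= 1] is then bounded by its power [alpha]. *)
pose d := Num.min 1 (Num.min d1 d2).
have d0 : 0 < d by rewrite !lt_min ltr01 d10.
have d1' : d <= 1 by rewrite /d ge_min lexx.
have dd1 : d <= d1 by rewrite /d !ge_min lexx orbT.
have dd2 : d <= d2 by rewrite /d !ge_min lexx !orbT.
have alpha0 : 0 < alpha := lt_trans ltr01 alpha1.
have da0 : 0 < d `^ alpha by rewrite powR_gt0.
pose K : R := `|b * tan (pi * alpha / 2)|.
have s0 : 0 <= sigma `^ alpha by exact: powR_ge0.
pose C1 := 1 + sigma `^ alpha * (1 + K).
pose C2 : R := (2 + `|tau|) / d `^ alpha.
have K0 : 0 <= K by exact: normr_ge0.
have C10 : 0 <= C1 by apply: addr_ge0 => //; apply: mulr_ge0 => //; apply: addr_ge0.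
have C20 : 0 <= C2 by apply: divr_ge0; [exact: addr_ge0|exact: ltW].
exists (C1 + C2); first exact: addr_ge0.
move=> u; have [->|u0] := eqVneq u 0.
  rewrite normr0 powR0 ?gt_eqF// mulr0 /weight_cos /weight_sin.
  under eq_Rintegral do rewrite mul0r cos0 subrr.
  under [X in `|X - _|]eq_Rintegral do rewrite mul0r sin0.
  by rewrite !Rintegral_cst1 mul0r subrr normr0.
have nu0 : 0 < `|u| by rewrite normr_gt0.
have ua0 : 0 < `|u| `^ alpha by rewrite powR_gt0.
have [ud|du] := ltP `|u| d.
  have Kk : `|kappa u| <= K.
    rewrite /kappa /K mulrAC normrM ler_piMr//.
    by rewrite normr_sg u0.
  have := H1 u u0 (lt_le_trans ud dd1); have := H2 u u0 (lt_le_trans ud dd2).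
  rewrite !sub0r !normrN !normrM !normfV !(ger0_norm (powR_ge0 _ _)).
  rewrite !ler_pdivrMr// !mul1r => h2 h1.
  have s1 : sigma `^ alpha * `|u| `^ alpha <= sigma `^ alpha * (1 + K) * `|u| `^ alpha.
    by rewrite ler_wpM2r ?powR_ge0// ler_peMr// lerDl.
  have s2 : sigma `^ alpha * `|u| `^ alpha * `|kappa u| <= sigma `^ alpha * (1 + K) * `|u| `^ alpha.
    rewrite mulrAC ler_wpM2r ?powR_ge0// ler_wpM2l// (le_trans Kk)// lerDr//.
  have C2u : 0 <= C2 * `|u| `^ alpha by rewrite mulr_ge0 ?powR_ge0.
  rewrite mulrDl; split.
  - rewrite weight_cosE.
    have := ler_normB (\int[G]_x cos (u * x) - 1 + sigma `^ alpha * `|u| `^ alpha) (sigma `^ alpha * `|u| `^ alpha).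
    rewrite addrK => /le_trans; apply.
    rewrite (@ger0_norm _ (sigma `^ alpha * `|u| `^ alpha)) ?mulr_ge0 ?powR_ge0//.
    by rewrite /C1 mulrDl mul1r; lra.
  - rewrite /weight_sin.
    have := ler_normD (\int[G]_x sin (u * x) - u * tau - sigma `^ alpha * `|u| `^ alpha * kappa u) (sigma `^ alpha * `|u| `^ alpha * kappa u).
    rewrite subrK => /le_trans; apply.
    rewrite (@normrM _ (sigma `^ alpha * `|u| `^ alpha)) (@ger0_norm _ (sigma `^ alpha * `|u| `^ alpha)) ?mulr_ge0 ?powR_ge0//.
    by rewrite /C1 mulrDl mul1r; lra.
have dua : 1 <= `|u| `^ alpha / d `^ alpha.
  rewrite ler_pdivlMr// mul1r ge0_ler_powR ?nnegrE// ?ltW//.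
have lin : `|u| <= `|u| `^ alpha / d `^ alpha.
  have -> : `|u| `^ alpha / d `^ alpha = (`|u| / d) `^ alpha.
    by rewrite powR_div// ltW.
  apply: (@le_trans _ _ (`|u| / d)).
    by rewrite ler_pdivlMr// ler_piMr.
  by apply: le1r_powR; [rewrite ler_pdivlMr// mul1r|exact: ltW].
have C1u : 0 <= C1 * `|u| `^ alpha by rewrite mulr_ge0 ?powR_ge0.
have C2u : C2 * `|u| `^ alpha = (2 + `|tau|) * (`|u| `^ alpha / d `^ alpha).
  by rewrite /C2; ring.
rewrite mulrDl C2u; split.
- rewrite weight_cosE (le_trans (ler_normB _ _))// normr1.
  have := norm_Rint_cos u; have : 0 <= `|tau| by []. nra.
- rewrite /weight_sin (le_trans (ler_normB _ _))// normrM.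
  have := norm_Rint_sin u; have : 0 <= `|tau| by []. nra.
Qed.

(** The expansion of the characteristic function is the only information on [G]: its real part
    bounds the integral of [1 - cos (u x)] by [C |u|^alpha], which [dyadic_moment_bound] turns into
    a first moment. *)
Lemma weight_integrable : G.-integrable setT (fun x => (x : R)%:E).
Proof.
have [C C0 HC] := weight_bound.
have [K K0 HK] := dyadic_moment_bound alpha1.
have := HK _ _ G (fun x => x) C measurable_idG C0; move=> H.
apply/integrableP; split; first by apply/measurable_EFinP; exact: measurable_idG.
apply: (le_lt_trans (H _)); last exact: ltry.
move=> n; have [+ _] := HC (2 ^- n).
rewrite (ger0_norm (x := 2 ^- n)) ?invr_ge0 ?exprn_ge0//.
rewrite weight_cosE distrC => /ler_normlW.
by rewrite -[X in X - _](Rintegral_cst1 G) -RintegralB.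
Qed.

Let weight_cvg : forall e, 0 < e -> exists2 d, 0 < d & forall t, t != 0 -> `|t| < d ->
  `|weight_cos t / `|t| `^ alpha + sigma `^ alpha| <= e /\
  `|weight_sin t / `|t| `^ alpha - sigma `^ alpha * kappa t| <= e.
Proof.
move=> e e0.
have [/cvgrPdist_le/(_ e e0)/near0[d1 d10 H1]
      /cvgrPdist_le/(_ e e0)/near0[d2 d20 H2]] := parts.
exists (Num.min d1 d2); first by rewrite lt_min d10.
move=> t t0; rewrite lt_min => /andP[td1 td2].
have ta0 : `|t| `^ alpha != 0 by rewrite gt_eqF// powR_gt0// normr_gt0.
split.
- have := H1 t t0 td1; rewrite sub0r normrN weight_cosE.
  by rewrite [X in `|X|]mulrDl mulfK.
- have := H2 t t0 td2; rewrite sub0r normrN /weight_sin.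
  by rewrite [X in `|X|]mulrBl mulrAC mulfK.
Qed.

Lemma weight_cos_cvg (s : nat -> R) x : (forall n, 0 < s n) -> s n @[n --> \oo] --> 0 ->
  weight_cos (s n * x) / (s n) `^ alpha @[n --> \oo] --> - (sigma `^ alpha * `|x| `^ alpha).
Proof.
move=> s0 cs; apply/cvgrPdist_le => e e0.
have [->|x0] := eqVneq x 0.
  near=> n; rewrite mulr0 normr0 powR0; last by rewrite gt_eqF// (lt_trans ltr01).
  rewrite mulr0 oppr0 sub0r normrN /weight_cos.
  under eq_Rintegral do rewrite mul0r cos0 subrr.
  by rewrite Rintegral_cst1 mul0r normr0 ltW.
have xa : 0 < `|x| `^ alpha by rewrite powR_gt0// normr_gt0.
have nx : 0 < `|x| by rewrite normr_gt0.
have [d d0 H] := weight_cvg (divr_gt0 e0 xa).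
near=> n.
have sx : s n * x != 0 by rewrite mulf_neq0// gt_eqF.
have snx : `|s n * x| = s n * `|x| by rewrite normrM gtr0_norm.
have sn : `|s n * x| < d.
  rewrite snx -ltr_pdivlMr//.
  have : `|0 - s n| < d / `|x|.
    by near: n; move/cvgrPdist_lt : cs; apply; exact: divr_gt0.
  by rewrite sub0r normrN gtr0_norm.
have [+ _] := H _ sx sn.
rewrite ler_pdivlMr// snx (powRM _ (ltW (s0 n)) (normr_ge0 x)).
rewrite -{2}(gtr0_norm xa) -normrM => h.
apply: le_trans h; rewrite distrC opprK.
rewrite le_eqVlt; apply/orP; left; apply/eqP; congr (`|_|); field.
by rewrite !gt_eqF// powR_gt0.
Unshelve. all: by end_near. Qed.

Lemma weight_sin_cvg (s : nat -> R) x : (forall n, 0 < s n) -> s n @[n --> \oo] --> 0 ->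
  weight_sin (s n * x) / (s n) `^ alpha @[n --> \oo] -->
    sigma `^ alpha * `|x| `^ alpha * (b * Num.sg x * tan (pi * alpha / 2)).
Proof.
move=> s0 cs; apply/cvgrPdist_le => e e0.
have [->|x0] := eqVneq x 0.
  near=> n; rewrite mulr0 normr0 powR0; last by rewrite gt_eqF// (lt_trans ltr01).
  rewrite mulr0 mul0r sub0r normrN /weight_sin.
  under eq_Rintegral do rewrite mul0r sin0.
  by rewrite Rintegral_cst1 mul0r subrr mul0r normr0 ltW.
have xa : 0 < `|x| `^ alpha by rewrite powR_gt0// normr_gt0.
have nx : 0 < `|x| by rewrite normr_gt0.
have [d d0 H] := weight_cvg (divr_gt0 e0 xa).
near=> n.
have sx : s n * x != 0 by rewrite mulf_neq0// gt_eqF.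
have snx : `|s n * x| = s n * `|x| by rewrite normrM gtr0_norm.
have sn : `|s n * x| < d.
  rewrite snx -ltr_pdivlMr//.
  have : `|0 - s n| < d / `|x|.
    by near: n; move/cvgrPdist_lt : cs; apply; exact: divr_gt0.
  by rewrite sub0r normrN gtr0_norm.
have [_ +] := H _ sx sn.
rewrite ler_pdivlMr// snx (powRM _ (ltW (s0 n)) (normr_ge0 x)).
rewrite -{2}(gtr0_norm xa) -normrM => h.
apply: le_trans h; rewrite distrC /kappa sgrM (gtr0_sg (s0 n)) mul1r.
rewrite le_eqVlt; apply/orP; left; apply/eqP; congr (`|_|); field.
by rewrite !gt_eqF// powR_gt0.
Unshelve. all: by end_near. Qed.

(** [tau] enters only as the linear coefficient of the expansion. It is the mean because both are
    limits of the integral of [sin (s x) / s] as [s] tends to 0: one by domination by [|x|], the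
    other because [weight_sin] at [s] is of order [s^alpha] with [alpha > 1]. *)
Lemma weight_mean : \int[G]_x (x : R) = tau.
Proof.
have iabs := integrable_norm weight_integrable.
pose s n : R := n.+1%:R^-1.
have s0 n : 0 < s n by rewrite invr_gt0.
have cs : s n @[n --> \oo] --> 0 by exact: cvg_harmonic.
have h1 : \int[G]_x (sin (s n * x) / s n) @[n --> \oo] --> \int[G]_x (x : R).
  apply: (Rintegral_dominated_cvg _ _ _ iabs).
  - by move=> n; apply: measurable_funM => //; exact: measurable_sin_comp.
  - exact: measurable_idG.
  - apply: aeW => x.
    apply/cvgrPdist_le => e e0; near=> n.
    have sn := s0 n.
    rewrite (_ : x - sin (s n * x) / s n = - ((sin (s n * x) - s n * x) / s n)); last first.
      by field; rewrite gt_eqF.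
    rewrite normrN normrM normfV (gtr0_norm sn) ler_pdivrMr//.
    rewrite (le_trans (norm_sinB_le _))// exprMn expr2 -mulrA mulrC ler_wpM2r ?(ltW sn)//.
    have : `|0 - s n| <= e / (1 + x ^+ 2).
      near: n; move/cvgrPdist_le : cs; apply; apply: divr_gt0 => //.
      by rewrite ltr_pwDl// sqr_ge0.
    rewrite sub0r normrN gtr0_norm// ler_pdivlMr ?ltr_pwDl ?sqr_ge0//.
    by apply: le_trans; rewrite ler_wpM2l ?(ltW sn)// lerDr.
  - apply: aeW => x n; rewrite normrM normfV (gtr0_norm (s0 n)) ler_pdivrMr//.
    by rewrite (le_trans (norm_sin_le _))// normrM (gtr0_norm (s0 n)) mulrC.
apply: (cvg_unique _ h1) => //.
have [C C0 HC] := weight_bound.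
have cpow : (s n) `^ (alpha - 1) @[n --> \oo] --> (0 : R).
  have h0 : 0 < alpha - 1 by rewrite subr_gt0.
  exact: ((cvg_at_rightP _ _ _).1 (powR_cvg0 h0) s (conj s0 cs)).
apply/cvgrPdist_le => e e0; near=> n.
have sn := s0 n.
have -> : \int[G]_x (sin (s n * x) / s n) = (\int[G]_x sin (s n * x)) / s n.
  by rewrite RintegralZr.
rewrite (_ : tau - _ = - (weight_sin (s n) / s n)); last first.
  by rewrite /weight_sin; field; rewrite gt_eqF.
rewrite normrN normrM normfV (gtr0_norm sn).
have [_ h] := HC (s n).
rewrite (@le_trans _ _ (C * (s n) `^ (alpha - 1)))//.
  rewrite ler_pdivrMr// (le_trans h)// (gtr0_norm sn) -mulrA ler_wpM2l//.
  by rewrite mulrC mulr_powRB1 ?(ltW sn)// (lt_trans ltr01).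
have : `|0 - (s n) `^ (alpha - 1)| <= e / (1 + C).
  by near: n; move/cvgrPdist_le : cpow; apply; rewrite divr_gt0// ltr_pwDl.
rewrite sub0r normrN ger0_norm ?powR_ge0// ler_pdivlMr ?ltr_pwDl//.
by apply: le_trans; rewrite mulrC ler_wpM2l ?powR_ge0// lerDr.
Unshelve. all: by end_near. Qed.

End domain_of_attraction.

Lemma charge_jordan d (T : measurableType d) (R : realType) (nu : {charge set T -> \bar R}) :
  exists m1 m2 : {finite_measure set T -> \bar R},
    forall A, measurable A -> nu A = (m1 A - m2 A)%E.
Proof.
have [P [N nuPN]] := Hahn_decomposition nu.
exists (jordan_pos nuPN), (jordan_neg nuPN) => A mA.
by rewrite (jordan_decomp nuPN mA) /cadd /= cscaleN1.
Qed.

(** * Balls, radii and intensities *)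

Section balls.
Context {R : realType} (d : nat).

Let ballrel : set ((Rd R d * measurableTypeR R) * Rd R d) :=
  [set p | eball p.1.1 p.1.2 p.2].

Let mdist : measurable_fun setT (fun p : (Rd R d * measurableTypeR R) * Rd R d =>
  Num.sqrt (\sum_(i < d) (tnth p.2 i - tnth p.1.1 i) ^+ 2) : R).
Proof.
apply: measurableT_comp; first exact: continuous_measurable_fun (@sqrt_continuous R).
apply: measurable_sum => i.
apply: measurable_funX; apply: measurable_funB.
  exact: (measurableT_comp (measurable_tnth i) measurable_snd).
exact: (measurableT_comp (measurable_tnth i) (measurableT_comp measurable_fst measurable_fst)).
Qed.

Let measurable_ballrel : measurable ballrel.
Proof.
have m2 : measurable_fun setT (fun p : (Rd R d * measurableTypeR R) * Rd R d => p.1.2 : R).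
  exact: (measurableT_comp measurable_snd measurable_fst).
have -> : ballrel = setT `&` (fun p => Num.sqrt (\sum_(i < d) (tnth p.2 i - tnth p.1.1 i) ^+ 2) < p.1.2) @^-1` [set true].
  by rewrite setTI; apply/seteqP; split => p.
exact: (measurable_fun_ltr mdist m2).
Qed.

Lemma measurable_eball (x : Rd R d) (r : R) : measurable (eball x r).
Proof.
rewrite (_ : eball x r = xsection ballrel (x, r)); first exact: measurable_xsection.
by apply/seteqP; split => y; rewrite /xsection /= in_setE.
Qed.

Lemma eball_sym (x y : Rd R d) (r : R) : eball x r y = eball y r x.
Proof.
rewrite /eball /=; congr (is_true (Num.sqrt _ < r)).
by apply: eq_bigr => i _; rewrite -sqrrN opprB.
Qed.

Lemma measurable_measure_eball (m : {finite_measure set (Rd R d) -> \bar R}) :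
  measurable_fun setT (fun z : Rd R d * measurableTypeR R => m (eball z.1 z.2)).
Proof.
have := measurable_fun_xsection m measurable_ballrel.
congr measurable_fun; apply/funext => -[x r] /=; congr (m _).
by apply/seteqP; split => y; rewrite /xsection /= in_setE.
Qed.

(** The cube, unlike the ball, is a product, so the recursive definition of Lebesgue measure can be
    followed one coordinate at a time. *)
Lemma lebesgue_tuple_box n (y : Rd R n) (r : R) : 0 <= r ->
  let box := [set x : Rd R n | forall i, `](tnth y i - r), (tnth y i + r)[%classic (tnth x i)] in
  measurable box /\ (lebesgue_tuple n box <= ((2 * r) ^+ n)%:E)%E.
Proof.
move=> r0; elim: n y => [|n IH] y /=.
  split.
    by rewrite (_ : [set x | _] = setT)//; apply/seteqP; split => // x _ [].
  by rewrite expr0 /dirac lee_fin indicE; case: (_ \in _).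
set box := [set x | _].
pose y' : Rd R n := [tuple of behead y].
have [mB' hB'] := IH y'.
set box' := [set x | _] in mB' hB'.
pose I0 : set (measurableTypeR R) := `](tnth y ord0 - r), (tnth y ord0 + r)[%classic.
have pre : @tuple_cons R n @^-1` box = I0 `*` box'.
  apply/seteqP; split => -[a x] /=.
    move=> H; split; first by have := H ord0; rewrite (tnth_nth 0).
    move=> i; have := H (lift ord0 i).
    by rewrite !(tnth_nth 0) /= nth_behead.
  move=> [H0 H1] i; case: (unliftP ord0 i) => [j ->|->].
    by have := H1 j; rewrite !(tnth_nth 0) /= nth_behead.
  by rewrite (tnth_nth 0) /=; exact: H0.
have mbox : measurable box.
  rewrite (_ : box = \bigcap_(i in setT) ((fun x => tnth x i) @^-1` `](tnth y i - r), (tnth y i + r)[%classic)); last first.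
    by apply/seteqP; split => x H i //=; exact: H.
  apply: fin_bigcap_measurable => // i _.
  rewrite -[X in measurable X]setTI; exact: measurable_tnth.
split => //.
rewrite /lebesgue_tuple_step /pushforward pre product_measure1E//; last by rewrite /I0; exact: measurable_itv.
rewrite [X in (X * _)%E](_ : _ = (2 * r)%:E); last first.
  rewrite /I0 -[LHS]/(lebesgue_measure _) lebesgue_measure_itv /=.
  have [r0'|r0'] := ltP (tnth y ord0 - r) (tnth y ord0 + r).
    by rewrite lte_fin r0' -EFinB; congr (_%:E); ring.
  rewrite lte_fin ltNge r0' /=; congr (_%:E).
  by apply/eqP; rewrite eq_le mulr_ge0//= ; lra.
by rewrite exprS (EFinM (2 * r)) lee_pmul// lee_fin mulr_ge0.
Qed.

Lemma lebesgue_tuple_eball (x : Rd R d) (r : R) : 0 <= r ->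
  (lebesgue_tuple d (eball x r) <= ((2 * r) ^+ d)%:E)%E.
Proof.
move=> r0; have [mB hB] := lebesgue_tuple_box x r0.
apply: le_trans hB; apply: le_measure; [by apply: mem_set; exact: measurable_eball|exact: mem_set|].
move=> y /=; rewrite /eball /= => h i; rewrite /= in_itv/=.
have : `|tnth y i - tnth x i| < r.
  apply: le_lt_trans h; rewrite -sqrtr_sqr ler_sqrt; last by apply: sumr_ge0 => j _; exact: sqr_ge0.
  by rewrite (bigD1 i)//= lerDl sumr_ge0// => j _; exact: sqr_ge0.
by rewrite ltr_norml => /andP[? ?]; apply/andP; split; lra.
Qed.

(** Fubini and the symmetry between centre and point: integrating over the centre first gives the
    volume of a ball around [y], at most that of the cube of side [2 r], whatever [y] is. *)
Lemma integral_measure_eball (m : {finite_measure set (Rd R d) -> \bar R}) (r : R) : 0 <= r ->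
  (\int[lebesgue_tuple d]_x m (eball x r) <= (fine (m setT) * (2 * r) ^+ d)%:E)%E.
Proof.
move=> r0.
pose f (p : Rd R d * Rd R d) : \bar R := (\1_(eball p.1 r) p.2)%:E.
have mf : measurable_fun setT f.
  apply/measurable_EFinP.
  rewrite (_ : (fun p => _) = \1_[set p : Rd R d * Rd R d | eball p.1 r p.2]); last first.
    by apply/funext => p; rewrite !indicE; congr (_%:R); apply/idP/idP; rewrite !inE.
  apply: measurable_indic.
  have mg : measurable_fun setT (fun p : Rd R d * Rd R d => ((p.1, r), p.2) : (Rd R d * measurableTypeR R) * Rd R d).
    by apply: measurable_fun_pair => //; apply: measurable_fun_pair.
  by have := mg measurableT _ measurable_ballrel; rewrite setTI.
have f0 p : (0 <= f p)%E by rewrite lee_fin.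
have -> : (\int[lebesgue_tuple d]_x m (eball x r) = \int[lebesgue_tuple d]_x \int[m]_y f (x, y))%E.
  by apply: eq_integral => x _; rewrite /f /= integral_indic ?setIT//; exact: measurable_eball.
rewrite fubini_tonelli//.
apply: (@le_trans _ _ (\int[m]_y ((2 * r) ^+ d)%:E)%E).
  apply: ge0_le_integral => //.
  - by move=> y _; apply: integral_ge0.
  - exact: measurable_fun_fubini_tonelli_G.
  - move=> y _; rewrite /f /=.
    under eq_integral.
      move=> x _; rewrite indicE (_ : (y \in eball x r) = (x \in eball y r)); last first.
        by apply/idP/idP; rewrite !in_setE eball_sym.
      rewrite -indicE; over.
    by rewrite integral_indic ?setIT ?lebesgue_tuple_eball//; exact: measurable_eball.
rewrite integral_cst// muleC EFinM lee_wpmul2r//.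
  by rewrite lee_fin exprn_ge0// mulr_ge0.
by rewrite fineK// fin_num_measure.
Qed.

End balls.

Section ball_mass.
Context {R : realType} (d : nat) (mu : {charge set (Rd R d) -> \bar R}).

Lemma measurable_ball_mass : measurable_fun setT (ball_mass mu).
Proof.
have [m1 [m2 muE]] := charge_jordan mu.
apply: (measurableT_comp (fine_measurable measurableT)).
rewrite (_ : (fun z => _) = (fun z : Rd R d * measurableTypeR R => m1 (eball z.1 z.2) - m2 (eball z.1 z.2))%E).
  by apply: emeasurable_funB; exact: measurable_measure_eball.
by apply/funext => z; rewrite muE//; exact: measurable_eball.
Qed.

Lemma ball_mass_bound : exists V : R, [/\ 0 <= V, forall z, `|ball_mass mu z| <= V &
  forall r, 0 <= r ->
    (\int[lebesgue_tuple d]_x (`|ball_mass mu (x, r)|)%:E <= (V * (2 * r) ^+ d)%:E)%E].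
Proof.
have [m1 [m2 muE]] := charge_jordan mu.
have fin (m : {finite_measure set (Rd R d) -> \bar R}) (A : set (Rd R d)) :
    measurable A -> m A \is a fin_num by move=> mA; exact: fin_num_measure.
have le_T (m : {finite_measure set (Rd R d) -> \bar R}) (A : set (Rd R d)) :
    measurable A -> (m A <= m setT)%E.
  by move=> mA; apply: le_measure => //; exact: mem_set.
have V0 : 0 <= fine (m1 setT) + fine (m2 setT) by rewrite addr_ge0// fine_ge0.
have bnd z : ((`|ball_mass mu z|)%:E <= m1 (eball z.1 z.2) + m2 (eball z.1 z.2))%E.
  have mB := measurable_eball z.1 z.2.
  rewrite /ball_mass muE// -(fineK (fin m1 _ mB)) -(fineK (fin m2 _ mB)).
  rewrite -EFinB -EFinD lee_fin /= (le_trans (ler_normB _ _))//.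
  by rewrite !ger0_norm// fine_ge0.
exists (fine (m1 setT) + fine (m2 setT)); split => // [z|r r0].
  rewrite -lee_fin (le_trans (bnd z))// EFinD.
  rewrite (fineK (fin m1 _ measurableT)) (fineK (fin m2 _ measurableT)).
  by apply: leeD; apply: le_T; exact: measurable_eball.
have mm m : measurable_fun setT (fun x : Rd R d => (m : {finite_measure set (Rd R d) -> \bar R}) (eball x r)).
  exact: (measurableT_comp (measurable_measure_eball m) (measurable_pair2 r)).
apply: (@le_trans _ _ (\int[lebesgue_tuple d]_x (m1 (eball x r) + m2 (eball x r)))%E).
  apply: ge0_le_integral => //.
  - apply/measurable_EFinP; apply: measurableT_comp => //.
    exact: (measurableT_comp measurable_ball_mass (measurable_pair2 r)).
  - exact: emeasurable_funD.
rewrite ge0_integralD//.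
by rewrite mulrDl EFinD leeD// integral_measure_eball.
Qed.

End ball_mass.

(** * Measures given by a density, scaling and intensities *)

Section density_measure.
Context d (T : measurableType d) (R : realType) (m : {measure set T -> \bar R}).
Variable h : T -> R.

(** The proofs [mh] and [h0] are arguments so that the measure structure can be attached to the term
    itself. *)
Definition density_measure (mh : measurable_fun setT h) (h0 : forall x, 0 <= h x)
  (A : set T) : \bar R := (\int[m]_(x in A) (h x)%:E)%E.

Variables (mh : measurable_fun setT h) (h0 : forall x, 0 <= h x).

Let density0 : density_measure mh h0 set0 = 0%E.
Proof. by rewrite /density_measure integral_set0. Qed.

Let density_ge0 A : (0 <= density_measure mh h0 A)%E.
Proof. by apply: integral_ge0 => x _; rewrite lee_fin. Qed.

Let density_sigma_additive : semi_sigma_additive (density_measure mh h0).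
Proof.
move=> F mF tF mUF; rewrite /density_measure ge0_integral_bigcup//; last 2 first.
- by apply/measurable_EFinP; exact: measurable_funTS.
- by move=> x _; rewrite lee_fin.
apply: is_cvg_ereal_nneg_natsum => n _.
by apply: integral_ge0 => x _; rewrite lee_fin.
Qed.

HB.instance Definition _ := isMeasure.Build _ _ _ (density_measure mh h0)
  density0 density_ge0 density_sigma_additive.

Local Notation nu := (density_measure mh h0).

Lemma ge0_integral_density_measure (f : T -> \bar R) :
  measurable_fun setT f -> (forall x, 0 <= f x)%E ->
  (\int[nu]_x f x = \int[m]_x ((h x)%:E * f x))%E.
Proof. by move=> mf f0; apply: ge0_integral_density => //. Qed.

Lemma integrable_density_measure (f : T -> R) : measurable_fun setT f ->
  m.-integrable setT (EFin \o (fun x => h x * f x)) ->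
  nu.-integrable setT (EFin \o f).
Proof.
move=> mf /integrableP[_ hf]; apply/integrableP; split; first exact/measurable_EFinP.
rewrite ge0_integral_density_measure//; last exact/measurableT_comp/measurable_EFinP.
by under eq_integral do rewrite /= -EFinM -{1}(ger0_norm (h0 _)) -normrM.
Qed.

(** Positive and negative parts are transferred separately, so the identity holds without
    integrability. *)
Lemma Rintegral_density_measure (f : T -> R) : measurable_fun setT f ->
  \int[nu]_x f x = \int[m]_x (h x * f x).
Proof.
move=> mf; have emf : measurable_fun setT (EFin \o f) by exact/measurable_EFinP.
rewrite /Rintegral !(integralE _ _ (fun x => (_ x)%:E)) !(integralE _ _ (fun x => (_ * _)%:E)).
rewrite !ge0_integral_density_measure//; [|exact: measurable_funeneg|exact: measurable_funepos].
congr (fine (_ - _)); apply: eq_integral => x _.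
- by rewrite !funeposE maxe_pMr ?lee_fin// mule0 -EFinM.
- by rewrite !funenegE maxe_pMr ?lee_fin// mule0 muleN.
Qed.

End density_measure.

Section lebesgue_scaling.
Context {R : realType}.

(** The rescaled image of Lebesgue measure agrees with it on the intervals []a, b]], which
    characterise it; the rest is an integral against an image measure with constant weight. *)
Lemma ge0_integral_scale (c : R) (g : R -> \bar R) : 0 < c ->
  measurable_fun setT g -> (forall r, 0 <= g r)%E ->
  (\int[@lebesgue_measure R]_r ((c^-1)%:E * g (r / c)%R) = \int[@lebesgue_measure R]_r g r)%E.
Proof.
move=> c0 mg g0.
pose Z (r : measurableTypeR R) : measurableTypeR R := r / c.
have mZ : measurable_fun setT Z by exact: measurable_funM.
have ci0 : 0 <= c^-1 by rewrite invr_ge0 ltW.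
pose eta0 : {measure set (measurableTypeR R) -> \bar R} :=
  mscale (NngNum ci0) (pushforward (@lebesgue_measure R) Z).
apply/esym; apply: (@ge0_integral_weighted _ _ _ lebesgue_measure (fun=> c^-1) _ _ _ _ Z) => //.
move=> U mU.
rewrite ge0_integralZl_EFin//; last first.
  by apply/measurable_EFinP; apply: (measurableT_comp _ mZ); exact: measurable_indic.
transitivity (eta0 mZ U); first (apply: lebesgue_measure_unique => // X [[a b] _ <-]); last first.
  rewrite /eta0 /mscale /=; congr (_ * _)%E.
  rewrite (_ : (fun x => _) = (fun x => (\1_(Z @^-1` U) x)%:E))//.
  rewrite integral_indic//; first by rewrite setIT.
  by rewrite -[X in measurable X]setTI; exact: mZ.
rewrite -[RHS]/((c^-1)%:E * lebesgue_measure (Z @^-1` `]a, b]%classic))%E.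
rewrite (_ : _ @^-1` _ = `](a * c), (b * c)]%classic); last first.
  by apply/seteqP; split => x /=; rewrite !in_itv/= /Z ltr_pdivlMr// ler_pdivrMr.
rewrite !lebesgue_measure_itv/= !lte_fin ltr_pM2r//; case: ifPn => _; last by rewrite mule0.
by rewrite -2!EFinD -EFinM; congr (_%:E); field; rewrite gt_eqF.
Qed.

End lebesgue_scaling.

Section intensities.
Context {R : realType} (d : nat).

(** The restriction to the positive half-line extended by 0 (not the positive part), which turns
    integrals over []0, +oo[] into integrals over the line. *)
Definition pos_part_fun (g : R -> R) : R -> R := g \_ `]0, +oo[.

Lemma pos_part_funE (g : R -> R) r : 0 < r -> pos_part_fun g r = g r.
Proof. by move=> r0; rewrite /pos_part_fun patchE mem_set//= in_itv/= r0. Qed.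

Lemma pos_part_fun0 (g : R -> R) r : r <= 0 -> pos_part_fun g r = 0.
Proof.
move=> r0; rewrite /pos_part_fun patchE memNset//= in_itv/= andbT.
by apply/negP; rewrite -leNgt.
Qed.

Lemma pos_part_fun_ge0 (g : R -> R) : (forall r, 0 < r -> 0 <= g r) ->
  forall r, 0 <= pos_part_fun g r.
Proof.
by move=> g0 r; have [r0|r0] := ltP 0 r; [rewrite pos_part_funE// g0|rewrite pos_part_fun0].
Qed.

Lemma measurable_pos_part_fun (g : R -> R) :
  measurable_fun (`]0, +oo[%classic : set R) g ->
  measurable_fun setT (pos_part_fun g).
Proof. by move=> mg; apply/(measurable_restrictT _ _).1. Qed.

Local Notation LL := (lebesgue_tuple d \x (@lebesgue_measure R))%E.

Definition stable_density (alpha beta Cbeta sigma : R) (z : Rd R d * measurableTypeR R) : R :=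
  pos_part_fun (fun r => sigma `^ alpha * Cbeta * r `^ (- 1 - beta)) z.2.

Lemma measurable_stable_density alpha beta Cbeta sigma :
  measurable_fun setT (stable_density alpha beta Cbeta sigma).
Proof.
apply: (measurableT_comp _ measurable_snd); apply: measurable_pos_part_fun.
apply: measurable_funM => //; apply: (@measurable_funTS _ _ _ _ _ (fun r => r `^ _)).
exact: measurable_powR.
Qed.

Lemma stable_density_ge0 alpha beta Cbeta sigma : 0 < Cbeta ->
  forall z, 0 <= stable_density alpha beta Cbeta sigma z.
Proof.
move=> C0 z; apply: pos_part_fun_ge0 => r r0.
by rewrite !mulr_ge0 ?powR_ge0 // ltW.
Qed.

(** Replaces a bare set function by a term that carries a measure structure; [ball_intensityE] does
    the same for the Poisson intensity. *)
Lemma stable_controlE alpha beta Cbeta sigma (C0 : 0 < Cbeta) :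
  stable_control d alpha beta Cbeta sigma =
  density_measure LL (measurable_stable_density alpha beta Cbeta sigma)
    (stable_density_ge0 alpha beta sigma C0).
Proof.
apply/funext => A; rewrite /stable_control /density_measure.
rewrite [LHS]integral_mkcondr; apply: eq_integral => -[x r] _.
rewrite patchE /stable_density /=; have [r0|r0] := ltP 0 r.
  by rewrite mem_set//= pos_part_funE.
by rewrite memNset ?pos_part_fun0//=; apply/negP; rewrite -leNgt.
Qed.

Definition ball_density (lambda : R) (f : R -> R) (rho : R)
    (z : Rd R d * measurableTypeR R) : R :=
  lambda * (pos_part_fun f (z.2 / rho) / rho).

Section ball_intensity.
Variables (lambda : R) (f : R -> R) (rho : R).
Hypotheses (lambda0 : 0 < lambda) (rho0 : 0 < rho).
Hypothesis mf : measurable_fun (`]0, +oo[%classic : set R) f.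
Hypothesis f0 : forall r, 0 < r -> 0 <= f r.

Lemma measurable_ball_density : measurable_fun setT (ball_density lambda f rho).
Proof.
apply: measurable_funM => //; apply: measurable_funM => //.
apply: (measurableT_comp (measurable_pos_part_fun mf)).
by apply: measurable_funM => //; exact: measurable_snd.
Qed.

Lemma ball_density_ge0 z : 0 <= ball_density lambda f rho z.
Proof.
by rewrite mulr_ge0 ?(ltW lambda0)// divr_ge0 ?(ltW rho0)//; exact: pos_part_fun_ge0.
Qed.

Lemma ball_intensityE (G : probability (measurableTypeR R) R) :
  ball_intensity (d := d) lambda f rho G =
  density_measure (LL \x G)%E (measurableT_comp measurable_ball_density measurable_fst)
    (fun z => ball_density_ge0 z.1).
Proof.
apply/funext => A; rewrite /ball_intensity /density_measure.
rewrite [LHS]integral_mkcondr; apply: eq_integral => -[[x r] m] _.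
rewrite patchE /ball_density /=; have [r0|r0] := ltP 0 r.
  by rewrite mem_set//= pos_part_funE// divr_gt0.
rewrite memNset ?pos_part_fun0//= ?mul0r ?mulr0//; last by apply/negP; rewrite -leNgt.
by rewrite pmulr_lle0 ?invr_gt0.
Qed.

End ball_intensity.
End intensities.

(** * Integrals of powers of the radius *)

Section power_integrals.
Context {R : realType}.
Local Notation leb := (@lebesgue_measure R).

Lemma continuous_powR_gt0 (c x : R) : 0 < x -> {for x, continuous (fun r : R => r `^ c)}.
Proof.
move=> x0; apply: differentiable_continuous; apply/derivable1_diffP.
by apply: derivable_powR; rewrite in_itv/= x0.
Qed.

Lemma integral_powR_itv (c x y : R) : c != 0 -> 0 < x -> x < y ->
  (\int[leb]_(r in `[x, y]) (r `^ (c - 1))%:E = ((y `^ c - x `^ c) / c)%:E)%E.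
Proof.
move=> c0 x0 xy.
have cont e z : 0 < z -> {for z, continuous (fun r : R => r `^ e)} by exact: continuous_powR_gt0.
rewrite (@continuous_FTC2 _ (fun r => r `^ (c - 1)) (fun r => c^-1 * r `^ c))//.
- by rewrite -EFinB; congr (_%:E); ring.
- apply: continuous_in_subspaceT => z /set_mem/=; rewrite in_itv/= => /andP[xz _].
  by apply: cont; exact: lt_le_trans xz.
- split.
  + move=> z; rewrite in_itv/= => /andP[xz _]; apply: derivableM => //.
    by apply: derivable_powR; rewrite in_itv/= (lt_trans x0 xz).
  + apply: cvg_at_right_filter; apply: cvgM; first exact: cvg_cst.
    exact: cont.
  + apply: cvg_at_left_filter; apply: cvgM; first exact: cvg_cst.
    exact/cont/(lt_trans x0).
- move=> z; rewrite in_itv/= => /andP[xz _].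
  have z0 : 0 < z := lt_trans x0 xz.
  have := is_derive1_powR c z0 => ?.
  rewrite derive1E; rewrite (_ : (fun r => _) = (c^-1 : R) \*: (fun r : R => r `^ c)); last exact/funext.
  rewrite deriveZ//.
  by rewrite derive_val scalerA mulVf// scale1r.
Qed.

(** Below 1 the minimum is replaced by [r^q], integrable at 0 because [beta < q]; above 1 by [r^p],
    integrable at infinity because [p < beta]. The compact intervals [F n] exhaust the half-line,
    and the fundamental theorem of calculus bounds the integral over each by the same constant. *)
Lemma integral_min_powR_lty (beta p q : R) : p < beta -> beta < q ->
  (\int[leb]_(r in `]0%R, +oo[) (r `^ (- 1 - beta) * Num.min (r `^ p) (r `^ q))%:E < +oo)%E.
Proof.
move=> pb bq.
pose phi (r : R) := r `^ (- 1 - beta) * Num.min (r `^ p) (r `^ q).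
have mphi : measurable_fun setT phi.
  apply: measurable_funM; first exact: measurable_powR.
  by apply: measurable_minr; exact: measurable_powR.
have phi0 r : 0 <= phi r by rewrite mulr_ge0 ?powR_ge0// le_min !powR_ge0.
(* [n.+2] keeps 1 strictly inside the interval, so that neither of the two pieces is degenerate. *)
pose F n : set R := `[(n.+2%:R)^-1, n.+2%:R]%classic.
have n1 n : 1 < n.+2%:R :> R by rewrite ltr1n.
have ni n : 0 < (n.+2%:R)^-1 :> R by rewrite invr_gt0.
have ni1 n : (n.+2%:R)^-1 < 1 :> R by rewrite invf_lt1.
have FE : \bigcup_n F n = `]0, +oo[%classic.
  apply/seteqP; split => r /=.
    by move=> [n _ /=]; rewrite !in_itv/= andbT => /andP[/(lt_le_trans (ni n))].
  rewrite in_itv/= andbT => r0.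
  pose N := (Num.truncn r + Num.truncn r^-1)%N.
  have rN (z : R) : 0 <= z -> z <= (Num.truncn z).+1%:R by move=> z0; rewrite ltW// truncnS_gt.
  exists N; first by [].
  rewrite /F /= in_itv/=; apply/andP; split; last first.
    by rewrite (le_trans (rN _ (ltW r0)))// ler_nat /N; lia.
  rewrite -[leRHS]invrK lef_pV2 ?posrE ?invr_gt0//.
  by rewrite (le_trans (rN _ _)) ?invr_ge0 ?(ltW r0)// ler_nat /N; lia.
have cvgF : (\int[leb]_(r in F n) (phi r)%:E)%E @[n --> \oo] --> (\int[leb]_(r in `]0%R, +oo[) (phi r)%:E)%E.
  rewrite -FE; apply: ge0_nondecreasing_set_cvg_integral => //.
  - move=> n m nm; apply/subsetPset => r; rewrite /F /= !in_itv/= => /andP[h1 h2].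
    apply/andP; split; last by rewrite (le_trans h2)// ler_nat; lia.
    by rewrite (le_trans _ h1)// lef_pV2 ?posrE// ler_nat; lia.
  - by move=> n; exact: measurable_itv.
  - by move=> n; apply/measurable_EFinP; exact: measurable_funTS.
  - by move=> n r _; rewrite lee_fin.
apply: (@le_lt_trans _ _ ((q - beta)^-1 + (beta - p)^-1)%:E); last exact: ltry.
rewrite -(cvg_lim _ cvgF)//; apply: lime_le; first by apply/cvg_ex; eexists; exact: cvgF.
apply: nearW => n.
have mE (A : set R) e : measurable_fun A (fun r : R => (r `^ e)%:E).
  by apply/measurable_EFinP; apply: measurable_funTS; exact: measurable_powR.
pose N : R := n.+2%:R; pose Ni : R := N^-1.
have := ni n; have := ni1 n; rewrite -/N -/Ni => Ni1 Ni0.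
pose U1 : \bar R := (\int[leb]_(r in `[Ni, 1%R]) (r `^ (q - beta - 1))%:E)%E.
pose U2 : \bar R := (\int[leb]_(r in `[1%R, N]) (r `^ (p - beta - 1))%:E)%E.
apply: (@le_trans _ _ (U1 + U2)%E); rewrite /U1 /U2.
  pose V1 : \bar R := (\int[leb]_(r in `[Ni, 1%R]) (phi r)%:E)%E.
  pose V2 : \bar R := (\int[leb]_(r in `[1%R, N]) (phi r)%:E)%E.
  apply: (@le_trans _ _ (V1 + V2)%E); rewrite /V1 /V2.
    rewrite /F (@itv_bndbnd_setU _ _ _ (BLeft 1))//; last 2 first.
    - by rewrite bnd_simp ltW.
    - by rewrite bnd_simp ltW.
    rewrite ge0_integral_setU//; last 3 first.
    - by apply/measurable_EFinP; exact: measurable_funTS.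
    - by move=> r _; rewrite lee_fin.
    - apply: lt_disjoint => r1 r2 /=; rewrite !in_itv/= => /andP[_ h1] /andP[h2 _].
      exact: lt_le_trans h1 h2.
    apply: leeD => //; apply: ge0_subset_integral => //.
    - by apply/measurable_EFinP; exact: measurable_funTS.
    - by move=> r _; rewrite lee_fin.
    - by move=> r /=; rewrite !in_itv/= => /andP[-> /ltW ->].
  apply: leeD; apply: ge0_le_integral => //.
  - by move=> r _; rewrite lee_fin.
  - by apply/measurable_EFinP; exact: measurable_funTS.
  - exact: mE.
  - move=> r; rewrite /= in_itv/= => /andP[nr r1].
    have r0 : 0 < r := lt_le_trans Ni0 nr.
    rewrite lee_fin /phi (_ : q - beta - 1 = (- 1 - beta) + q); last by ring.
    rewrite [leRHS]powRD ?(gt_eqF r0) ?implybT// ler_wpM2l ?powR_ge0//.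
    by rewrite ge_min lexx orbT.
  - by move=> r _; rewrite lee_fin.
  - by apply/measurable_EFinP; exact: measurable_funTS.
  - exact: mE.
  - move=> r; rewrite /= in_itv/= => /andP[r1 _].
    have r0 : 0 < r := lt_le_trans ltr01 r1.
    rewrite lee_fin /phi (_ : p - beta - 1 = (- 1 - beta) + p); last by ring.
    rewrite [leRHS]powRD ?(gt_eqF r0) ?implybT// ler_wpM2l ?powR_ge0//.
    by rewrite ge_min lexx.
have N1 : 1 < N := n1 n.
have qb0 : q - beta != 0 by rewrite subr_eq0 gt_eqF.
have pb0 : p - beta != 0 by rewrite subr_eq0 lt_eqF.
rewrite !integral_powR_itv//.
rewrite -EFinD lee_fin lerD// powR1.
  rewrite ler_pdivrMr ?subr_gt0// mulVf ?subr_eq0 ?gt_eqF//.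
  by rewrite lerBlDr lerDl powR_ge0.
rewrite -[leLHS]mulrNN -invrN opprB opprB.
rewrite ler_pdivrMr ?subr_gt0// mulVf ?subr_eq0 ?gt_eqF//.
by rewrite lerBlDr lerDl powR_ge0.
Qed.

End power_integrals.

(** * Linear combinations in the alpha-beta space *)

Section alpha_beta_space_closure.
Context {R : realType} (d : nat) (alpha beta : R).
Hypothesis alpha1 : 1 < alpha.

Local Notation ab := (@alpha_beta_space R d alpha beta).

Lemma powR_normD_le (x y : R) :
  `|x + y| `^ alpha <= 2 `^ alpha * `|x| `^ alpha + 2 `^ alpha * `|y| `^ alpha.
Proof.
have a0 : 0 <= alpha by rewrite ltW// (lt_trans ltr01).
wlog xy : x y / `|x| <= `|y|.
  by move=> H; have [/H//|/ltW/H] := leP `|x| `|y|; rewrite addrC [X in _ -> _ <= X]addrC.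
rewrite -[leLHS]add0r lerD ?mulr_ge0 ?powR_ge0//.
rewrite -powRM// ge0_ler_powR ?nnegrE ?mulr_ge0//.
by rewrite (le_trans (ler_normD _ _))//; lra.
Qed.

(** Below 1 the minimum is the power with the larger exponent, above 1 the one with the smaller, so
    narrowing [[p, q]] enlarges it on both sides. *)
Lemma le_min_powR (p q p' q' r : R) : 0 < r -> p <= p' -> p' <= q' -> q' <= q ->
  Num.min (r `^ p) (r `^ q) <= Num.min (r `^ p') (r `^ q').
Proof.
move=> r0 pp pq qq; have [r1|/ltW r1] := leP r 1.
  have h x y : x <= y -> r `^ y <= r `^ x.
    by move=> xy; apply: (@ger_powR _ r) => //; rewrite r0.
  rewrite ge_min orbC le_min !h//; exact: le_trans qq.
have h x y : x <= y -> r `^ x <= r `^ y by exact: ler_powR.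
rewrite ge_min le_min !h//; exact: le_trans pq.
Qed.

Lemma measurable_ball_mass_powR (mu : charge (Rd R d) R) r :
  measurable_fun setT (fun x => (`|ball_mass mu (x, r)| `^ alpha)%:E).
Proof.
apply/measurable_EFinP; apply: (measurableT_comp (measurable_powR _)).
apply: measurableT_comp => //.
exact: (measurableT_comp (measurable_ball_mass mu) (measurable_pair2 r)).
Qed.

(** The exponents of the two measures may differ; their intervals around [beta] are intersected.
    [xi] is described by its ball masses, the only quantities on which the space and the field
    depend. *)
Lemma alpha_beta_space_lincomb (mu nu xi : charge (Rd R d) R) (s t : R) :
  (forall z, ball_mass xi z = s * ball_mass mu z + t * ball_mass nu z) ->
  ab mu -> ab nu -> ab xi.
Proof.
move=> xiE [C [p [q [p0 pb bq hC]]]] [C' [p' [q' [p0' pb' bq' hC']]]].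
pose K := 2 `^ alpha * `|s| `^ alpha * `|C| + 2 `^ alpha * `|t| `^ alpha * `|C'|.
exists K, (Num.max p p'), (Num.min q q'); split.
- by rewrite lt_max p0.
- by rewrite gt_max pb pb'.
- by rewrite lt_min bq bq'.
move=> r r0.
have m0 a b : 0 <= Num.min (r `^ a) (r `^ b) by rewrite le_min !powR_ge0.
have abs (c a b : R) : c * Num.min (r `^ a) (r `^ b) <= `|c| * Num.min (r `^ a) (r `^ b).
  by rewrite ler_wpM2r// ler_norm.
have pq : Num.max p p' <= Num.min q q'.
  by rewrite ge_max !le_min; apply/andP; split; apply/andP; split; apply/ltW;
    [exact: lt_trans bq|exact: lt_trans bq'|exact: lt_trans bq|exact: lt_trans bq'].
have M1 : Num.min (r `^ p) (r `^ q) <= Num.min (r `^ Num.max p p') (r `^ Num.min q q').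
  by apply: le_min_powR => //; [rewrite le_max lexx|rewrite ge_min lexx].
have M2 : Num.min (r `^ p') (r `^ q') <= Num.min (r `^ Num.max p p') (r `^ Num.min q q').
  by apply: le_min_powR => //; [rewrite le_max lexx orbT|rewrite ge_min lexx orbT].
pose I1 := (\int[lebesgue_tuple d]_x (`|ball_mass mu (x, r)| `^ alpha)%:E)%E.
pose I2 := (\int[lebesgue_tuple d]_x (`|ball_mass nu (x, r)| `^ alpha)%:E)%E.
apply: (@le_trans _ _ ((2 `^ alpha * `|s| `^ alpha)%:E * I1 + (2 `^ alpha * `|t| `^ alpha)%:E * I2)%E).
  have mm := measurable_ball_mass_powR.
  have pw (z : Rd R d) (m : charge (Rd R d) R) : [set: Rd R d] z -> (0 <= (`|ball_mass m (z, r)| `^ alpha)%:E)%E.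
    by move=> _; rewrite lee_fin powR_ge0.
  rewrite -!ge0_integralZl_EFin ?mulr_ge0 ?powR_ge0//.
  rewrite -ge0_integralD//.
  all: try by apply: measurable_funeM; exact: mm.
  all: try by move=> x _; rewrite lee_fin !mulr_ge0 ?powR_ge0.
  apply: ge0_le_integral => //.
  - by apply: emeasurable_funD; apply: measurable_funeM; exact: mm.
  - move=> x _; rewrite -!EFinM -EFinD lee_fin xiE (le_trans (powR_normD_le _ _))//.
    by rewrite !normrM !powRM// !mulrA.
rewrite /K mulrDl EFinD.
apply: leeD; rewrite -[X in (_ <= X%:E)%E]mulrA [X in (_ <= X)%E]EFinM lee_wpmul2l ?lee_fin ?mulr_ge0 ?powR_ge0//.
- by rewrite (le_trans (hC r r0))// lee_fin (le_trans (abs _ _ _))// ler_wpM2l.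
- by rewrite (le_trans (hC' r r0))// lee_fin (le_trans (abs _ _ _))// ler_wpM2l.
Qed.

Hypothesis beta0 : 0 < beta.

Lemma alpha_beta_space_sum k (v : 'I_k -> charge (Rd R d) R) (t : 'I_k -> R) :
  (forall i, ab (v i)) ->
  exists2 mu, ab mu & forall z, ball_mass mu z = \sum_i t i * ball_mass (v i) z.
Proof.
elim: k v t => [|k IH] v t abv.
  exists (czero : charge _ _); last by move=> z; rewrite big_ord0.
  (* For the zero charge any two exponents around [beta] serve. *)
  exists 0, (beta / 2), (beta + 1); split; [by rewrite divr_gt0|by rewrite ltr_pdivrMr// ltr_pMr// ltr1n|by rewrite ltrDl|].
  move=> r r0; rewrite mul0r integral0_eq// => x _.
  by rewrite /ball_mass/= normr0 powR0// gt_eqF// (lt_trans ltr01).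
have [mu abmu muE] := IH (fun i => v (lift ord0 i)) (fun i => t (lift ord0 i)) (fun i => abv _).
pose xi0 : charge (Rd R d) R := cadd (cscale (t ord0) (v ord0)) mu.
have [xi xiE] : exists xi : charge (Rd R d) R, forall z, ball_mass xi z = t ord0 * ball_mass (v ord0) z + 1 * ball_mass mu z.
  exists xi0 => z.
  have mB := measurable_eball z.1 z.2.
  have f0 := fin_num_measure (v ord0) _ mB.
  have f1 := fin_num_measure mu _ mB.
  rewrite /ball_mass /xi0 /= /cadd /= /cscale mul1r fineD ?fin_numM// fineM//.
exists xi; first exact: (alpha_beta_space_lincomb xiE (abv ord0) abmu).
by move=> z; rewrite xiE mul1r muE big_ord_recl.
Qed.

End alpha_beta_space_closure.

(** * Integrated powers of ball masses *)

Section ball_mass_power.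
Context {R : realType} (d : nat) (alpha beta : R).
Hypothesis alpha1 : 1 < alpha.
Variable mu : charge (Rd R d) R.

Local Notation leb := (@lebesgue_measure R).
Local Notation LL := (lebesgue_tuple d \x leb)%E.

Definition ball_power (r : R) : \bar R :=
  (\int[lebesgue_tuple d]_x (`|ball_mass mu (x, r)| `^ alpha)%:E)%E.

Lemma ball_power_ge0 r : (0 <= ball_power r)%E.
Proof. by apply: integral_ge0 => x _; rewrite lee_fin powR_ge0. Qed.

Lemma measurable_ball_powR :
  measurable_fun setT (fun z => `|ball_mass mu z| `^ alpha).
Proof.
apply: (measurableT_comp (measurable_powR _)).
by apply: measurableT_comp => //; exact: measurable_ball_mass.
Qed.

(** One factor of the power is integrated in [L^1], the remaining power [alpha - 1] is bounded by
    its supremum. This makes the exponent [d] available beside [p] and [q]. *)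
Lemma ball_power_volume : exists2 W : R, 0 <= W &
  forall r, 0 <= r -> (ball_power r <= (W * r ^+ d)%:E)%E.
Proof.
have [V [V0 bV IV]] := ball_mass_bound mu.
exists (V `^ (alpha - 1) * (V * 2 ^+ d)); first by rewrite !mulr_ge0 ?powR_ge0.
move=> r r0; rewrite -2!mulrA -exprMn EFinM.
apply: (@le_trans _ _ ((V `^ (alpha - 1))%:E *
    \int[lebesgue_tuple d]_x (`|ball_mass mu (x, r)|)%:E)%E); last first.
  by rewrite lee_wpmul2l ?lee_fin ?powR_ge0// IV.
have mb : measurable_fun setT (fun x => (`|ball_mass mu (x, r)|)%:E).
  apply/measurable_EFinP; apply: measurableT_comp => //.
  exact: (measurableT_comp (measurable_ball_mass mu) (measurable_pair2 r)).
rewrite -ge0_integralZl_EFin ?powR_ge0//.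
apply: ge0_le_integral => //.
- exact: measurable_ball_mass_powR.
- exact: measurable_funeM.
- move=> x _; rewrite -EFinM lee_fin -(@mulr_powRB1 _ _ alpha)//; last exact: lt_trans alpha1.
  rewrite mulrC ler_wpM2r// ge0_ler_powR ?nnegrE ?subr_ge0 ?(ltW alpha1)//.
Qed.

Lemma ball_power_tonelli (g : R -> R) : measurable_fun setT g -> (forall r, 0 <= g r) ->
  (\int[LL]_z (g z.2 * `|ball_mass mu z| `^ alpha)%:E =
   \int[leb]_r ((g r)%:E * ball_power r))%E.
Proof.
move=> mg g0; rewrite fubini_tonelli2; last 2 first.
- apply/measurable_EFinP; apply: measurable_funM; last exact: measurable_ball_powR.
  exact: (measurableT_comp mg measurable_snd).
- by move=> z; rewrite lee_fin mulr_ge0 ?powR_ge0.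
apply: eq_integral => r _; rewrite /fubini_G /=.
under eq_integral do rewrite EFinM.
by rewrite ge0_integralZl_EFin//; exact: measurable_ball_mass_powR.
Qed.

Lemma measurable_ball_power : measurable_fun setT ball_power.
Proof.
apply: (@measurable_fun_fubini_tonelli_G _ _ _ _ _ (lebesgue_tuple d)
  (fun z => (`|ball_mass mu z| `^ alpha)%:E)).
- by apply/measurable_EFinP; exact: measurable_ball_powR.
- by move=> z; rewrite lee_fin powR_ge0.
Qed.

(** This places the measure in [L^alpha] of the control measure, so that its stable integral makes
    sense; the same integrand is the majorant in the convergence of the exponents. *)
Lemma ball_mass_integrable : alpha_beta_space d alpha beta mu ->
  (\int[LL]_z (pos_part_fun (fun r => r `^ (- 1 - beta)) z.2 * `|ball_mass mu z| `^ alpha)%:E < +oo)%E.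
Proof.
move=> [C [p [q [p0 pb bq hC]]]].
have mg : measurable_fun setT (pos_part_fun (fun r : R => r `^ (- 1 - beta))).
  apply: measurable_pos_part_fun.
  by apply: (@measurable_funTS _ _ _ _ _ (fun r => r `^ _)); exact: measurable_powR.
have g0 : forall r : R, 0 <= pos_part_fun (fun r : R => r `^ (- 1 - beta)) r.
  by apply: pos_part_fun_ge0 => r _; exact: powR_ge0.
rewrite ball_power_tonelli//.
pose phi (r : R) := r `^ (- 1 - beta) * Num.min (r `^ p) (r `^ q).
have mphi : measurable_fun setT phi.
  apply: measurable_funM; first exact: measurable_powR.
  by apply: measurable_minr; exact: measurable_powR.
have phi0 r : 0 <= phi r by rewrite mulr_ge0 ?powR_ge0// le_min !powR_ge0.
apply: (@le_lt_trans _ _ (\int[leb]_r ((`|C|)%:E * ((EFin \o phi) \_ `]0%R, +oo[) r))%E).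
  apply: ge0_le_integral => //.
  - by move=> r _; rewrite mule_ge0 ?ball_power_ge0 ?lee_fin.
  - by apply: emeasurable_funM; [exact/measurable_EFinP|exact: measurable_ball_power].
  - apply: measurable_funeM; apply/(measurable_restrictT _ _).1 => //.
    by apply: measurable_funTS; exact/measurable_EFinP.
  - move=> r _; have [r0|r0] := ltP 0 r; last first.
      by rewrite pos_part_fun0// mul0e mule_ge0 ?lee_fin// patchE; case: ifP => //; rewrite lee_fin.
    rewrite pos_part_funE// patchE mem_set/=; last by rewrite in_itv/= r0.
    rewrite muleC -EFinM /phi mulrCA EFinM [leLHS]muleC lee_wpmul2l ?lee_fin ?powR_ge0//.
    apply: le_trans (hC r r0) _; rewrite lee_fin ler_wpM2r ?ler_norm//.
    by rewrite le_min !powR_ge0.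
rewrite ge0_integralZl_EFin//; last 2 first.
- by move=> r _; rewrite patchE; case: ifP => //; rewrite lee_fin.
- apply/(measurable_restrictT _ _).1 => //.
  by apply: measurable_funTS; exact/measurable_EFinP.
rewrite -integral_mkcond; have := integral_min_powR_lty pb bq.
rewrite -ge0_fin_numE; last by apply: integral_ge0 => r _; rewrite lee_fin phi0.
by move=> h; rewrite -ge0_fin_numE ?fin_numM// mule_ge0 ?integral_ge0// => r _; rewrite lee_fin phi0.
Qed.

End ball_mass_power.

(** * Radii inside and outside the asymptotic range of the density *)

Section near_far.
Context {R : realType} (d : nat) (eps : int) (alpha beta Cbeta : R) (f : R -> R).
Hypotheses (heps : eps = 1 \/ eps = -1) (alpha1 : 1 < alpha) (beta0 : 0 < beta) (Cbeta0 : 0 < Cbeta).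
Hypothesis hf : radius_density d eps beta Cbeta f.

Local Notation leb := (@lebesgue_measure R).
Local Notation LL := (lebesgue_tuple d \x leb)%E.

(** Membership in [zero_pow eps] is reduced to an explicit interval, []0, e / 2[] or []M', +oo[]. It
    is measurable, and off it [s] is bounded below or above, so that powers of [s] compare in one
    direction with a constant given by the endpoint. *)
Lemma zero_powP (S : set R) : zero_pow eps S ->
  exists2 S' : set R, measurable S' /\ S' `<=` S &
   zero_pow eps S' /\ forall (a b : R),
    (if eps == 1 then a <= b else b <= a) ->
    exists2 K, 0 <= K & forall s, 0 < s -> ~ S' s -> s `^ a <= K * s `^ b.
Proof.
rewrite /zero_pow; case: eqP => [_|_] hS.
- have [e e0 he] := hS.
  exists `]0, (e / 2)%R[%classic; first split => //.
    move=> x /=; rewrite in_itv/= => /andP[x0 xe]; apply: he => //=.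
    rewrite /ball_ /= sub0r normrN gtr0_norm//; lra.
  split.
    exists (e / 2) => /=; first by rewrite divr_gt0.
    move=> x /=; rewrite /ball_ /= sub0r normrN => xe x0.
    by rewrite in_itv/= x0 -(gtr0_norm x0).
  move=> a b ab; exists ((e / 2) `^ (a - b)); first exact: powR_ge0.
  move=> s s0; rewrite /= in_itv/= s0/= => /negP; rewrite -leNgt => es.
  have e20 : 0 < e / 2 by rewrite divr_gt0.
  have -> : s `^ a = s `^ (a - b) * s `^ b.
    by rewrite -powRD ?subrK// (gt_eqF s0) implybT.
  have E x : x `^ (a - b) = (x `^ (b - a))^-1 by rewrite -powRN opprB.
  rewrite ler_wpM2r ?powR_ge0// !E lef_pV2 ?posrE ?powR_gt0//.
  by rewrite ge0_ler_powR ?nnegrE ?(ltW s0) ?(ltW e20)// subr_ge0.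
- have [M [_ hM]] := hS.
  pose M' := Num.max M 1.
  have M'0 : 0 < M' by rewrite lt_max ltr01 orbT.
  exists `]M', +oo[%classic; first split => //.
    by move=> x /=; rewrite in_itv/= andbT gt_max => /andP[/hM].
  split.
    by exists M'; split; [exact: num_real|move=> x Mx /=; rewrite in_itv/= Mx].
  move=> a b ab; exists (M' `^ (a - b)); first exact: powR_ge0.
  move=> s s0; rewrite /= in_itv/= andbT => /negP; rewrite -leNgt => es.
  have -> : s `^ a = s `^ (a - b) * s `^ b.
    by rewrite -powRD ?subrK// (gt_eqF s0) implybT.
  by rewrite ler_wpM2r ?powR_ge0// ge0_ler_powR ?nnegrE ?(ltW s0) ?(ltW M'0)// subr_ge0.
Qed.

(** The ratio of [f] to its equivalent tends to 1, hence is eventually below 2. *)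
Lemma density_bound_near : zero_pow eps [set s | 0 < s -> f s <= 2 * Cbeta * s `^ (- 1 - beta)].
Proof.
have [_ f0 _ hcv] := hf.
have FF : Filter (zero_pow eps : set_system R).
  by rewrite /zero_pow; case: ifP => _; exact: _.
have h2 : (1 : R) < 2 by rewrite ltr1n.
have H : zero_pow eps [set s | f s / (Cbeta * s `^ (- 1 - beta)) < 2].
  by apply: (cvgr_lt _ hcv).
apply: (filterS _ H) => s hs s0.
have p0 : 0 < Cbeta * s `^ (- 1 - beta) by rewrite mulr_gt0// powR_gt0.
by rewrite -mulrA -ler_pdivrMr// ltW.
Qed.

(** [e] is the smaller of [p] and [d] if [eps = 1], the larger of [q] and [d] otherwise. Its
    position relative to [d] lets the moment of order [d] control [s^e] off the asymptotic range;
    its position relative to [beta] makes [rho^(e - beta)] tend to 0. *)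
Lemma ball_power_exponent (mu : charge (Rd R d) R) : alpha_beta_space d alpha beta mu ->
  exists e C : R, [/\ 0 <= C, forall r, 0 < r -> (ball_power alpha mu r <= (C * r `^ e)%:E)%E,
    if eps == 1 then e <= d%:R else d%:R <= e &
    if eps == 1 then e < beta else beta < e].
Proof.
move=> [C [p [q [p0 pb bq hC]]]].
have [W W0 hW] := ball_power_volume alpha1 mu.
have hp r : 0 < r -> (ball_power alpha mu r <= (`|C| * r `^ p)%:E)%E.
  move=> r0; apply: le_trans (hC r r0) _; rewrite lee_fin.
  apply: (@le_trans _ _ (`|C| * Num.min (r `^ p) (r `^ q))).
    by rewrite ler_wpM2r ?ler_norm// le_min !powR_ge0.
  by rewrite ler_wpM2l// ge_min lexx.
have hq r : 0 < r -> (ball_power alpha mu r <= (`|C| * r `^ q)%:E)%E.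
  move=> r0; apply: le_trans (hC r r0) _; rewrite lee_fin.
  apply: (@le_trans _ _ (`|C| * Num.min (r `^ p) (r `^ q))).
    by rewrite ler_wpM2r ?ler_norm// le_min !powR_ge0.
  by rewrite ler_wpM2l// ge_min lexx orbT.
have hd r : 0 < r -> (ball_power alpha mu r <= (W * r `^ d%:R)%:E)%E.
  by move=> r0; rewrite powR_mulrn ?(ltW r0)//; exact/hW/ltW.
case: (eps == 1).
  have [pd|dp] := leP p d%:R; first by exists p, `|C|; split.
  by exists d%:R, W; split => //; exact: lt_trans pb.
have [dq|qd] := leP d%:R q; first by exists q, `|C|; split.
by exists d%:R, W; split => //; exact: lt_trans qd.
Qed.

Definition radius_moment : \bar R :=
  (\int[leb]_r (pos_part_fun f r * r `^ d%:R)%:E)%E.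

Lemma radius_moment_lty : (radius_moment < +oo)%E.
Proof.
have [_ f0 + _] := hf; apply: le_lt_trans.
rewrite [leRHS]integral_mkcond le_eqVlt; apply/orP; left; apply/eqP.
apply: eq_integral => r _; rewrite patchE; have [r0|r0] := ltP 0 r.
  rewrite pos_part_funE// mem_set/=; last by rewrite in_itv/= r0.
  by rewrite mulrC powR_mulrn// ltW.
rewrite pos_part_fun0// mul0r memNset//= in_itv/= andbT; apply/negP.
by rewrite -leNgt.
Qed.

(** The density [f (r / rho) / rho] divided by [rho^beta]. The factor left beside it in the
    intensity is [lambda rho^beta], the power [alpha] of the normalisation. *)
Definition rescaled_density (rho r : R) : R :=
  rho `^ (- 1 - beta) * pos_part_fun f (r / rho).

Lemma rescaled_density_ge0 rho r : 0 <= rescaled_density rho r.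
Proof.
by have [_ f0 _ _] := hf; rewrite mulr_ge0 ?powR_ge0//; exact: pos_part_fun_ge0.
Qed.

Lemma measurable_rescaled_density rho : measurable_fun setT (rescaled_density rho).
Proof.
have [mf _ _ _] := hf; apply: measurable_funM => //.
by apply: (measurableT_comp (measurable_pos_part_fun mf)); exact: measurable_funM.
Qed.

(** With [r = rho s], off [S] the bound [r^e] becomes [rho^e s^e <= K rho^e s^d], and the moment of
    order [d] absorbs [s^d]. The prefactor [rho^(-1 - beta)] and the Jacobian [rho] leave
    [rho^(e - beta)]. *)
Lemma far_integral_le (mu : charge (Rd R d) R) (S : set R) (e C K rho : R) :
  measurable S -> 0 <= C -> 0 <= K -> 0 < rho ->
  (forall r, 0 < r -> (ball_power alpha mu r <= (C * r `^ e)%:E)%E) ->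
  (forall s, 0 < s -> ~ S s -> s `^ e <= K * s `^ d%:R) ->
  (\int[LL]_z (rescaled_density rho z.2 * \1_(~` S) (z.2 / rho)%R * `|ball_mass mu z| `^ alpha)%:E <=
   (rho `^ (e - beta) * (C * K))%:E * radius_moment)%E.
Proof.
move=> mS C0 K0 rho0 hC hK.
have [mf f0 _ _] := hf.
have mff := measurable_pos_part_fun mf.
have ff0 := pos_part_fun_ge0 f0.
have mind : measurable_fun setT (fun r : R => \1_(~` S) (r / rho) : R).
  apply: (measurableT_comp (measurable_indic (measurableC mS))).
  exact: measurable_funM.
rewrite (@ball_power_tonelli _ _ _ mu (fun r => rescaled_density rho r * \1_(~` S) (r / rho))); last 2 first.
- by apply: measurable_funM => //; exact: measurable_rescaled_density.
- by move=> r; rewrite mulr_ge0 ?rescaled_density_ge0.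
pose c := rho `^ (e - beta) * (C * K).
have c0 : 0 <= c by rewrite !mulr_ge0 ?powR_ge0.
pose g r : \bar R := (c * (pos_part_fun f r * r `^ d%:R))%:E.
have g0 r : (0 <= g r)%E by rewrite lee_fin !mulr_ge0 ?powR_ge0.
have mfd : measurable_fun setT (fun r : R => pos_part_fun f r * r `^ d%:R).
  by apply: measurable_funM => //; exact: measurable_powR.
have mg : measurable_fun setT g by apply/measurable_EFinP; exact: measurable_funM.
have <- : (\int[leb]_r g r = c%:E * radius_moment)%E.
  rewrite /g; under eq_integral do rewrite EFinM.
  rewrite ge0_integralZl_EFin//; last exact/measurable_EFinP.
  by move=> r _; rewrite lee_fin mulr_ge0 ?powR_ge0.
rewrite -(ge0_integral_scale rho0 mg g0).
apply: ge0_le_integral => //.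
- move=> r _; apply: mule_ge0; last exact: ball_power_ge0.
  by rewrite lee_fin mulr_ge0 ?rescaled_density_ge0.
- apply: emeasurable_funM; last exact: measurable_ball_power.
  by apply/measurable_EFinP/measurable_funM => //; exact: measurable_rescaled_density.
- apply: measurable_funeM; apply: (measurableT_comp mg); exact: measurable_funM.
- move=> r _; rewrite /g -EFinM.
  have rhs0 : (0 <= (rho^-1 * (c * (pos_part_fun f (r / rho) * (r / rho) `^ d%:R)))%:E)%E.
    by rewrite lee_fin !mulr_ge0 ?powR_ge0 ?invr_ge0 ?(ltW rho0).
  have [r0|r0] := ltP 0 r; last first.
    rewrite (_ : rescaled_density rho r = 0) ?mul0r ?mul0e//.
    by rewrite /rescaled_density pos_part_fun0 ?mulr0// pmulr_lle0 ?invr_gt0.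
  rewrite indicE; have [/set_mem nS|_] := boolP (r / rho \in ~` S); last by rewrite mulr0 mul0e.
  have s0 : 0 < r / rho by rewrite divr_gt0.
  rewrite mulr1; apply: (@le_trans _ _ ((rescaled_density rho r)%:E * (C * r `^ e)%:E)%E).
    by rewrite lee_wpmul2l ?lee_fin ?rescaled_density_ge0 ?hC.
  rewrite -EFinM lee_fin /rescaled_density; set F := pos_part_fun f _.
  have F0 : 0 <= F by exact: ff0.
  have rE : r `^ e = rho `^ e * (r / rho) `^ e.
    by rewrite -powRM ?(ltW rho0) ?(ltW s0)// mulrCA divff ?mulr1// gt_eqF.
  have pE : rho `^ (- 1 - beta) * rho `^ e = rho^-1 * rho `^ (e - beta).
    rewrite -(powR_inv1 (ltW rho0)) -!powRD ?(gt_eqF rho0) ?implybT//.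
    by congr (_ `^ _); ring.
  have -> : rho `^ (- 1 - beta) * F * (C * r `^ e) =
      rho^-1 * rho `^ (e - beta) * C * F * (r / rho) `^ e by rewrite rE -pE; ring.
  have -> : rho^-1 * (c * (F * (r / rho) `^ d%:R)) =
      rho^-1 * rho `^ (e - beta) * C * F * (K * (r / rho) `^ d%:R) by rewrite /c; ring.
  by rewrite ler_wpM2l ?hK// !mulr_ge0 ?powR_ge0// invr_ge0 ltW.
Qed.

End near_far.

Lemma ae_sum d (T : measurableType d) (R : realType) (P : {measure set T -> \bar R})
    (V : eqType) (s : seq V) (F G : V -> T -> R) :
  (forall y, {ae P, forall w, F y w = G y w}) ->
  {ae P, forall w, \sum_(y <- s) F y w = \sum_(y <- s) G y w}.
Proof.
move=> FG; elim: s => [|y s IH]; first by apply: aeW => w; rewrite !big_nil.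
by apply: filterS2 (FG y) IH => w h1 h2; rewrite !big_cons h1 h2.
Qed.

(** * Stable integrals *)

Section stable_sums.
Context d (T : measurableType d) d' (E : measurableType d') (R : realType).
Variables (P : probability T R) (alpha : R) (m : {measure set E -> \bar R}) (b : R).
Variable M : set E -> T -> R.
Hypotheses (alpha1 : 1 < alpha) (hM : stable_random_measure P alpha m b M).

Local Notation fin := (finite_sets m).

Let fin0 : fin set0.
Proof. by split; [exact: measurable0|rewrite measure0]. Qed.

(** Sigma-additivity for a sequence of empty sets: a convergent series with constant terms has zero
    terms. *)
Lemma srm0 : {ae P, forall w, M set0 w = 0}.
Proof.
have := srm_sigma_additive hM (fun=> fin0) (@trivIset_set0 _ _ _).
rewrite bigcup0// => /(_ fin0); apply: filterS => w h.
have h1 : series (fun _ : nat => M set0 w) n @[n --> \oo] --> M set0 w by exact: h.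
have cv : cvgn (series (fun _ : nat => M set0 w)) by apply/cvg_ex; exists (M set0 w).
have := cvg_series_cvg_0 cv.
by move/(cvg_lim (@norm_hausdorff _ R)); rewrite lim_cst//; exact: norm_hausdorff.
Qed.

(** Padding with empty sets turns the finite family into a sequence whose partial sums are constant
    from [k] on, outside the null set where [M set0] does not vanish. *)
Lemma srm_finite_additive k (A : 'I_k -> set E) (q : pred 'I_k) (U : set E) :
  (forall i, fin (A i)) -> trivIset setT A -> fin U ->
  U = [set z | exists2 i, q i & A i z] ->
  {ae P, forall w, M U w = \sum_(i | q i) M (A i) w}.
Proof.
move=> finA tA finU UE.
pose B n : set E := if insub n is Some i then (if q i then A i else set0) else set0.
have finB n : fin (B n).
  by rewrite /B; case: insub => [i|]; [case: (q i)|]; [exact: finA|exact: fin0|exact: fin0].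
have Bi (i : 'I_k) : B i = if q i then A i else set0 by rewrite /B valK.
have BU : \bigcup_n B n = U.
  rewrite UE; apply/seteqP; split => z /=.
    move=> [n _]; rewrite /B; case: insubP => [i _ _|//].
    by case: ifP => // qi Az; exists i.
  by move=> [i qi Az]; exists i => //; rewrite Bi qi.
have tB : trivIset setT B.
  move=> i j _ _ [z [/= zi zj]]; move: zi zj; rewrite /B.
  case: insubP => [i' _ <-|//]; case: insubP => [j' _ <-|//].
  case: ifP => // _ zi; case: ifP => // _ zj; congr (nat_of_ord _).
  by apply: tA => //; exists z.
have finBU : fin (\bigcup_n B n) by rewrite BU.
have := srm_sigma_additive hM finB tB finBU.
apply: filterS2 srm0 => w w0; rewrite BU => h.
have seriesE n : (k <= n)%N -> series (fun n => M (B n) w) n = \sum_(i | q i) M (A i) w.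
  move=> kn; rewrite /series/= (big_cat_nat (leq0n k) kn)//= [X in _ + X]big_nat_cond.
  rewrite [X in _ + X]big1 ?addr0; last first.
    by move=> i /andP[/andP[ki _] _]; rewrite /B insubN -?leqNgt.
  rewrite big_mkord [RHS]big_mkcond/=; apply: eq_bigr => i _; rewrite Bi.
  by case: ifP.
apply/esym; have h1 : series (fun n => M (B n) w) n @[n --> \oo] --> M U w by exact: h.
apply: (cvg_unique _ _ h1) => //.
by apply: cvg_near_cst; exists k => // n /= kn; exact: seriesE.
Qed.

Variables (p : nat) (A : 'I_p -> set E).
Hypotheses (finA : forall i, fin (A i)) (tA : trivIset setT A).

Let mA i : measurable (A i). Proof. by have [] := finA i. Qed.
Let ltA i : (m (A i) < +oo)%E. Proof. by have [] := finA i. Qed.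

(** [F] equals [h i] on [A i] and 0 elsewhere, so a function of [F] vanishing at 0 integrates to a
    finite sum over the [m (A i)]. These are the exponents of the independent variables
    [h i * M (A i)]. *)
Lemma srm_cos_sum (h : 'I_p -> R) :
  let F z := \sum_i h i * \1_(A i) z in
  let a := - \int[m]_z (`|F z| `^ alpha) in
  let c := \int[m]_z (`|F z| `^ alpha * (b * Num.sg (F z) * tan (pi * alpha / 2))) in
  \int[P]_w cos (\sum_i h i * M (A i) w) = expR a * cos c /\
  \int[P]_w sin (\sum_i h i * M (A i) w) = expR a * sin c.
Proof.
move=> F a c.
have Fz z : (exists2 i, A i z & F z = h i) \/ (forall i, ~ A i z) /\ F z = 0.
  have [[i Ai]|nA] := pselect (exists i, A i z).
    left; exists i => //; rewrite /F (bigD1 i)//= indicE mem_set// mulr1 big1 ?addr0//.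
    move=> j ji; rewrite indicE memNset ?mulr0// => Aj.
    by move/eqP : ji; apply; apply: tA => //; exists z.
  right; split => [i Ai|]; first by apply: nA; exists i.
  by rewrite /F big1// => i _; rewrite indicE memNset ?mulr0// => Ai; apply: nA; exists i.
have HF (H : R -> R) : H 0 = 0 -> forall z, H (F z) = \sum_i H (h i) * \1_(A i) z.
  move=> H0 z; case: (Fz z) => [[i Ai ->]|[nA ->]].
    rewrite (bigD1 i)//= indicE mem_set// mulr1 big1 ?addr0//.
    move=> j ji; rewrite indicE memNset ?mulr0// => Aj.
    by move/eqP : ji; apply; apply: tA => //; exists z.
  by rewrite H0 big1// => i _; rewrite indicE memNset ?mulr0// => Ai; apply: nA Ai.
have a0 : alpha != 0 by rewrite gt_eqF// (lt_trans ltr01).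
have aE : a = \sum_i - (fine (m (A i)) * `|h i| `^ alpha).
  rewrite /a; under eq_Rintegral do rewrite (HF (fun x => `|x| `^ alpha)) ?normr0 ?powR0//.
  by rewrite Rintegral_indic_sum// -sumrN; apply: eq_bigr => i _; rewrite mulrC.
have cE : c = \sum_i fine (m (A i)) * `|h i| `^ alpha * (b * Num.sg (h i) * tan (pi * alpha / 2)).
  rewrite /c; under eq_Rintegral do rewrite (HF (fun x => `|x| `^ alpha * (b * Num.sg x * tan (pi * alpha / 2)))) ?normr0 ?powR0 ?mul0r//.
  by rewrite Rintegral_indic_sum//; apply: eq_bigr => i _; ring.
have law i : \int[P]_w cos (h i * M (A i) w) =
     expR (- (fine (m (A i)) * `|h i| `^ alpha)) *
     cos (fine (m (A i)) * `|h i| `^ alpha * (b * Num.sg (h i) * tan (pi * alpha / 2))) /\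
   \int[P]_w sin (h i * M (A i) w) =
     expR (- (fine (m (A i)) * `|h i| `^ alpha)) *
     sin (fine (m (A i)) * `|h i| `^ alpha * (b * Num.sg (h i) * tan (pi * alpha / 2))).
  have := srm_law hM (finA i) (h i); rewrite stable_cfE /charfun /=.
  rewrite -powRrM mulVf// powRr1 ?fine_ge0//.
  by case=> -> ->.
rewrite aE cE; split.
- apply: (@independent_cos_sum _ _ _ _ _ P p (fun i w => M (A i) w) _ _ (fun i x => h i * x)).
  + by move=> i; exact: (srm_measurable hM (finA i)).
  + exact: (srm_independent hM).
  + by move=> i; exact: measurable_funM.
  + by move=> i; have [] := law i.
  + by move=> i; have [] := law i.
- apply: (@independent_sin_sum _ _ _ _ _ P p (fun i w => M (A i) w) _ _ (fun i x => h i * x)).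
  + by move=> i; exact: (srm_measurable hM (finA i)).
  + exact: (srm_independent hM).
  + by move=> i; exact: measurable_funM.
  + by move=> i; have [] := law i.
  + by move=> i; have [] := law i.
Qed.

End stable_sums.

(** * Inequalities for the power alpha *)

Section powR_inequalities.
Context {R : realType} (alpha : R).
Hypothesis alpha1 : 1 < alpha.

Lemma powR_norm_sum_le k : exists2 C : R, 0 <= C &
  forall x : 'I_k -> R, `|\sum_i x i| `^ alpha <= C * \sum_i `|x i| `^ alpha.
Proof.
have a0 : alpha != 0 by rewrite gt_eqF// (lt_trans ltr01).
elim: k => [|k [C C0 IH]].
  by exists 0 => // x; rewrite !big_ord0 normr0 powR0// mulr0.
exists (2 `^ alpha * (1 + C)); first by rewrite mulr_ge0 ?powR_ge0// addr_ge0.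
move=> x; rewrite !big_ord_recl (le_trans (powR_normD_le alpha1 _ _))//.
set S := \sum_(i < k) `|_| `^ alpha.
have S0 : 0 <= S by apply: sumr_ge0 => i _; exact: powR_ge0.
set y := `|x ord0| `^ alpha.
have y0 : 0 <= y by exact: powR_ge0.
apply: (@le_trans _ _ (2 `^ alpha * y + 2 `^ alpha * (C * S))).
  by rewrite lerD2l ler_wpM2l ?powR_ge0// IH.
rewrite -mulrDr -mulrA ler_wpM2l ?powR_ge0//.
rewrite mulrDl mul1r mulrDr; have := mulr_ge0 C0 y0; lra.
Qed.

(* If |x - y| is small compared with |y|, then x / y is near 1; otherwise both
   |x| and |y| are controlled by |x - y|. *)
Lemma powR_sg_approx (e : R) : 0 < e -> exists2 C : R, 0 <= C &
  forall x y : R, `| `|x| `^ alpha - `|y| `^ alpha| <= e * `|y| `^ alpha + C * `|x - y| `^ alpha /\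
    `| `|x| `^ alpha * Num.sg x - `|y| `^ alpha * Num.sg y| <= e * `|y| `^ alpha + C * `|x - y| `^ alpha.
Proof.
move=> e0; have a0 : 0 <= alpha by rewrite ltW// (lt_trans ltr01).
have [eta [eta0 eta1 heta]] : exists eta : R, [/\ 0 < eta, eta < 1 &
    forall r, `|r - 1| < eta -> `|r `^ alpha - 1| <= e].
  have c1 : {for 1, continuous (fun r : R => r `^ alpha)} by exact: continuous_powR_gt0.
  have /cvgrPdist_le/(_ e e0)[t /= t0 ht] := c1.
  exists (Num.min t (1 / 2)); split.
  - by rewrite lt_min t0/= divr_gt0.
  - by rewrite gt_min; apply/orP; right; lra.
  move=> r; rewrite lt_min => /andP[rt _].
  have := ht r; rewrite /= powR1 => H; rewrite distrC; apply: H.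
  by rewrite /ball_ /= distrC.
exists ((1 + eta^-1) `^ alpha + (eta^-1) `^ alpha); first by rewrite addr_ge0 ?powR_ge0.
move=> x y; have [near|far] := ltP `|x - y| (eta * `|y|).
  have y0 : 0 < `|y|.
    by rewrite -(pmulr_rgt0 _ eta0); exact: le_lt_trans near.
  have yn0 : y != 0 by rewrite -normr_gt0.
  pose r := x / y.
  have xE : x = r * y by rewrite /r divfK.
  have r1 : `|r - 1| < eta.
    by rewrite -(ltr_pM2r y0) -normrM mulrBl -xE mul1r.
  have r0 : 0 < r by move: r1; rewrite ltr_norml => /andP[]; lra.
  have hr := heta r r1.
  have sgx : Num.sg x = Num.sg y by rewrite xE sgrM gtr0_sg// mul1r.
  have tail0 : 0 <= ((1 + eta^-1) `^ alpha + (eta^-1) `^ alpha) * `|x - y| `^ alpha.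
    by rewrite mulr_ge0 ?powR_ge0// addr_ge0 ?powR_ge0.
  have main : `| `|x| `^ alpha - `|y| `^ alpha| <= e * `|y| `^ alpha.
    rewrite xE normrM (gtr0_norm r0) powRM ?(ltW r0)//.
    rewrite -{2}(mul1r (`|y| `^ alpha)) -mulrBl normrM (ger0_norm (powR_ge0 `|y| _)).
    by rewrite ler_wpM2r ?powR_ge0.
  split; first by rewrite (le_trans main)// lerDl.
  rewrite sgx -mulrBl normrM; apply: (@le_trans _ _ (`| `|x| `^ alpha - `|y| `^ alpha| * 1)).
    by rewrite ler_wpM2l// normr_sg; case: (_ != _).
  by rewrite mulr1 (le_trans main)// lerDl.
have ybd : `|y| <= eta^-1 * `|x - y| by rewrite mulrC ler_pdivlMr// mulrC.
have xbd : `|x| <= (1 + eta^-1) * `|x - y|.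
  rewrite mulrDl mul1r -{1}(subrK y x) (le_trans (ler_normD _ _))// lerD2l//.
have ei0 : 0 <= eta^-1 by rewrite invr_ge0 ltW.
have xp : `|x| `^ alpha <= (1 + eta^-1) `^ alpha * `|x - y| `^ alpha.
  rewrite -powRM ?addr_ge0// ge0_ler_powR ?nnegrE// mulr_ge0// addr_ge0//.
have yp : `|y| `^ alpha <= (eta^-1) `^ alpha * `|x - y| `^ alpha.
  by rewrite -powRM// ge0_ler_powR ?nnegrE// mulr_ge0.
have head0 : 0 <= e * `|y| `^ alpha by rewrite mulr_ge0 ?powR_ge0// ltW.
have tot : `|x| `^ alpha + `|y| `^ alpha <= e * `|y| `^ alpha +
    ((1 + eta^-1) `^ alpha + (eta^-1) `^ alpha) * `|x - y| `^ alpha.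
  by rewrite -[leLHS]add0r mulrDl lerD// lerD.
split; apply: le_trans tot; apply: le_trans (ler_normB _ _) _.
  by rewrite (ger0_norm (powR_ge0 `|x| alpha)) (ger0_norm (powR_ge0 `|y| alpha)).
rewrite !normrM (ger0_norm (powR_ge0 `|x| alpha)) (ger0_norm (powR_ge0 `|y| alpha)); apply: lerD.
  by rewrite -[leRHS]mulr1 ler_wpM2l ?powR_ge0// normr_sg; case: (_ != _).
by rewrite -[leRHS]mulr1 ler_wpM2l ?powR_ge0// normr_sg; case: (_ != _).
Qed.

End powR_inequalities.

(** * Convergence in probability *)

Lemma cvg_in_probability_sum d (T : measurableType d) (R : realType) (P : probability T R)
    k (X : 'I_k -> nat -> T -> R) (Y : 'I_k -> T -> R) (t : 'I_k -> R) :
  (forall i n, measurable_fun setT (X i n)) -> (forall i, measurable_fun setT (Y i)) ->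
  (forall i, cvg_in_probability P (X i) (Y i)) ->
  cvg_in_probability P (fun n w => \sum_i t i * X i n w) (fun w => \sum_i t i * Y i w).
Proof.
move=> mX mY XY.
(* If every difference is below [e / B], the combination is below [e]; the 1 makes this strict and
   keeps [B] positive. *)
pose B := 1 + \sum_i `|t i|.
have B0 : 0 < B by rewrite ltr_pwDl// sumr_ge0.
move=> e e0; pose e' := e / B.
have e'0 : 0 < e' by rewrite divr_gt0.
have mS n : measurable_fun setT (fun w => \sum_i t i * X i n w).
  by apply: measurable_sum => i; exact: measurable_funM.
have mS' : measurable_fun setT (fun w => \sum_i t i * Y i w).
  by apply: measurable_sum => i; exact: measurable_funM.
have mge (f : T -> R) c : measurable_fun setT f -> measurable [set w | c <= `|f w|].
  move=> mf; rewrite -[X in measurable X]setTI.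
  have -> : [set w | c <= `|f w|] = (fun w => `|f w|) @^-1` `[c, +oo[.
    by apply/seteqP; split => w /=; rewrite in_itv/= andbT.
  by apply: (measurableT_comp _ mf) => //; exact: measurable_itv.
have mA i n : measurable [set w | e' <= `|X i n w - Y i w|].
  by apply: (mge (fun w => X i n w - Y i w)); exact: measurable_funB.
have bd n : (P [set w | (e <= `|\sum_i t i * X i n w - \sum_i t i * Y i w|)%R] <=
    \sum_(i < k) P [set w | (e' <= `|X i n w - Y i w|)%R])%E.
  apply: (@le_trans _ _ (P (\big[setU/set0]_(i < k) [set w | (e' <= `|X i n w - Y i w|)%R]))).
    apply: le_measure.
    - by apply: mem_set; apply: (mge (fun w => \sum_i t i * X i n w - \sum_i t i * Y i w)); exact: measurable_funB.
    - by apply: mem_set; apply: bigsetU_measurable => i _; exact: mA.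
    - move=> w /= hw; apply: contrapT => nw.
      have lt i : `|X i n w - Y i w| < e'.
        rewrite ltNge; apply/negP => h; apply: nw; rewrite -bigcup_seq /=.
        by exists i => //=; exact: mem_index_enum.
      move: hw; apply/negP; rewrite -ltNge -sumrB.
      apply: (@le_lt_trans _ _ (\sum_i `|t i| * e')).
        apply: le_trans (ler_norm_sum _ _ _) _; apply: ler_sum => i _.
        by rewrite -mulrBr normrM ler_wpM2l// ltW.
      rewrite -mulr_suml /e' mulrA ltr_pdivrMr// mulrC ltr_pM2l//.
      by rewrite /B ltrDr.
  suff [] : measurable (\big[setU/set0]_(i < k) [set w | (e' <= `|X i n w - Y i w|)%R]) /\
    (P (\big[setU/set0]_(i < k) [set w | (e' <= `|X i n w - Y i w|)%R]) <=
    \sum_(i < k) P [set w | (e' <= `|X i n w - Y i w|)%R])%E by [].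
  apply: (@big_ind2 _ _ (fun (A : set T) (x : \bar R) => measurable A /\ (P A <= x)%E)).
  - by split; [exact: measurable0|rewrite measure0].
  - move=> A1 x1 A2 x2 [mA1 h1] [mA2 h2]; split; first exact: measurableU.
    by apply: le_trans (measureU2 _ mA1 mA2) _; exact: leeD.
  - by move=> i _; split => //; exact: mA.
apply: (squeeze_cvge (f := fun=> 0%E) (h := fun n => (\sum_(i < k) P [set w | (e' <= `|X i n w - Y i w|)%R])%E)).
- by apply: nearW => n; rewrite measure_ge0 bd.
- exact: cvg_cst.
- have E0 : 0%E = (\sum_(i < k) 0)%E :> \bar R by rewrite big1.
  rewrite [X in _ --> X]E0; apply: cvg_nnesum => // i _.
    by apply: nearW => n; exact: measure_ge0.
  exact: XY.
Qed.

(** Off an event of small probability the Lipschitz bound applies, on it the trivial bound 2; with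
    [e' = e / 4] the total is below [e' + 2 * e']. *)
Lemma cvg_in_probability_lipschitz d (T : measurableType d) (R : realType) (P : probability T R)
    (X : nat -> T -> R) (Y : T -> R) (g : R -> R) :
  (forall n, measurable_fun setT (X n)) -> measurable_fun setT Y ->
  cvg_in_probability P X Y -> measurable_fun setT g ->
  (forall x, `|g x| <= 1) -> (forall x y, `|g x - g y| <= `|x - y|) ->
  \int[P]_w g (X n w) @[n --> \oo] --> \int[P]_w g (Y w).
Proof.
move=> mX mY XY mg g1 gl.
apply/cvgrPdist_le => e e0.
pose e' := e / 4; have e'0 : 0 < e' by rewrite divr_gt0.
have mA n : measurable [set w | e' <= `|X n w - Y w|].
  rewrite -[X in measurable X]setTI.
  have -> : [set w | e' <= `|X n w - Y w|] = (fun w => `|X n w - Y w|) @^-1` `[e', +oo[.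
    by apply/seteqP; split => w /=; rewrite in_itv/= andbT.
  have mXY : measurable_fun setT (fun w => `|X n w - Y w|).
    by apply: measurableT_comp => //; exact: measurable_funB.
  by apply: mXY => //; exact: measurable_itv.
have H : \forall n \near \oo, fine (P [set w | e' <= `|X n w - Y w|]) < e'.
  by have /fine_cvgP[_ h] := XY e' e'0; apply: (cvgr_lt _ h).
apply: filterS H => n Pn.
have ig (Z : T -> R) : measurable_fun setT Z -> P.-integrable setT (EFin \o (fun w => g (Z w))).
  by move=> mZ; apply: (@bounded_integrable _ _ _ _ _ 1) => //; exact: measurableT_comp.
have iK : P.-integrable setT (EFin \o (fun w => e' + 2 * \1_[set w | e' <= `|X n w - Y w|] w)).
  apply: (@bounded_integrable _ _ _ _ _ (e' + 2)).
    apply: measurable_funD => //; apply: measurable_funM => //; exact: measurable_indic.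
  move=> w; rewrite ger0_norm; last by rewrite addr_ge0 ?(ltW e'0)// mulr_ge0.
  by rewrite lerD2l indicE; case: (_ \in _); rewrite ?mulr1// mulr0.
rewrite distrC -RintegralB//; [|exact: ig|exact: ig].
apply: le_trans (le_norm_Rintegral (K := fun w => e' + 2 * \1_[set w | e' <= `|X n w - Y w|] w) _ _ iK) _.
- by apply: measurable_funB; exact: measurableT_comp.
- move=> w; rewrite indicE; have [_|/negP nw] := boolP (_ \in _).
    rewrite mulr1; apply: (@le_trans _ _ (1 + 1)).
      by rewrite (le_trans (ler_normB _ _))// lerD.
    by have := e'0; lra.
  rewrite mulr0 addr0 (le_trans (gl _ _))// ltW// ltNge; apply/negP => h; apply: nw.
  exact: mem_set.
have -> : \int[P]_w (e' + 2 * \1_[set w | e' <= `|X n w - Y w|] w) =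
    e' + 2 * fine (P [set w | e' <= `|X n w - Y w|]).
  rewrite RintegralD//; last 2 first.
  - by apply: (@bounded_integrable _ _ _ _ _ `|e'|).
  - apply: (@bounded_integrable _ _ _ _ _ 2).
      by apply: measurable_funM => //; exact: measurable_indic.
    by move=> w; rewrite ger0_norm ?mulr_ge0// indicE; case: (_ \in _); rewrite ?mulr1// mulr0.
  rewrite Rintegral_cst1; congr (_ + _).
  have := @Rintegral_indic_sum _ _ _ P 1 (fun=> 2) (fun=> [set w | e' <= `|X n w - Y w|]).
  rewrite big_ord1 => <- //.
    by apply: eq_Rintegral => w _; rewrite big_ord1.
  by move=> _; rewrite (le_lt_trans (probability_le1 _ _))// ltry.
by rewrite /e' in Pn *; lra.
Qed.

Lemma finite_range_ffun (R : realType) (E : Type) k (s : 'I_k -> E -> R) :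
  (forall j, finite_set (range (s j))) ->
  finite_set (range (fun z => [ffun j => s j z])).
Proof.
move=> fs.
have fsP j : {r : seq R | forall z, s j z \in r}.
  apply: cid; have [r rE] := (finite_seqP (range (s j))).1 (fs j).
  by exists r => z; have : range (s j) (s j z) by []; rewrite rE.
pose r j := projT1 (fsP j).
pose N := \max_j size (r j).
pose h (v : {ffun 'I_k -> 'I_N.+1}) : {ffun 'I_k -> R} := [ffun j => nth 0 (r j) (v j)].
apply: (@sub_finite_set _ _ (range h)); last exact/finite_image/finite_finset.
move=> _ [z _ <-]; exists [ffun j => inord (index (s j z) (r j))] => //.
apply/ffunP => j; rewrite /h !ffunE inordK ?nth_index//; first exact: (projT2 (fsP j)).
rewrite ltnS (leq_trans (index_size _ _))// /N.
by rewrite (bigD1 j)//= leq_maxl.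
Qed.

Lemma measurable_sgr (R : realType) : measurable_fun setT (Num.sg : R -> R).
Proof.
rewrite (_ : Num.sg = fun x : R => \1_(`]0, +oo[ : set R) x - \1_(`]-oo, 0[ : set R) x).
  by apply: measurable_funB; apply: measurable_indic; exact: measurable_itv.
apply/funext => x; rewrite !indicE !mem_setE !in_itv/= andbT.
have [x0|x0|x0] := ltgtP 0 x.
- by rewrite gtr0_sg// subr0.
- by rewrite ltr0_sg// sub0r.
- by rewrite -x0 sgr0 subr0.
Qed.

Lemma Rintegral_sum d (T : measurableType d) (R : realType) (m : {measure set T -> \bar R})
    k (g : 'I_k -> T -> R) : (forall j, m.-integrable setT (EFin \o g j)) ->
  \int[m]_x (\sum_j g j x) = \sum_j \int[m]_x g j x.
Proof.
elim: k g => [|k IH] g ig.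
  by under eq_Rintegral do rewrite big_ord0; rewrite big_ord0 Rintegral_cst// mul0r.
under eq_Rintegral do rewrite big_ord_recl.
rewrite RintegralD//; first by rewrite IH ?big_ord_recl.
have := @integrable_sum _ _ _ m setT measurableT _ (index_enum 'I_k) xpredT
  (fun j x => (g (lift ord0 j) x)%:E) (fun j _ => ig _).
by apply: eq_integrable => // x _ /=; rewrite sumEFin.
Qed.

Lemma cvg_sum_ord (R : realType) k (u : 'I_k -> nat -> R) (l : 'I_k -> R) :
  (forall j, u j @ \oo --> l j) -> \sum_j u j n @[n --> \oo] --> \sum_j l j.
Proof.
elim: k u l => [|k IH] u l ul.
  rewrite big_ord0 (_ : (fun n => _) = fun=> 0); first exact: cvg_cst.
  by apply/funext => n; rewrite big_ord0.
rewrite big_ord_recl (_ : (fun n => _) = fun n => u ord0 n + \sum_(j < k) u (lift ord0 j) n).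
  by apply: cvgD; [exact: ul|exact: (IH (fun j => u (lift ord0 j)))].
by apply/funext => n; rewrite big_ord_recl.
Qed.

Lemma measurable_norm_powR d (T : measurableType d) (R : realType) (alpha : R) (f : T -> R) :
  measurable_fun setT f -> measurable_fun setT (fun z => `|f z| `^ alpha).
Proof.
by move=> mf; apply: (measurableT_comp (measurable_powR _)); exact: measurableT_comp.
Qed.

(** * Characteristic functions of stable integrals *)

Section stable_functional.
Context d (T : measurableType d) d' (E : measurableType d') (R : realType).
Variables (P : probability T R) (alpha : R) (m : {measure set E -> \bar R}) (b : R).
Variable M : set E -> T -> R.
Hypotheses (alpha1 : 1 < alpha) (hM : stable_random_measure P alpha m b M).
Import HBSimple.

Local Notation fin := (finite_sets m).
Local Notation La := (Lalpha alpha m).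

Lemma Lalpha_integrable (f : E -> R) : La f ->
  m.-integrable setT (EFin \o (fun z => `|f z| `^ alpha)).
Proof.
move=> [mf foo]; apply/integrableP; split.
  apply/measurable_EFinP; apply: (measurableT_comp (measurable_powR _)).
  exact: measurableT_comp.
by under eq_integral do rewrite /= ger0_norm ?powR_ge0//.
Qed.

Lemma Lalpha_levelset (f : E -> R) (y : R) : La f -> y != 0 -> fin (f @^-1` [set y]).
Proof.
move=> Lf y0; have [mf _] := Lf.
have mA : measurable (f @^-1` [set y]).
  by rewrite -[X in measurable X]setTI; apply: mf => //; exact: measurable_set1.
split => //.
have iu := Lalpha_integrable Lf.
have mu : measurable_fun setT (fun z => `|f z| `^ alpha) by have /measurable_int/measurable_EFinP := iu.
have c0 : `|y| `^ alpha != 0 by rewrite powR_eq0 normr_eq0 negb_and y0.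
apply: (@le_lt_trans _ _ (m ((fun z => `|f z| `^ alpha) @^-1` [set `|y| `^ alpha]))).
  apply: le_measure; [exact: mem_set|apply: mem_set|by move=> z /= ->].
  by rewrite -[X in measurable X]setTI; apply: mu => //; exact: measurable_set1.
by apply: (integrable_levelset mu iu _ c0).
Qed.

Lemma simple_stable_integralE (s : {sfun E >-> R}) w :
  simple_stable_integral M s w = \sum_(y <- fset_set (range s)) y * M (s @^-1` [set y]) w.
Proof. by rewrite /simple_stable_integral fsbig_finite. Qed.

Lemma measurable_simple_stable_integral (s : {sfun E >-> R}) : La s ->
  measurable_fun setT (simple_stable_integral M s).
Proof.
move=> Ls.
rewrite (_ : simple_stable_integral M s = fun w => \sum_(y <- fset_set (range s)) y * M (s @^-1` [set y]) w); last first.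
  by apply/funext => w; exact: simple_stable_integralE.
apply: measurable_sum => y; have [->|y0] := eqVneq y 0.
  by rewrite (_ : (fun w => _) = cst 0)//; apply/funext => w; rewrite mul0r.
by apply: measurable_funM => //; exact: (srm_measurable hM (Lalpha_levelset Ls y0)).
Qed.

Variable k : nat.

(** The simple functions [s j] have different level sets; the vector [S z] of their values gives a
    common refinement [A i]. Each level set of [s j] is a finite union of the [A i], on which [M] is
    almost surely additive, and the sum becomes one over disjoint sets. *)
Lemma simple_stable_functional (s : 'I_k -> {sfun E >-> R}) (t : 'I_k -> R) :
  (forall j, La (s j)) ->
  let F z := \sum_j t j * s j z in
  let a := - \int[m]_z (`|F z| `^ alpha) in
  let c := \int[m]_z (`|F z| `^ alpha * (b * Num.sg (F z) * tan (pi * alpha / 2))) in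
  \int[P]_w cos (\sum_j t j * simple_stable_integral M (s j) w) = expR a * cos c /\
  \int[P]_w sin (\sum_j t j * simple_stable_integral M (s j) w) = expR a * sin c.
Proof.
move=> Ls F a c.
pose S z : {ffun 'I_k -> R} := [ffun j => s j z].
have finS : finite_set (range S) by apply: finite_range_ffun => j; exact: fimfunP.
have [p [v [v_inj v0 vr SE]]] := @finite_range_decomposition R E {ffun 'I_k -> R} S [ffun=> 0] finS.
pose A i := S @^-1` [set v i].
have AE i : A i = \bigcap_(j in [set: 'I_k]) (s j @^-1` [set v i j]).
  apply/seteqP; split => z /=; first by move=> + j _ => /ffunP/(_ j); rewrite ffunE.
  by move=> h; apply/ffunP => j; rewrite ffunE; exact: h.
have mA i : measurable (A i).
  by rewrite AE; apply: fin_bigcap_measurable => // j _.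
have finA i : fin (A i).
  split=> //; have [j vj] : exists j, v i j != 0.
    apply/existsP; rewrite -negb_forall; apply/negP => /forallP h.
    by move/eqP : (v0 i); apply; apply/ffunP => j; rewrite ffunE; exact/eqP/h.
  have [mB] := Lalpha_levelset (Ls j) vj; apply: le_lt_trans.
  by apply: le_measure; [exact: mem_set|exact: mem_set|rewrite AE; apply: bigcap_inf].
have tA : trivIset setT A.
  by move=> i j _ _ [z [/= zi zj]]; apply: v_inj; rewrite -zi -zj.
have coverA z : S z != [ffun=> 0] -> exists i, A i z.
  move=> Sz; apply: contrapT => nA.
  (* The decomposition applied to the indicator of nonzero vectors shows that every nonzero value of
     [S] is listed. *)
  have := SE (fun u => (u != [ffun=> 0])%:R); rewrite eqxx => /(_ erefl z).
  rewrite Sz big1; first by move/eqP; rewrite oner_eq0.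
  by move=> i _; rewrite indicE memNset ?mulr0// => Ai; apply: nA; exists i.
have SSI j : {ae P, forall w, simple_stable_integral M (s j) w = \sum_i v i j * M (A i) w}.
  have h y : {ae P, forall w, y * M (s j @^-1` [set y]) w = y * \sum_(i | v i j == y) M (A i) w}.
    (* The level set of 0 may have infinite measure, where nothing is known about [M]; the factor 0
       removes it. *)
    have [->|y0] := eqVneq y 0; first by apply: aeW => w; rewrite !mul0r.
    have UE : s j @^-1` [set y] = [set z | exists2 i, v i j == y & A i z].
      apply/seteqP; split => z /=.
        move=> zy; have [i Ai] : exists i, A i z.
          apply: coverA; apply/negP => /eqP/ffunP/(_ j); rewrite !ffunE zy.
          by move/eqP; rewrite (negbTE y0).
        exists i => //; apply/eqP; rewrite -zy -[LHS]/((v i : {ffun _ -> _}) j).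
        by have /= <- := Ai; rewrite ffunE.
      by move=> [i /eqP <- /= Ai]; have /ffunP/(_ j) := Ai; rewrite ffunE.
    have := srm_finite_additive hM finA tA (Lalpha_levelset (Ls j) y0) UE.
    by apply: filterS => w ->.
  apply: filterS (ae_sum (fset_set (range (s j))) h) => w.
  rewrite simple_stable_integralE => ->.
  under eq_bigr do rewrite mulr_sumr big_mkcond/=.
  rewrite exchange_big/=; apply: eq_bigr => i _.
  have vin : v i j \in fset_set (range (s j)).
    rewrite in_fset_set; last exact: fimfunP.
    by apply: mem_set; have [z _ <-] := vr i; rewrite ffunE.
  rewrite (bigD1_seq (v i j))//= eqxx big1 ?addr0// => y yv.
  by rewrite eq_sym (negbTE yv).
have SSall : {ae P, forall w, forall j, simple_stable_integral M (s j) w = \sum_i v i j * M (A i) w}.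
  by apply: filter_forall => j; exact: SSI.
pose h i := \sum_j t j * v i j.
have sumE : {ae P, forall w, \sum_j t j * simple_stable_integral M (s j) w = \sum_i h i * M (A i) w}.
  apply: filterS SSall => w hw.
  under eq_bigr do rewrite hw mulr_sumr.
  rewrite exchange_big/=; apply: eq_bigr => i _; rewrite /h mulr_suml.
  by apply: eq_bigr => j _; rewrite mulrA.
have FE : F = fun z => \sum_i h i * \1_(A i) z.
  apply/funext => z.
  have := SE (fun u => \sum_j t j * u j) _ z; rewrite -/A => <-.
    by apply: eq_bigr => j _; rewrite ffunE.
  by rewrite big1// => j _; rewrite ffunE mulr0.
have [Hc Hs] := srm_cos_sum alpha1 hM finA tA h.
have mS1 : measurable_fun setT (fun w => \sum_j t j * simple_stable_integral M (s j) w).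
  apply: measurable_sum => j; apply: measurable_funM => //.
  exact: measurable_simple_stable_integral.
have mS2 : measurable_fun setT (fun w => \sum_i h i * M (A i) w).
  apply: measurable_sum => i; apply: measurable_funM => //.
  exact: (srm_measurable hM (finA i)).
rewrite /a /c FE; split; rewrite -?Hc -?Hs; apply: ae_eq_Rintegral.
- exact: measurable_cos_comp.
- exact: measurable_cos_comp.
- by apply: filterS sumE => w ->.
- exact: measurable_sin_comp.
- exact: measurable_sin_comp.
- by apply: filterS sumE => w ->.
Qed.

Lemma integrable_sum_Lalpha (f : 'I_k -> E -> R) (t : 'I_k -> R) : (forall j, La (f j)) ->
  m.-integrable setT (EFin \o (fun z => \sum_j `|t j| `^ alpha * `|f j z| `^ alpha)).
Proof.
move=> Lf; have -> : EFin \o (fun z => \sum_j `|t j| `^ alpha * `|f j z| `^ alpha) =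
    (fun z => \sum_j (`|t j| `^ alpha)%:E * (`|f j z| `^ alpha)%:E)%E.
  by apply/funext => z /=; rewrite -sumEFin.
apply: integrable_sum => // j _.
by apply: integrableZl => //; exact: Lalpha_integrable.
Qed.

Lemma powR_sum_le (t : 'I_k -> R) : exists2 C : R, 0 <= C & forall x : 'I_k -> R,
  `|\sum_j t j * x j| `^ alpha <= C * \sum_j `|t j| `^ alpha * `|x j| `^ alpha.
Proof.
have [C C0 hC] := powR_norm_sum_le alpha1 k; exists C => // x.
rewrite (le_trans (hC _))//; rewrite le_eqVlt; apply/orP; left; apply/eqP; congr (_ * _).
by apply: eq_bigr => j _; rewrite normrM powRM.
Qed.

Lemma Lalpha_sum (f : 'I_k -> E -> R) (t : 'I_k -> R) : (forall j, La (f j)) ->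
  La (fun z => \sum_j t j * f j z).
Proof.
move=> Lf; have mF : measurable_fun setT (fun z => \sum_j t j * f j z).
  by apply: measurable_sum => j; apply: measurable_funM => //; have [] := Lf j.
split => //; have [C C0 hC] := powR_sum_le t.
have ig := integrableZl measurableT C (integrable_sum_Lalpha t Lf).
have : m.-integrable setT (EFin \o (fun z => `|\sum_j t j * f j z| `^ alpha)).
  apply: le_integrable ig => //; first by apply/measurable_EFinP; exact: measurable_norm_powR.
  by move=> z _ /=; rewrite lee_fin ger0_norm ?powR_ge0// (le_trans (hC _))// ler_norm.
move=> /integrableP[_]; apply: le_lt_trans; rewrite le_eqVlt; apply/orP; left; apply/eqP.
by apply: eq_integral => z _; rewrite /= (ger0_norm (powR_ge0 _ _)).
Qed.

(** The error terms of [powR_sg_approx] are integrated directly: [e1] absorbs the integral for [F],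
    and the [L^alpha] distance makes the other term vanish, without passing to almost everywhere
    convergent subsequences. The functions with and without the sign serve the imaginary and the
    real exponent. *)
Lemma Lalpha_cvg (F_ : nat -> E -> R) (F : E -> R) : (forall n, La (F_ n)) -> La F ->
  (forall n, La (fun z => F_ n z - F z)) ->
  \int[m]_z (`|F_ n z - F z| `^ alpha) @[n --> \oo] --> (0 : R) ->
  \int[m]_z (`|F_ n z| `^ alpha) @[n --> \oo] --> \int[m]_z (`|F z| `^ alpha) /\
  \int[m]_z (`|F_ n z| `^ alpha * Num.sg (F_ n z)) @[n --> \oo] -->
    \int[m]_z (`|F z| `^ alpha * Num.sg (F z)).
Proof.
move=> LF_ LF LD cD.
have key (phi : R -> R) : measurable_fun setT phi -> (forall x, `|phi x| <= `|x| `^ alpha) ->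
  (forall e, 0 < e -> exists2 C : R, 0 <= C & forall x y, `|phi x - phi y| <= e * `|y| `^ alpha + C * `|x - y| `^ alpha) ->
  \int[m]_z phi (F_ n z) @[n --> \oo] --> \int[m]_z phi (F z).
  move=> mphi phile phiC; apply/cvgrPdist_le => e e0.
  set IF := \int[m]_z (`|F z| `^ alpha).
  have IF0 : 0 <= IF by apply: Rintegral_ge0 => z _; exact: powR_ge0.
  pose e1 := e / 2 / (1 + IF).
  have e10 : 0 < e1 by rewrite !divr_gt0// ltr_pwDl.
  have [C C0 hC] := phiC e1 e10.
  have H : \forall n \near \oo, C * \int[m]_z (`|F_ n z - F z| `^ alpha) < e / 2.
    have h : C * \int[m]_z (`|F_ n z - F z| `^ alpha) @[n --> \oo] --> C * 0.
      by apply: cvgM => //; exact: cvg_cst.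
    by rewrite mulr0 in h; apply: (cvgr_lt _ h); rewrite divr_gt0.
  apply: filterS H => n hn.
  have iphi f : La f -> m.-integrable setT (EFin \o (fun z => phi (f z))).
    move=> Lf; apply: le_integrable (Lalpha_integrable Lf) => //.
      by apply/measurable_EFinP; apply: measurableT_comp => //; have [] := Lf.
    by move=> z _; rewrite lee_fin (le_trans (phile _))// ler_norm.
  have i1 := iphi _ (LF_ n); have i2 := iphi _ LF.
  rewrite distrC -(RintegralB measurableT i1 i2).
  have iD := Lalpha_integrable (LD n); have iF := Lalpha_integrable LF.
  have iR : m.-integrable setT (EFin \o (fun z => e1 * `|F z| `^ alpha + C * `|F_ n z - F z| `^ alpha)).
    exact: (integrableD measurableT (integrableZl measurableT e1 iF) (integrableZl measurableT C iD)).
  have iB : m.-integrable setT (EFin \o (fun z => phi (F_ n z) - phi (F z))).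
    exact: (integrableB measurableT (iphi _ (LF_ n)) (iphi _ LF)).
  apply: le_trans (le_normr_Rintegral measurableT iB) _.
  apply: (@le_trans _ _ (\int[m]_z (e1 * `|F z| `^ alpha + C * `|F_ n z - F z| `^ alpha))).
    by apply: le_Rintegral => //; exact: (integrable_norm iB).
  rewrite RintegralD//; last 2 first.
  - exact: (integrableZl measurableT e1 iF).
  - exact: (integrableZl measurableT C iD).
  rewrite !RintegralZl// -/IF (_ : e = e / 2 + e / 2); last by field.
  apply: lerD; last exact: ltW.
  rewrite /e1 mulrAC ler_pdivrMr ?ltr_pwDl// ler_wpM2l ?divr_ge0 ?(ltW e0)//.
  by rewrite lerDr.
split.
- apply: (key (fun x => `|x| `^ alpha)).
  + exact: measurable_norm_powR.
  + by move=> x; rewrite ger0_norm ?powR_ge0.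
  + move=> e e0; have [C C0 hC] := powR_sg_approx alpha1 e0.
    by exists C => // x y; have [] := hC x y.
- apply: (key (fun x => `|x| `^ alpha * Num.sg x)).
  + apply: measurable_funM; first exact: measurable_norm_powR.
    exact: measurable_sgr.
  + move=> x; rewrite normrM ger0_norm ?powR_ge0// -[leRHS]mulr1 ler_wpM2l ?powR_ge0//.
    by rewrite normr_sg; case: (_ != _).
  + move=> e e0; have [C C0 hC] := powR_sg_approx alpha1 e0.
    by exists C => // x y; have [] := hC x y.
Qed.

Variable I : (E -> R) -> T -> R.
Hypothesis hI : stable_integral P alpha m M I.

(** Linearity of [I] is not postulated: the combination is formed outside [I], from simple
    approximations of each [f j]. The exponents converge by [L^alpha] convergence, the expectations
    by convergence in probability, cosine and sine being bounded and Lipschitz. *)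
Lemma stable_functional (f : 'I_k -> E -> R) (t : 'I_k -> R) :
  (forall j, La (f j)) ->
  let F z := \sum_j t j * f j z in
  let a := - \int[m]_z (`|F z| `^ alpha) in
  let c := \int[m]_z (`|F z| `^ alpha * (b * Num.sg (F z) * tan (pi * alpha / 2))) in
  \int[P]_w cos (\sum_j t j * I (f j) w) = expR a * cos c /\
  \int[P]_w sin (\sum_j t j * I (f j) w) = expR a * sin c.
Proof.
move=> Lf F a c.
have mI j : measurable_fun setT (I (f j)) by have [] := hI (Lf j).
pose hs j := cid (hI (Lf j)).2.
pose s j := projT1 (hs j).
have Ls j n : La (s j n) by have [h _ _] := projT2 (hs j); exact: h.
have cs j : (\int[m]_z (`|s j n z - f j z| `^ alpha)%:E)%E @[n --> \oo] --> 0%E.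
  by have [] := projT2 (hs j).
have ps j : cvg_in_probability P (fun n => simple_stable_integral M (s j n)) (I (f j)).
  by have [] := projT2 (hs j).
pose F_ n z := \sum_j t j * s j n z.
have LF_ n : La (F_ n) by exact: (Lalpha_sum t (Ls ^~ n)).
have LF : La F by exact: (Lalpha_sum t Lf).
have Lsf j n : La (fun z => s j n z - f j z).
  split; first by apply: measurable_funB => //; have [] := Lf j.
  have [ms _] := Ls j n; have [mf _] := Lf j.
  have i1 := integrableZl measurableT (2 `^ alpha) (Lalpha_integrable (Ls j n)).
  have i2 := integrableZl measurableT (2 `^ alpha) (Lalpha_integrable (Lf j)).
  have : m.-integrable setT (EFin \o (fun z => `|s j n z - f j z| `^ alpha)).
    apply: le_integrable (integrableD measurableT i1 i2) => //.
      by apply/measurable_EFinP; apply: measurable_norm_powR; exact: measurable_funB.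
    move=> z _ /=; rewrite lee_fin ger0_norm ?powR_ge0// (le_trans (powR_normD_le alpha1 _ _))//.
    by rewrite normrN ler_norm.
  move=> /integrableP[_]; apply: le_lt_trans; rewrite le_eqVlt; apply/orP; left; apply/eqP.
  by apply: eq_integral => z _; rewrite /= (ger0_norm (powR_ge0 _ _)).
have DE n z : F_ n z - F z = \sum_j t j * (s j n z - f j z).
  by rewrite /F_ /F -sumrB; apply: eq_bigr => j _; rewrite mulrBr.
have LD n : La (fun z => F_ n z - F z).
  have := Lalpha_sum t (Lsf ^~ n); congr Lalpha; apply/funext => z; exact/esym/DE.
have cD : \int[m]_z (`|F_ n z - F z| `^ alpha) @[n --> \oo] --> (0 : R).
  have [C C0 hC] := powR_sum_le t.
  apply: (squeeze_cvgr (f := fun=> 0) (h := fun n => C * \sum_j `|t j| `^ alpha * \int[m]_z (`|s j n z - f j z| `^ alpha))).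
  - apply: nearW => n; apply/andP; split.
      by apply: Rintegral_ge0 => z _; exact: powR_ge0.
    have ig := integrableZl measurableT C (integrable_sum_Lalpha t (Lsf ^~ n)).
    apply: (@le_trans _ _ (\int[m]_z (C * \sum_j `|t j| `^ alpha * `|s j n z - f j z| `^ alpha))).
      apply: (le_Rintegral measurableT (Lalpha_integrable (LD n)) ig).
      by move=> z _; rewrite DE.
    rewrite (RintegralZl _ measurableT (integrable_sum_Lalpha t (Lsf ^~ n))).
    have ij j : m.-integrable setT (EFin \o (fun z => `|t j| `^ alpha * `|s j n z - f j z| `^ alpha)).
      exact: (integrableZl measurableT (`|t j| `^ alpha) (Lalpha_integrable (Lsf j n))).
    rewrite ler_wpM2l// (Rintegral_sum ij) le_eqVlt; apply/orP; left; apply/eqP.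
    by apply: eq_bigr => j _; rewrite (RintegralZl _ measurableT (Lalpha_integrable (Lsf j n))).
  - exact: cvg_cst.
  - rewrite -[X in _ --> X](mulr0 C); apply: cvgM; first exact: cvg_cst.
    have E0 : (0 : R) = \sum_(j < k) `|t j| `^ alpha * 0 by rewrite big1// => j _; rewrite mulr0.
    rewrite [X in _ --> X]E0.
    apply: (@cvg_sum_ord _ _ (fun j n => `|t j| `^ alpha * \int[m]_z (`|s j n z - f j z| `^ alpha))) => j.
    apply: cvgM; first exact: cvg_cst.
    by have /fine_cvgP[_] := cs j.
have [ca cc] := Lalpha_cvg LF_ LF LD cD.
have mX j n : measurable_fun setT (simple_stable_integral M (s j n)).
  exact: measurable_simple_stable_integral.
have cP := cvg_in_probability_sum t mX mI ps.
have mXn n : measurable_fun setT (fun w => \sum_j t j * simple_stable_integral M (s j n) w).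
  by apply: measurable_sum => j; exact: measurable_funM.
have mY : measurable_fun setT (fun w => \sum_j t j * I (f j) w).
  by apply: measurable_sum => j; exact: measurable_funM.
pose a_ n := - \int[m]_z (`|F_ n z| `^ alpha).
pose c_ n := \int[m]_z (`|F_ n z| `^ alpha * (b * Num.sg (F_ n z) * tan (pi * alpha / 2))).
have ca_ : a_ n @[n --> \oo] --> a by exact: cvgN.
have cE (G : E -> R) : La G -> \int[m]_z (`|G z| `^ alpha * (b * Num.sg (G z) * tan (pi * alpha / 2))) =
    (b * tan (pi * alpha / 2)) * \int[m]_z (`|G z| `^ alpha * Num.sg (G z)).
  move=> LG; rewrite -RintegralZl//.
    by apply: eq_Rintegral => z _; ring.
  apply: le_integrable (Lalpha_integrable LG) => //.
    apply/measurable_EFinP; apply: measurable_funM.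
      by apply: measurable_norm_powR; have [] := LG.
    by apply: (measurableT_comp (@measurable_sgr R)); have [] := LG.
  move=> z _; rewrite lee_fin normrM (ger0_norm (powR_ge0 _ _)) -[leRHS]mulr1 ler_wpM2l ?powR_ge0//.
  by rewrite normr_sg; case: (_ != _).
have cc_ : c_ n @[n --> \oo] --> c.
  rewrite /c (cE F LF) (_ : c_ = fun n => (b * tan (pi * alpha / 2)) * \int[m]_z (`|F_ n z| `^ alpha * Num.sg (F_ n z))); last first.
    by apply/funext => n; rewrite /c_ (cE (F_ n) (LF_ n)).
  by apply: cvgM => //; exact: cvg_cst.
split.
- have h1 := cvg_in_probability_lipschitz mXn mY cP (continuous_measurable_fun (@continuous_cos R))
    (@norm_cos_le1 R) (@cos_lipschitz R).
  apply: (cvg_unique _ h1) => //.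
  rewrite (_ : (fun n => _) = (fun n => expR (a_ n) * cos (c_ n))).
    by apply: cvgM; apply: continuous_cvg => //; [exact: continuous_expR|exact: continuous_cos].
  by apply/funext => n; have [] := simple_stable_functional t (Ls ^~ n).
- have h1 := cvg_in_probability_lipschitz mXn mY cP (continuous_measurable_fun (@continuous_sin R))
    (@norm_sin_le1 R) (@sin_lipschitz R).
  apply: (cvg_unique _ h1) => //.
  rewrite (_ : (fun n => _) = (fun n => expR (a_ n) * sin (c_ n))).
    by apply: cvgM; apply: continuous_cvg => //; [exact: continuous_expR|exact: continuous_sin].
  by apply/funext => n; have [] := simple_stable_functional t (Ls ^~ n).
Qed.

End stable_functional.

(** * The limit of the rescaled exponents *)

Section zero_pow.
Context {R : realType}.

Global Instance zero_pow_proper (eps : int) : ProperFilter (zero_pow eps : set_system R).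
Proof. by rewrite /zero_pow; case: ifP => _; exact: _. Qed.

Lemma zero_powN_gt0 (eps : int) : \forall rho \near (zero_pow eps : set_system R), 0 < rho.
Proof.
rewrite /zero_pow; case: ifP => _; first exact: nbhs_right_gt.
exact: nbhs_pinfty_gt.
Qed.

Variables (eps : int).
Hypothesis heps : eps = 1 \/ eps = -1.

Lemma zero_pow_scale (r : R) : 0 < r ->
  r / rho @[rho --> zero_pow (- eps)] --> (zero_pow eps : set_system R).
Proof.
move=> r0; rewrite /zero_pow; case: heps => -> /=.
- move=> S [e /= e0 he].
  exists (r / e); split; first exact: num_real.
  move=> rho hrho; have rho0 : 0 < rho by apply: lt_trans hrho; rewrite divr_gt0.
  have p0 : 0 < r / rho by rewrite divr_gt0.
  apply: he => //=; rewrite sub0r normrN gtr0_norm//.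
  by rewrite ltr_pdivrMr// mulrC -ltr_pdivrMr.
- move=> S [M [_ hM]].
  pose M' := Num.max M 1.
  have M'0 : 0 < M' by rewrite lt_max ltr01 orbT.
  exists (r / M') => /=; first by rewrite divr_gt0.
  move=> rho /=; rewrite sub0r normrN => h rho0; apply: hM.
  apply: (@le_lt_trans _ _ M'); first by rewrite le_max lexx.
  by rewrite ltr_pdivlMr// mulrC -ltr_pdivlMr// -(gtr0_norm rho0).
Qed.

Lemma zero_pow_powR (c : R) : (if eps == 1 then c < 0 else 0 < c) ->
  rho `^ c @[rho --> zero_pow (- eps)] --> (0 : R).
Proof.
case: heps => e1 hc.
- have c0 : c < 0 by rewrite e1 in hc.
  have h1 := @zero_pow_scale 1 ltr01.
  have z1 : zero_pow eps = 0^'+ :> set_system R by rewrite /zero_pow e1.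
  have h2 : (r `^ (- c)) @[r --> zero_pow eps] --> (0 : R).
    by rewrite z1; apply: powR_cvg0; rewrite oppr_gt0.
  have := cvg_comp _ _ h1 h2; apply: cvg_trans; apply: near_eq_cvg.
  apply: filterS (zero_powN_gt0 (- eps)) => rho rho0 /=.
  by rewrite div1r powRN -[X in (X `^ c)^-1]powR_inv1 ?(ltW rho0)// -powRrM mulN1r powRN invrK.
- have c0 : 0 < c by rewrite e1 in hc.
  rewrite /zero_pow e1 /=; exact: powR_cvg0.
Qed.

End zero_pow.

Section limit.
Context {R : realType} (d : nat) (eps : int) (alpha beta Cbeta : R) (f : R -> R).
Hypotheses (heps : eps = 1 \/ eps = -1) (alpha1 : 1 < alpha) (beta0 : 0 < beta) (Cbeta0 : 0 < Cbeta).
Hypothesis hf : radius_density d eps beta Cbeta f.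
Variable mu : charge (Rd R d) R.
Hypothesis hmu : alpha_beta_space d alpha beta mu.

Local Notation leb := (@lebesgue_measure R).
Local Notation LL := (lebesgue_tuple d \x leb)%E.
Local Notation resc := (rescaled_density beta f).

Let w (r : R) : R := pos_part_fun (fun r => r `^ (- 1 - beta)) r.

Let w0 r : 0 <= w r.
Proof. by apply: pos_part_fun_ge0 => s _; exact: powR_ge0. Qed.

Let mw : measurable_fun setT w.
Proof.
apply: measurable_pos_part_fun.
by apply: (@measurable_funTS _ _ _ _ _ (fun r => r `^ _)); exact: measurable_powR.
Qed.

Let mresc rho : measurable_fun setT (fun z : Rd R d * measurableTypeR R => resc rho z.2).
Proof.
exact: (measurableT_comp (measurable_rescaled_density hf rho) measurable_snd).
Qed.

Let mscaleind (S : set R) (rho : R) : measurable S ->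
  measurable_fun setT (fun z : Rd R d * measurableTypeR R => \1_S (z.2 / rho) : R).
Proof.
move=> mS; apply: (measurableT_comp (measurable_indic mS)).
by apply: measurable_funM => //; exact: measurable_snd.
Qed.

(** The prefactor of [rescaled_density] matches the homogeneity of the power, so the majorant does
    not depend on [rho]. *)
Lemma rescaled_density_le (S : set R) (rho r : R) : 0 < rho ->
  (forall s, S s -> 0 < s -> f s <= 2 * Cbeta * s `^ (- 1 - beta)) ->
  resc rho r * \1_S (r / rho) <= 2 * Cbeta * w r.
Proof.
move=> rho0 hS; have rhs0 : 0 <= 2 * Cbeta * w r.
  by rewrite mulr_ge0 ?w0// mulr_ge0// ltW.
rewrite indicE; have [/set_mem hs|_] := boolP (_ \in _); rewrite ?mulr0// mulr1.
have [r0|r0] := ltP 0 r; last first.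
  by rewrite /rescaled_density pos_part_fun0 ?mulr0// pmulr_lle0 ?invr_gt0.
have s0 : 0 < r / rho by rewrite divr_gt0.
rewrite /rescaled_density /w !pos_part_funE//.
have -> : r `^ (- 1 - beta) = rho `^ (- 1 - beta) * (r / rho) `^ (- 1 - beta).
  by rewrite -powRM ?(ltW rho0) ?(ltW s0)// mulrCA divff ?mulr1// gt_eqF.
by rewrite mulrCA ler_wpM2l ?powR_ge0// hS.
Qed.

Lemma rescaled_density_cvg (r : R) : 0 < r ->
  resc rho r @[rho --> zero_pow (- eps)] --> Cbeta * w r.
Proof.
move=> r0; have [_ _ _ hcv] := hf.
have h1 := cvg_comp _ _ (zero_pow_scale heps r0) hcv.
rewrite -[X in _ --> X]mulr1.
have h2 : (Cbeta * w r) * (f (r / rho) / (Cbeta * (r / rho) `^ (- 1 - beta)))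
    @[rho --> zero_pow (- eps)] --> Cbeta * w r * 1.
  by apply: cvgM; [exact: cvg_cst|exact: h1].
apply: cvg_trans h2; apply: near_eq_cvg.
apply: filterS (zero_powN_gt0 (- eps)) => rho rho0 /=.
have s0 : 0 < r / rho by rewrite divr_gt0.
rewrite /rescaled_density /w !pos_part_funE//.
have -> : r `^ (- 1 - beta) = rho `^ (- 1 - beta) * (r / rho) `^ (- 1 - beta).
  by rewrite -powRM ?(ltW rho0) ?(ltW s0)// mulrCA divff ?mulr1// gt_eqF.
by field; rewrite !gt_eqF// powR_gt0.
Qed.

(** [S] is the range of [r / rho] where the asymptotics of [f] can be used, chosen once for all
    [rho]; off it the exponent of [ball_power_exponent] gives a bound tending to 0. *)
Lemma near_far_split : exists S : set R, [/\ measurable S,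
    zero_pow eps S,
    forall s, S s -> 0 < s -> f s <= 2 * Cbeta * s `^ (- 1 - beta) &
    exists2 B : R -> R, B rho @[rho --> zero_pow (- eps)] --> (0 : R) &
      forall rho, 0 < rho ->
       (\int[LL]_z (resc rho z.2 * \1_(~` S) (z.2 / rho)%R * `|ball_mass mu z| `^ alpha)%:E
         <= (B rho)%:E)%E].
Proof.
have [S [mS subS] [zS hS]] := zero_powP (density_bound_near Cbeta0 hf).
have [e [C [C0 hC ed eb]]] := ball_power_exponent eps alpha1 hmu.
exists S; split => //.
have [K K0 hK] : exists2 K, 0 <= K & forall s, 0 < s -> ~ S s -> s `^ e <= K * s `^ d%:R.
  by apply: hS.
have [_ f0 _ _] := hf.
have mom : (0 <= radius_moment d f)%E.
  by apply: integral_ge0 => r _; rewrite lee_fin mulr_ge0 ?powR_ge0//; exact: pos_part_fun_ge0.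
exists (fun rho => rho `^ (e - beta) * (C * K) * fine (radius_moment d f)).
  rewrite -(mul0r (fine (radius_moment d f))) -(mul0r (C * K)).
  apply: cvgM; last exact: cvg_cst.
  apply: cvgM; last exact: cvg_cst.
  apply: zero_pow_powR => //; move: eb; case: ifP => _; first by rewrite subr_lt0.
  by rewrite subr_gt0.
move=> rho rho0; apply: le_trans (far_integral_le hf mS C0 K0 rho0 hC hK) _.
by rewrite [leRHS]EFinM fineK// ge0_fin_numE// (radius_moment_lty hf).
Qed.

Let mind_near (S : set R) rho : measurable S ->
  measurable_fun setT (fun z : Rd R d * measurableTypeR R =>
    (resc rho z.2 * \1_S (z.2 / rho)%R * `|ball_mass mu z| `^ alpha)).
Proof.
move=> mS; apply: measurable_funM; last exact: measurable_ball_powR.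
by apply: measurable_funM => //; exact: mscaleind.
Qed.

Let ind_ge0 (S : set R) rho (z : Rd R d * measurableTypeR R) :
  0 <= resc rho z.2 * \1_S (z.2 / rho)%R * `|ball_mass mu z| `^ alpha.
Proof.
by rewrite mulr_ge0 ?powR_ge0// mulr_ge0 ?(rescaled_density_ge0 hf)// indicE.
Qed.

Let Wint : \bar R := (\int[LL]_z (w z.2 * `|ball_mass mu z| `^ alpha)%:E)%E.

Let mwb : measurable_fun setT (fun z : Rd R d * measurableTypeR R => w z.2 * `|ball_mass mu z| `^ alpha).
Proof.
apply: measurable_funM; last exact: measurable_ball_powR.
exact: (measurableT_comp mw measurable_snd).
Qed.

Let Wint_fin : Wint \is a fin_num.
Proof.
rewrite ge0_fin_numE; first exact: ball_mass_integrable.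
by apply: integral_ge0 => z _; rewrite lee_fin mulr_ge0 ?powR_ge0.
Qed.

Lemma rescaled_integral_bound : exists B : R,
  \forall rho \near zero_pow (- eps),
   (\int[LL]_z (resc rho z.2 * `|ball_mass mu z| `^ alpha)%:E <= B%:E)%E.
Proof.
have [S [mS zS hS [B cB hB]]] := near_far_split.
(* The near part is at most [2 * Cbeta * Wint] for every [rho > 0], the far part eventually at most
   1. *)
exists (2 * Cbeta * fine Wint + 1).
have h1 : \forall rho \near zero_pow (- eps), B rho < 1 by apply: (cvgr_lt _ cB).
apply: filterS2 h1 (zero_powN_gt0 (- eps)) => rho B1 rho0.
have mSc : measurable (~` S) by exact: measurableC.
have C20 : 0 <= 2 * Cbeta by rewrite mulr_ge0// ltW.
apply: (@le_trans _ _ (\int[LL]_z (resc rho z.2 * \1_S (z.2 / rho)%R * `|ball_mass mu z| `^ alpha)%:E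
  + \int[LL]_z (resc rho z.2 * \1_(~` S) (z.2 / rho)%R * `|ball_mass mu z| `^ alpha)%:E)%E).
  rewrite -ge0_integralD//; last 4 first.
  - by move=> z _; rewrite lee_fin; exact: ind_ge0.
  - by apply/measurable_EFinP; exact: mind_near.
  - by move=> z _; rewrite lee_fin; exact: ind_ge0.
  - by apply/measurable_EFinP; exact: mind_near.
  rewrite le_eqVlt; apply/orP; left; apply/eqP; apply: eq_integral => z _.
  rewrite -EFinD; congr (_%:E); rewrite -mulrDl -mulrDr !indicE.
  have := in_setC (z.2 / rho) S => ->.
  by case: (_ \in _); rewrite /= ?addr0 ?add0r mulr1.
rewrite EFinD; apply: leeD; last by rewrite (le_trans (hB _ rho0))// lee_fin ltW.
rewrite EFinM fineK// -ge0_integralZl_EFin//; last 2 first.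
- by move=> z _; rewrite lee_fin mulr_ge0 ?powR_ge0.
- exact/measurable_EFinP.
apply: ge0_le_integral => //.
- by move=> z _; rewrite lee_fin; exact: ind_ge0.
- by apply/measurable_EFinP; exact: mind_near.
- by apply: measurable_funeM; exact/measurable_EFinP.
- move=> z _; rewrite -EFinM lee_fin mulrA ler_wpM2r ?powR_ge0//.
  exact: rescaled_density_le.
Qed.

(** [psi] stands for either part of the exponent and [L] for its limit. The bound [K |x|^alpha] is
    homogeneous, so the factors in [u] cancel and [g] dominates the near part for every [n]; the
    indicator of [S] is eventually 1 at each [r > 0] because [r / rho] tends to [0^eps]. The far
    part is at most [K * B (rho n)]. *)
Lemma rescaled_integral_cvg (rho u : nat -> R) (psi L : R -> R) (K : R) :
  (forall n, 0 < rho n) -> (forall n, 0 < u n) -> rho @ \oo --> zero_pow (- eps) ->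
  measurable_fun setT psi -> measurable_fun setT L -> 0 <= K ->
  (forall x, `|psi x| <= K * `|x| `^ alpha) ->
  (forall x, u n `^ alpha * psi (x / u n) @[n --> \oo] --> L x) ->
  \int[LL]_z (resc (rho n) z.2 * (u n `^ alpha * psi (ball_mass mu z / u n))) @[n --> \oo]
    --> \int[LL]_z (Cbeta * w z.2 * L (ball_mass mu z)).
Proof.
move=> rho0 u0 crho mpsi mL K0 hpsi hL.
have [S [mS zS hS [B cB hB]]] := near_far_split.
have mSc : measurable (~` S) by exact: measurableC.
pose h n (z : Rd R d * measurableTypeR R) : R := u n `^ alpha * psi (ball_mass mu z / u n).
have mh n : measurable_fun setT (h n).
  apply: measurable_funM => //; apply: (measurableT_comp mpsi).
  by apply: measurable_funM => //; exact: measurable_ball_mass.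
have hh n z : `|h n z| <= K * `|ball_mass mu z| `^ alpha.
  rewrite normrM (ger0_norm (powR_ge0 _ _)).
  apply: (@le_trans _ _ (u n `^ alpha * (K * `|ball_mass mu z / u n| `^ alpha))).
    by rewrite ler_wpM2l ?powR_ge0.
  rewrite normrM normfV (gtr0_norm (u0 n)) powR_div ?(ltW (u0 n))//.
  rewrite le_eqVlt; apply/orP; left; apply/eqP; field.
  by rewrite gt_eqF// powR_gt0.
pose A n (z : Rd R d * measurableTypeR R) : R := resc (rho n) z.2 * \1_S (z.2 / rho n) * h n z.
pose D n (z : Rd R d * measurableTypeR R) : R := resc (rho n) z.2 * \1_(~` S) (z.2 / rho n) * h n z.
have mA n : measurable_fun setT (A n).
  by apply: measurable_funM => //; apply: measurable_funM => //; exact: mscaleind.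
have mD n : measurable_fun setT (D n).
  by apply: measurable_funM => //; apply: measurable_funM => //; exact: mscaleind.
pose g (z : Rd R d * measurableTypeR R) : R := 2 * Cbeta * K * (w z.2 * `|ball_mass mu z| `^ alpha).
have ig : LL.-integrable setT (EFin \o g).
  have : LL.-integrable setT (EFin \o (fun z : Rd R d * measurableTypeR R => w z.2 * `|ball_mass mu z| `^ alpha)).
    apply/integrableP; split; first exact/measurable_EFinP.
    under eq_integral do rewrite /= ger0_norm ?mulr_ge0 ?powR_ge0//.
    by rewrite -ge0_fin_numE// integral_ge0// => z _; rewrite lee_fin mulr_ge0 ?powR_ge0.
  by move/(integrableZl measurableT (2 * Cbeta * K)); apply: eq_integrable => // z _; rewrite /= EFinM.
have Ag n z : `|A n z| <= g z.
  rewrite /A normrM (ger0_norm (mulr_ge0 _ _)) ?(rescaled_density_ge0 hf)//.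
  apply: (@le_trans _ _ (2 * Cbeta * w z.2 * (K * `|ball_mass mu z| `^ alpha))).
    apply: ler_pM => //; first by rewrite mulr_ge0 ?(rescaled_density_ge0 hf).
    exact: rescaled_density_le.
  by rewrite le_eqVlt; apply/orP; left; apply/eqP; rewrite /g; ring.
have iA n : LL.-integrable setT (EFin \o A n).
  apply: le_integrable ig => //; first exact/measurable_EFinP.
  by move=> z _; rewrite lee_fin (le_trans (Ag n z))// ler_norm.
have Dle n z : `|D n z| <= K * (resc (rho n) z.2 * \1_(~` S) (z.2 / rho n) * `|ball_mass mu z| `^ alpha).
  rewrite /D normrM (ger0_norm (mulr_ge0 _ _)) ?(rescaled_density_ge0 hf)//.
  rewrite mulrCA ler_wpM2l// mulr_ge0 ?(rescaled_density_ge0 hf)//.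
have Dint n : (\int[LL]_z `|(D n z)%:E| <= (K * B (rho n))%:E)%E.
  apply: (@le_trans _ _ (K%:E * \int[LL]_z (resc (rho n) z.2 * \1_(~` S) (z.2 / rho n)%R * `|ball_mass mu z| `^ alpha)%:E)%E); last first.
    by rewrite EFinM lee_wpmul2l ?lee_fin ?hB.
  rewrite -ge0_integralZl_EFin//; last 2 first.
  - by move=> z _; rewrite lee_fin; exact: ind_ge0.
  - by apply/measurable_EFinP; exact: mind_near.
  apply: ge0_le_integral => //.
  - by apply: measurableT_comp => //; exact/measurable_EFinP.
  - by apply: measurable_funeM; apply/measurable_EFinP; exact: mind_near.
  - by move=> z _; rewrite -EFinM lee_fin.
have iD n : LL.-integrable setT (EFin \o D n).
  apply/integrableP; split; first exact/measurable_EFinP.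
  by apply: le_lt_trans (Dint n) _; exact: ltry.
have split_int n : \int[LL]_z (resc (rho n) z.2 * (u n `^ alpha * psi (ball_mass mu z / u n))) =
    \int[LL]_z A n z + \int[LL]_z D n z.
  rewrite -RintegralD//; apply: eq_Rintegral => z _.
  rewrite /A /D -/(h n z) -mulrDl -mulrDr !indicE.
  have := in_setC (z.2 / rho n) S => ->.
  by case: (_ \in _); rewrite /= ?addr0 ?add0r mulr1.
rewrite (_ : (fun n => _) = (fun n => \int[LL]_z A n z + \int[LL]_z D n z)); last first.
  by apply/funext => n; exact: split_int.
rewrite -[X in _ --> X]addr0; apply: cvgD; last first.
  apply/norm_cvg0P; apply: (@squeeze_cvgr _ _ _ _ (fun=> 0) (fun n => K * B (rho n))).
  - apply: nearW => n; rewrite normr_ge0/= (le_trans (le_normr_Rintegral _ (iD n)))//.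
    rewrite -lee_fin; apply: le_trans (Dint n).
    rewrite /Rintegral fineK//.
    have /integrableP[_ h1] := iD n.
    by rewrite ge0_fin_numE// integral_ge0// => z _; rewrite lee_fin.
  - exact: cvg_cst.
  - rewrite -(mulr0 K); apply: cvgM; first exact: cvg_cst.
    exact: (cvg_comp _ _ crho cB).
apply: (Rintegral_dominated_cvg mA _ _ ig).
- apply: measurable_funM.
    by apply: measurable_funM => //; exact: (measurableT_comp mw measurable_snd).
  by apply: (measurableT_comp mL); exact: measurable_ball_mass.
- apply: aeW => -[x r] /=; have [r0|r0] := ltP 0 r; last first.
    rewrite /A /= /w pos_part_fun0// mulr0 mul0r.
    rewrite (_ : (fun n => _) = (fun=> 0)); first exact: cvg_cst.
    apply/funext => n; rewrite /rescaled_density pos_part_fun0 ?mulr0 ?mul0r//.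
    by rewrite pmulr_lle0 ?invr_gt0.
  apply: cvgM; last exact: hL.
  rewrite -[X in _ --> X]mulr1; apply: cvgM.
    exact: (cvg_comp _ _ crho (rescaled_density_cvg r0)).
  apply: cvg_near_cst.
  have H : \forall n \near \oo, S (r / rho n).
    exact: (cvg_comp _ _ crho (zero_pow_scale heps r0) _ zS).
  by apply: filterS H => n Sn; rewrite indicE mem_set.
- by apply: aeW => z n; exact: Ag.
Qed.

End limit.

(** * Product measures *)

Section product_sigma_finite.
Context d1 d2 (X : measurableType d1) (Y : measurableType d2) (R : realType).
Variables (m1 : {sigma_finite_measure set X -> \bar R}) (m2 : {sigma_finite_measure set Y -> \bar R}).

Lemma product_measure_sigma_finite : sigma_finite setT (m1 \x m2)%E.
Proof.
have /sigma_finiteP[F [TF ndF Foo]] := sigma_finiteT m1.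
have /sigma_finiteP[G [TG ndG Goo]] := sigma_finiteT m2.
exists (fun n => F n `*` G n).
  apply/esym/seteqP; split => // -[x y] _.
  have [i _ Fi] : (\bigcup_i F i) x by rewrite -TF.
  have [j _ Gj] : (\bigcup_i G i) y by rewrite -TG.
  exists (maxn i j) => //=; split.
  - by move: x Fi; exact/subsetPset/ndF/leq_maxl.
  - by move: y Gj; exact/subsetPset/ndG/leq_maxr.
move=> k; have [? ?] := Foo k; have [? ?] := Goo k.
split; first exact: measurableX.
by rewrite product_measure1E// lte_mul_pinfty// ge0_fin_numE.
Qed.

(** The product of the measures of centres and radii is itself a factor in the product with [G], and
    Fubini's theorem asks for it as a sigma-finite measure. *)
Definition product_sigma_finite : {sigma_finite_measure set (X * Y)%type -> \bar R} :=
  HB.pack (m1 \x m2)%E (Measure_isSigmaFinite.Build _ _ _ (m1 \x m2)%E product_measure_sigma_finite).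

End product_sigma_finite.

Section product.
Context d1 d2 (X : measurableType d1) (Y : measurableType d2) (R : realType).
Variables (m1 : {sigma_finite_measure set X -> \bar R}) (m2 : {sigma_finite_measure set Y -> \bar R}).

Lemma Rintegral_fubini (g : X * Y -> R) :
  (m1 \x m2)%E.-integrable setT (EFin \o g) ->
  (forall x, m2.-integrable setT (fun y => (g (x, y))%:E)) ->
  \int[(m1 \x m2)%E]_z g z = \int[m1]_x \int[m2]_y g (x, y).
Proof.
move=> ig igx; rewrite /Rintegral; congr fine.
rewrite -(@integral12_prod_meas1 _ _ _ _ _ m1 m2 _ ig); apply: eq_integral => x _.
rewrite /fubini_F /= fineK//.
by have := igx x => /(integrable_fin_num measurableT).
Qed.

Lemma integrable_mul_prod (h : X -> R) (k : Y -> R) :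
  m1.-integrable setT (EFin \o h) -> m2.-integrable setT (EFin \o k) ->
  (m1 \x m2)%E.-integrable setT (EFin \o (fun z => h z.1 * k z.2)).
Proof.
move=> ih ik.
have mh : measurable_fun setT h by have /measurable_int/measurable_EFinP := ih.
have mk : measurable_fun setT k by have /measurable_int/measurable_EFinP := ik.
have mg : measurable_fun setT (EFin \o (fun z : X * Y => h z.1 * k z.2)).
  apply/measurable_EFinP; apply: measurable_funM.
    exact: (measurableT_comp mh measurable_fst).
  exact: (measurableT_comp mk measurable_snd).
apply: (integrable12ltyP m1 m2 mg).2 => /=.
have iE x : (\int[m2]_y `|h x * k y|%:E = `|h x|%:E * \int[m2]_y (`|k y|)%:E)%E.
  under eq_integral do rewrite normrM EFinM.
  rewrite ge0_integralZl_EFin//; apply/measurable_EFinP; exact: measurableT_comp.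
under eq_integral do rewrite iE.
have /integrableP[_ ik'] := ik; have /integrableP[_ ih'] := ih.
have kfin : (\int[m2]_y (`|k y|)%:E)%E \is a fin_num.
  by rewrite ge0_fin_numE//; exact: integral_ge0.
under eq_integral do rewrite -(fineK kfin) muleC.
rewrite ge0_integralZl_EFin//; last 2 first.
- by apply/measurable_EFinP; exact: measurableT_comp.
- by rewrite fine_ge0// integral_ge0.
rewrite -ge0_fin_numE; last by rewrite mule_ge0 ?lee_fin ?fine_ge0 ?integral_ge0.
by rewrite fin_numM// ge0_fin_numE//; exact: integral_ge0.
Qed.

End product.

(** * Weighted Poisson fields *)

Section weighted.
Context d (X : measurableType d) (R : realType).
Variables (m1 : {sigma_finite_measure set X -> \bar R}) (G : probability (measurableTypeR R) R).
Hypothesis iG : G.-integrable setT (fun x : measurableTypeR R => (x : R)%:E).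
Variables (h : X -> R) (mh : measurable_fun setT (fun z : X * measurableTypeR R => h z.1))
  (h0 : forall z : X * measurableTypeR R, 0 <= h z.1).

Local Notation nu := (density_measure (m1 \x G)%E mh h0).

Section one.
Variable F : X -> R.
Hypotheses (mF : measurable_fun setT F) (ihF : m1.-integrable setT (EFin \o (fun x => h x * F x))).

Lemma measurable_weighted : measurable_fun setT (fun z : X * measurableTypeR R => z.2 * F z.1 : R).
Proof.
apply: measurable_funM; first exact: measurable_snd.
exact: (measurableT_comp mF measurable_fst).
Qed.

Let iprod : (m1 \x G)%E.-integrable setT
  (EFin \o (fun z : X * measurableTypeR R => h z.1 * (z.2 * F z.1))).
Proof.
have := integrable_mul_prod ihF iG.
apply: eq_integrable => // z _ /=; congr (_%:E).
by rewrite -mulrA [F _ * _]mulrC.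
Qed.

Lemma weighted_integrable : nu.-integrable setT (EFin \o (fun z => z.2 * F z.1)).
Proof. by apply: integrable_density_measure; [exact: measurable_weighted|exact: iprod]. Qed.

(** Integrating over the weight first leaves a function of [F x / u]. The bound [2 |x|] holds for
    both compensated integrands, [cos x - 1] and [sin x - x], and with the first moment of [G] gives
    integrability on the product. *)
Lemma weighted_integral (u : R) (phi : R -> R) :
  measurable_fun setT phi -> (forall x, `|phi x| <= 2 * `|x|) ->
  \int[nu]_z phi (z.2 * F z.1 / u) = \int[m1]_x (h x * \int[G]_y phi (F x / u * y)).
Proof.
move=> mphi hphi.
have mcomp : measurable_fun setT (fun z : X * measurableTypeR R => phi (z.2 * F z.1 / u)).
  apply: (measurableT_comp mphi); apply: measurable_funM => //.
  exact: measurable_weighted.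
rewrite Rintegral_density_measure//.
have iGp x : G.-integrable setT (EFin \o (fun y => phi (F x / u * y))).
  have ig := integrableZl measurableT (2 * (F x / u)) iG.
  apply: le_integrable ig => //.
    by apply/measurable_EFinP; apply: (measurableT_comp mphi); exact: measurable_funM.
  move=> y _ /=; rewrite lee_fin (le_trans (hphi _))// !normrM.
  by rewrite (ger0_norm (x := 2))// !mulrA.
have phiE x y : phi (y * F x / u) = phi (F x / u * y).
  by congr phi; ring.
have iGd x : G.-integrable setT (EFin \o (fun y => h x * phi (F x / u * y))).
  exact: (integrableZl measurableT (h x) (iGp x)).
rewrite Rintegral_fubini.
- apply: eq_Rintegral => z _.
  rewrite -(RintegralZl _ measurableT (iGp z)); apply: eq_Rintegral => y _ /=.
  by rewrite phiE.
- have ig := integrableZl measurableT (2 / u) iprod.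
  apply: le_integrable ig => //; first by apply/measurable_EFinP; exact: measurable_funM.
  move=> z _ /=; rewrite lee_fin.
  have -> : 2 / u * (h z.1 * (z.2 * F z.1)) = h z.1 * (2 * (z.2 * F z.1 / u)) :> R by ring.
  rewrite normrM [leRHS]normrM ler_wpM2l// (le_trans (hphi _))//.
  by rewrite [leRHS]normrM (ger0_norm (x := 2)).
- by move=> x; have := iGd x; apply: eq_integrable => // y _ /=; rewrite phiE.
Qed.

End one.

Variables (dO : measure_display) (Omega : measurableType dO) (P : probability Omega R).
Variable N : R.-ker Omega ~> (X * measurableTypeR R)%type.
Hypothesis hN : poisson_random_measure P N nu.

Definition weighted_field (F : X -> R) (w : Omega) : R := \int[N w]_z (z.2 * F z.1).

Lemma measurable_weighted_field F : measurable_fun setT F ->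
  measurable_fun setT (weighted_field F).
Proof. by move=> mF; exact: (measurable_poisson_Rintegral N (measurable_weighted mF)). Qed.

(** The compensator of the sine is linear in the weight, so its integral over [G] is [tau F x / u],
    exactly the centring in [weight_sin]. *)
Lemma weighted_field_functional (F : X -> R) (u tau : R) :
  measurable_fun setT F -> m1.-integrable setT (EFin \o (fun x => h x * F x)) ->
  \int[G]_x x = tau ->
  let a := \int[m1]_x (h x * weight_cos G (F x / u)) in
  let c := \int[m1]_x (h x * weight_sin tau G (F x / u)) in
  let Z w := (weighted_field F w - fine 'E_P[weighted_field F]) / u in
  \int[P]_w cos (Z w) = expR a * cos c /\ \int[P]_w sin (Z w) = expR a * sin c.
Proof.
move=> mF ihF meanG a c Z.
pose K (z : X * measurableTypeR R) : R := z.2 * F z.1.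
have mK : measurable_fun setT K := measurable_weighted mF.
have iK : nu.-integrable setT (EFin \o K) := weighted_integrable mF ihF.
have iKu : nu.-integrable setT (EFin \o (fun z => K z / u)).
  have := integrableZl measurableT u^-1 iK.
  by apply: eq_integrable => // z _ /=; rewrite -EFinM mulrC.
have [Hc Hs] := compensated_poisson_functional hN iKu.
have EE : fine 'E_P[weighted_field F] = \int[nu]_z K z.
  by rewrite unlock; congr fine; exact: (poisson_integral_mean hN iK).
have mE : \int[nu]_z (K z / u) = fine 'E_P[weighted_field F] / u.
  by rewrite EE RintegralZr.
have aE : \int[nu]_z (cos (K z / u) - 1) = a.
  apply: (weighted_integral mF ihF u (phi := fun x => cos x - 1)).
    by apply: measurable_funB => //; exact: measurable_cos_comp.
  by move=> x; rewrite (le_trans (norm_cosB1_le _))// ler_peMl// ler1n.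
have cE : \int[nu]_z (sin (K z / u) - K z / u) = c.
  transitivity (\int[m1]_x (h x * \int[G]_y (sin (F x / u * y) - F x / u * y))).
    apply: (weighted_integral mF ihF u (phi := fun x => sin x - x)).
      by apply: measurable_funB => //; exact: measurable_sin_comp.
    move=> x; rewrite (le_trans (ler_normB _ _))// mulr_natl mulr2n lerD2r.
    exact: norm_sin_le.
  apply: eq_Rintegral => x _; congr (_ * _).
  have i1 : G.-integrable setT (EFin \o (fun y => F x / u * y)).
    exact: (integrableZl measurableT (F x / u) iG).
  have i2 : G.-integrable setT (EFin \o (fun y => sin (F x / u * y))).
    apply: le_integrable i1 => //.
      by apply/measurable_EFinP; apply: measurable_sin_comp; exact: measurable_funM.
    by move=> y _; rewrite lee_fin norm_sin_le.
  by rewrite (RintegralB measurableT i2 i1) (RintegralZl _ measurableT iG) meanG.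
have mZ : measurable_fun setT Z.
  apply: measurable_funM => //; apply: measurable_funB => //.
  exact: measurable_weighted_field.
have mZ' : measurable_fun setT (fun w => \int[N w]_z (K z / u) - \int[nu]_z (K z / u)).
  apply: measurable_funB => //; apply: measurable_poisson_Rintegral.
  exact: measurable_funM.
have E : {ae P, forall w, Z w = \int[N w]_z (K z / u) - \int[nu]_z (K z / u)}.
  apply: filterS (poisson_integrable hN iK) => w iw.
  by rewrite mE RintegralZr// -mulrBl.
split.
- rewrite -aE -cE -Hc; apply: ae_eq_Rintegral.
  + exact: measurable_cos_comp.
  + exact: measurable_cos_comp.
  + by apply: filterS E => w ->.
- rewrite -aE -cE -Hs; apply: ae_eq_Rintegral.
  + exact: measurable_sin_comp.
  + exact: measurable_sin_comp.
  + by apply: filterS E => w ->.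
Qed.

(** Linearity of the integral against [N w] rests on integrability of all [k] integrands, which
    holds for almost every [w]; the means are integrals against the intensity, where integrability
    is known. *)
Lemma weighted_field_sum k (H : 'I_k -> X -> R) (t : 'I_k -> R) (F : X -> R) (u : R) :
  (forall i, measurable_fun setT (H i)) ->
  (forall i, m1.-integrable setT (EFin \o (fun x => h x * H i x))) ->
  (forall x, F x = \sum_i t i * H i x) ->
  {ae P, forall w,
    \sum_i t i * ((weighted_field (H i) w - fine 'E_P[weighted_field (H i)]) / u) =
    (weighted_field F w - fine 'E_P[weighted_field F]) / u}.
Proof.
move=> mH iH FE.
have mF : measurable_fun setT F.
  rewrite (_ : F = fun x => \sum_i t i * H i x); last exact/funext.
  by apply: measurable_sum => i; exact: measurable_funM.
have ihF : m1.-integrable setT (EFin \o (fun x => h x * F x)).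
  have := @integrable_sum _ _ _ m1 setT measurableT _ (index_enum 'I_k) xpredT
    (fun i x => (t i * (h x * H i x))%:E) (fun i _ => integrableZl measurableT (t i) (iH i)).
  apply: eq_integrable => // x _ /=; rewrite sumEFin FE mulr_sumr; congr (_%:E).
  by apply: eq_bigr => i _; rewrite mulrCA.
have wE (z : X * measurableTypeR R) : z.2 * F z.1 = \sum_i t i * (z.2 * H i z.1) :> R.
  by rewrite FE mulr_sumr; apply: eq_bigr => i _; rewrite mulrCA.
have lin (m : {measure set (X * measurableTypeR R) -> \bar R}) :
    (forall i, m.-integrable setT (EFin \o (fun z => z.2 * H i z.1))) ->
    \int[m]_z (z.2 * F z.1) = \sum_i t i * \int[m]_z (z.2 * H i z.1).
  move=> im; under eq_Rintegral do rewrite wE.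
  have imt i : m.-integrable setT (EFin \o (fun z => t i * (z.2 * H i z.1))).
    exact: (integrableZl measurableT (t i) (im i)).
  by rewrite (Rintegral_sum imt); apply: eq_bigr => i _; rewrite (RintegralZl _ measurableT (im i)).
have EE H' : measurable_fun setT H' -> m1.-integrable setT (EFin \o (fun x => h x * H' x)) ->
    fine 'E_P[weighted_field H'] = \int[nu]_z (z.2 * H' z.1).
  move=> mH' iH'; rewrite unlock; congr fine.
  exact: (poisson_integral_mean hN (weighted_integrable mH' iH')).
have mE : fine 'E_P[weighted_field F] = \sum_i t i * fine 'E_P[weighted_field (H i)].
  rewrite EE// (lin nu); last by move=> i; exact: weighted_integrable.
  by apply: eq_bigr => i _; rewrite EE.
have allint : {ae P, forall w, forall i, (N w).-integrable setT (EFin \o (fun z => z.2 * H i z.1))}.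
  by apply: filter_forall => i; exact: (poisson_integrable hN (weighted_integrable (mH i) (iH i))).
apply: filterS allint => w iw.
have -> : weighted_field F w = \sum_i t i * weighted_field (H i) w by exact: (lin (N w) iw).
by rewrite mE -sumrB mulr_suml; apply: eq_bigr => i _; ring.
Qed.

End weighted.

Section ball_field.
Context {R : realType} (d : nat) (eps : int) (beta Cbeta : R) (f : R -> R).
Hypothesis hf : radius_density d eps beta Cbeta f.

Local Notation leb := (@lebesgue_measure R).
Local Notation LL := (lebesgue_tuple d \x leb)%E.
Local Notation resc := (rescaled_density beta f).

Lemma ball_densityE (lambda rho : R) (z : Rd R d * measurableTypeR R) : 0 < rho ->
  ball_density lambda f rho z = lambda * rho `^ beta * resc rho z.2.
Proof.
move=> rho0; rewrite /ball_density /rescaled_density -mulrA; congr (_ * _).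
rewrite [RHS]mulrA -powRD ?(gt_eqF rho0) ?implybT//.
by rewrite (_ : beta + (-1 - beta) = -1) ?powR_inv1 ?(ltW rho0)// 1?mulrC//; ring.
Qed.

(** A case of [far_integral_le] with power 1 and [S] empty, so that every radius is far: the [L^1]
    bound of order [r^d] meets the moment of order [d]. This gives the field a finite mean. *)
Lemma rescaled_ball_mass_integrable (mu : charge (Rd R d) R) (rho : R) : 0 < rho ->
  LL.-integrable setT (EFin \o (fun z : Rd R d * measurableTypeR R => resc rho z.2 * ball_mass mu z)).
Proof.
move=> rho0; have [V [V0 _ IV]] := ball_mass_bound mu.
have mr : measurable_fun setT (fun z : Rd R d * measurableTypeR R => resc rho z.2).
  exact: (measurableT_comp (measurable_rescaled_density hf rho) measurable_snd).
apply/integrableP; split.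
  by apply/measurable_EFinP; apply: measurable_funM => //; exact: measurable_ball_mass.
pose C := V * 2 ^+ d.
have C0 : 0 <= C by rewrite mulr_ge0.
have hC r : 0 < r -> (ball_power 1 mu r <= (C * r `^ d%:R)%:E)%E.
  move=> r0; rewrite /ball_power; under eq_integral do rewrite powRr1//.
  by rewrite /C -mulrA powR_mulrn ?(ltW r0)// -exprMn; exact/IV/ltW.
have hK (s : R) : 0 < s -> ~ set0 s -> s `^ d%:R <= 1 * s `^ d%:R by rewrite mul1r.
have := @far_integral_le _ _ _ 1 _ _ _ hf mu set0 d%:R C 1 rho measurable0 C0 ler01 rho0 hC hK.
rewrite setC0 => h; apply: (@le_lt_trans _ _ ((rho `^ (d%:R - beta) * (C * 1))%:E * radius_moment d f)%E).
  apply: le_trans h; rewrite le_eqVlt; apply/orP; left; apply/eqP.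
  apply: eq_integral => z _; rewrite /= indicT mulr1 powRr1// normrM ger0_norm//.
  exact: (rescaled_density_ge0 hf).
have [_ f0 _ _] := hf.
have mom : (0 <= radius_moment d f)%E.
  by apply: integral_ge0 => r _; rewrite lee_fin mulr_ge0 ?powR_ge0//; exact: pos_part_fun_ge0.
have mfin : radius_moment d f \is a fin_num by rewrite ge0_fin_numE// (radius_moment_lty hf).
by rewrite -(fineK mfin) -EFinM ltry.
Qed.

End ball_field.

(** Converts bounds on the exponents of a characteristic function into the bound on [E (1 - cos)]
    that [dyadic_moment_bound] expects. *)
Lemma one_sub_expR_cos_le (R : realType) (a c : R) : a <= 0 -> 1 - expR a * cos c <= `|a| + `|c|.
Proof.
move=> a0; have e1 : expR a <= 1 by rewrite expR_le1.
have e2 : 1 + a <= expR a by exact: expR_ge1Dx.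
have := norm_cosB1_le c; rewrite distrC => h.
have c1 : 0 <= 1 - cos c by rewrite subr_ge0 cos_le1.
rewrite (ger0_norm c1) in h.
have -> : 1 - expR a * cos c = (1 - expR a) + expR a * (1 - cos c) by ring.
rewrite (ler0_norm a0); apply: lerD; first by lra.
by apply: le_trans h; rewrite ler_piMl.
Qed.

(** Both ends of the half-line have a countable base of neighbourhoods, so limits can be tested
    along the positive sequences to which dominated convergence applies. *)
Lemma zero_pow_cvgP (R : realType) (eps : int) (g : R -> R) (l : R) :
  (forall rho : nat -> R, (forall n, 0 < rho n) -> rho @ \oo --> zero_pow eps ->
    g (rho n) @[n --> \oo] --> l) ->
  g rho @[rho --> zero_pow eps] --> l.
Proof.
rewrite /zero_pow; case: ifP => _ H.
  apply/cvg_at_rightP => v [v0 cv]; apply: H => //.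
  move=> S [e /= e0 he].
  have : \forall n \near \oo, `|0 - v n| < e by move/cvgrPdist_lt : cv; exact.
  by apply: filterS => n hn; apply: he.
apply/cvg_pinftyP => v cv.
(* A sequence tending to infinity may have nonpositive terms; it is changed only where it is below
   1, hence finitely often. *)
pose v' n := Num.max (v n) 1.
have v'0 n : 0 < v' n by rewrite lt_max ltr01 orbT.
have eqv : \forall n \near \oo, v n = v' n.
  have : \forall n \near \oo, 1 < v n by move/cvgryPgt : cv; exact.
  by apply: filterS => n hn; rewrite /v' max_l// ltW.
have cv' : v' @ \oo --> +oo.
  by apply: cvg_trans cv; apply: near_eq_cvg.
have := H _ v'0 cv'; apply: cvg_trans; apply: near_eq_cvg.
by apply: filterS eqv => n ->.
Qed.

Lemma measurable_weight_integral (R : realType) (G : probability (measurableTypeR R) R) (g : R -> R) :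
  measurable_fun setT g -> (forall x, `|g x| <= 1) ->
  measurable_fun setT (fun u : R => \int[G]_x g (u * x)).
Proof.
move=> mg g1.
have ig (u : R) : G.-integrable setT (EFin \o (fun x => g (u * x))).
  apply: (@bounded_integrable _ _ _ _ _ 1) => //.
  by apply: (measurableT_comp mg); exact: measurable_funM.
(* Adding 1 makes the integrand nonnegative, as measurability of parametrised integrals requires. *)
rewrite (_ : (fun u => _) = (fun u : R => \int[G]_x (1 + g (u * x)) - 1)).
  apply: measurable_funB => //; apply: (measurableT_comp (fine_measurable measurableT)).
  apply: (@measurable_fun_fubini_tonelli_F _ _ (measurableTypeR R) _ _ G
    (fun z : measurableTypeR R * measurableTypeR R => (1 + g (z.1 * z.2))%:E)).
    apply/measurable_EFinP; apply: measurable_funD => //; apply: (measurableT_comp mg).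
    by apply: measurable_funM; [exact: measurable_fst|exact: measurable_snd].
  by move=> z; rewrite lee_fin; have := g1 (z.1 * z.2); rewrite ler_norml => /andP[? _]; lra.
apply/funext => u; have i1 : G.-integrable setT (EFin \o (fun=> 1 : R)).
  by apply: (@bounded_integrable _ _ _ _ _ 1) => // w; rewrite normr1.
by rewrite (RintegralD measurableT i1 (ig u)) Rintegral_cst1 addrAC subrr add0r.
Qed.

Lemma measurable_weight_cos (R : realType) (G : probability (measurableTypeR R) R) :
  measurable_fun setT (weight_cos G).
Proof.
rewrite (_ : weight_cos G = fun u => \int[G]_x cos (u * x) - 1).
  apply: measurable_funB => //; apply: measurable_weight_integral; last exact: norm_cos_le1.
  exact: (continuous_measurable_fun (@continuous_cos R)).
apply/funext => u; rewrite /weight_cos.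
have i1 : G.-integrable setT (EFin \o (fun=> 1 : R)).
  by apply: (@bounded_integrable _ _ _ _ _ 1) => // w; rewrite normr1.
have ic : G.-integrable setT (EFin \o (fun x => cos (u * x))).
  apply: (@bounded_integrable _ _ _ _ _ 1); last by move=> x; exact: norm_cos_le1.
  by apply: measurable_cos_comp; exact: measurable_funM.
by rewrite (RintegralB measurableT ic i1) Rintegral_cst1.
Qed.

Lemma measurable_weight_sin (R : realType) (tau : R) (G : probability (measurableTypeR R) R) :
  measurable_fun setT (weight_sin tau G).
Proof.
apply: measurable_funB; last exact: measurable_funM.
apply: measurable_weight_integral; last exact: norm_sin_le1.
exact: (continuous_measurable_fun (@continuous_sin R)).
Qed.

Lemma Rintegral_le0 d (T : measurableType d) (R : realType) (m : {measure set T -> \bar R})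
    (g : T -> R) : (forall x, g x <= 0) -> \int[m]_x g x <= 0.
Proof.
move=> g0; rewrite /Rintegral fine_le0// integralE integral0_eq ?sub0e ?oppe_le0 ?integral_ge0//.
by move=> x _; rewrite funeposE; apply/max_idPr; rewrite lee_fin.
Qed.

Lemma weight_cos_le0 (R : realType) (G : probability (measurableTypeR R) R) (u : R) :
  weight_cos G u <= 0.
Proof.
by apply: Rintegral_le0 => x; rewrite subr_le0 cos_le1.
Qed.

(** * The normalisation *)

Section normalisation.
Context {R : realType}.
Variables (alpha beta lam rho : R).
Hypotheses (alpha1 : 1 < alpha) (lam0 : 0 < lam) (rho0 : 0 < rho).

Lemma normalisation_gt0 : 0 < lam `^ alpha^-1 * rho `^ (beta / alpha).
Proof. by rewrite mulr_gt0 ?powR_gt0. Qed.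

Lemma normalisation_powR : (lam `^ alpha^-1 * rho `^ (beta / alpha)) `^ alpha = lam * rho `^ beta.
Proof.
have a0 : alpha != 0 by rewrite gt_eqF// (lt_trans ltr01).
rewrite powRM ?powR_ge0// -!powRrM mulVf// powRr1 ?(ltW lam0)//.
by rewrite mulfVK.
Qed.

End normalisation.

(** With the power [alpha] of [u] equal to [lambda rho^beta], its divergence makes the arguments of
    [psi] small, where the expansion of the characteristic function is valid. *)
Lemma cvg_inv_normalisation (R : realType) (alpha : R) (u : nat -> R) : 1 < alpha ->
  (forall n, 0 < u n) -> u n `^ alpha @[n --> \oo] --> +oo ->
  (u n)^-1 @[n --> \oo] --> (0 : R).
Proof.
move=> alpha1 u0 cu; have a0 : alpha != 0 by rewrite gt_eqF// (lt_trans ltr01).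
apply/cvgrPdist_lt => e e0.
have : \forall n \near \oo, (e^-1) `^ alpha < u n `^ alpha by move/cvgryPgt : cu; exact.
apply: filterS => n h0.
have h : e^-1 < u n.
  rewrite ltNge; apply/negP => ue; move: h0; apply/negP; rewrite -leNgt.
  by rewrite ge0_ler_powR ?nnegrE ?invr_ge0 ?(ltW e0) ?(ltW (u0 n))// ltW// (lt_trans ltr01).
rewrite sub0r normrN gtr0_norm ?invr_gt0//.
by rewrite -[e]invrK ltf_pV2 ?posrE ?invr_gt0.
Qed.

(** * First moments of stable integrals *)

Section stable_moment.
Context d (T : measurableType d) d' (E : measurableType d') (R : realType).
Variables (P : probability T R) (alpha : R) (m : {measure set E -> \bar R}) (b : R).
Variable M : set E -> T -> R.
Hypotheses (alpha1 : 1 < alpha) (hM : stable_random_measure P alpha m b M).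
Variable I : (E -> R) -> T -> R.
Hypothesis hI : stable_integral P alpha m M I.

(** Scaling [f] by [th] multiplies both exponents by [th^alpha], so [E (1 - cos (th I f))] is of
    order [th^alpha] and the dyadic bound applies. The functional is used for a family of one
    function. *)
Lemma stable_integral_moment (f : E -> R) : Lalpha alpha m f ->
  exists B : R, (\int[P]_w (`|I f w|)%:E <= B%:E)%E.
Proof.
move=> Lf; have [K K0 hK] := dyadic_moment_bound alpha1.
have mI : measurable_fun setT (I f) by have [] := hI Lf.
set IF := \int[m]_z (`|f z| `^ alpha).
have IF0 : 0 <= IF by apply: Rintegral_ge0 => z _; exact: powR_ge0.
pose bt := b * tan (pi * alpha / 2).
pose C := (1 + `|bt|) * IF.
have C0 : 0 <= C by rewrite mulr_ge0// addr_ge0.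
exists (1 + K * C); apply: hK => // n.
set th : R := 2 ^- n; have th0 : 0 < th by rewrite invr_gt0 exprn_gt0.
have [Hc _] := stable_functional alpha1 hM hI (f := fun _ : 'I_1 => f) (fun=> th) (fun=> Lf).
rewrite /= in Hc.
have FE z : \sum_(j < 1) th * f z = th * f z by rewrite big_ord1.
have ia := Lalpha_integrable Lf.
have aE : \int[m]_z (`|\sum_(j < 1) th * f z| `^ alpha) = th `^ alpha * IF.
  rewrite -RintegralZl//; apply: eq_Rintegral => z _.
  by rewrite FE normrM (gtr0_norm th0) powRM ?(ltW th0).
have isg : m.-integrable setT (EFin \o (fun z => `|f z| `^ alpha * Num.sg (f z))).
  apply: le_integrable ia => //.
    have [mf _] := Lf.
    apply/measurable_EFinP; apply: measurable_funM; first exact: measurable_norm_powR.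
    exact: (measurableT_comp (@measurable_sgr R)).
  move=> z _; rewrite lee_fin normrM (ger0_norm (powR_ge0 _ _)) -[leRHS]mulr1 ler_wpM2l ?powR_ge0//.
  by rewrite normr_sg; case: (_ != _).
have cE : \int[m]_z (`|\sum_(j < 1) th * f z| `^ alpha * (b * Num.sg (\sum_(j < 1) th * f z) * tan (pi * alpha / 2))) =
    th `^ alpha * bt * \int[m]_z (`|f z| `^ alpha * Num.sg (f z)).
  rewrite -RintegralZl//; apply: eq_Rintegral => z _.
  by rewrite FE normrM (gtr0_norm th0) powRM ?(ltW th0)// sgrM (gtr0_sg th0) /bt; ring.
have cb : `|\int[m]_z (`|f z| `^ alpha * Num.sg (f z))| <= IF.
  apply: le_trans (le_normr_Rintegral measurableT isg) _.
  apply: le_Rintegral => //; first exact: (integrable_norm isg).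
  move=> z _; rewrite normrM (ger0_norm (powR_ge0 _ _)) -[leRHS]mulr1 ler_wpM2l ?powR_ge0//.
  by rewrite normr_sg; case: (_ != _).
have icos : P.-integrable setT (EFin \o (fun w => cos (th * I f w))).
  apply: (@bounded_integrable _ _ _ _ _ 1); last by move=> w; exact: norm_cos_le1.
  by apply: measurable_cos_comp; exact: measurable_funM.
have i1 : P.-integrable setT (EFin \o (fun=> 1 : R)).
  by apply: (@bounded_integrable _ _ _ _ _ 1) => // w; rewrite normr1.
rewrite (RintegralB measurableT i1 icos) Rintegral_cst1.
have -> : \int[P]_w cos (th * I f w) = \int[P]_w cos (\sum_(j < 1) th * I f w).
  by apply: eq_Rintegral => w _; rewrite big_ord1.
rewrite Hc (le_trans (one_sub_expR_cos_le _ _))//.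
  by rewrite oppr_le0 Rintegral_ge0// => z _; exact: powR_ge0.
rewrite aE cE normrN (normrM _ IF) (normrM (th `^ alpha * bt)) (normrM _ bt) (ger0_norm IF0) (ger0_norm (powR_ge0 _ _)).
have -> : C * th `^ alpha = th `^ alpha * IF + th `^ alpha * `|bt| * IF by rewrite /C; ring.
by rewrite lerD2l ler_wpM2l// mulr_ge0 ?powR_ge0.
Qed.

End stable_moment.

(** * The random balls field: characteristic function and moments *)

Section ball_field.
Context {R : realType} (d : nat) (eps : int) (alpha beta Cbeta sigma b tau : R) (f : R -> R).
Hypotheses (heps : eps = 1 \/ eps = -1) (alpha1 : 1 < alpha) (Cbeta0 : 0 < Cbeta).
Hypothesis hf : radius_density d eps beta Cbeta f.
Variable G : probability (measurableTypeR R) R.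
Hypothesis hG : normal_domain_of_attraction alpha sigma b tau G.

Local Notation leb := (@lebesgue_measure R).
Local Notation LL := (lebesgue_tuple d \x leb)%E.
Local Notation resc := (rescaled_density beta f).

Let mf : measurable_fun (`]0, +oo[%classic : set R) f. Proof. by have [] := hf. Qed.
Let f0 : forall r, 0 < r -> 0 <= f r. Proof. by have [] := hf. Qed.

Section fixed.
Variables (dO : measure_display) (Omega : measurableType dO) (P : probability Omega R).
Variable N : R.-ker Omega ~> (Rd R d * measurableTypeR R * measurableTypeR R)%type.
Variables (lambda rho : R).
Hypotheses (lambda0 : 0 < lambda) (rho0 : 0 < rho).
Hypothesis hN : poisson_random_measure P N (ball_intensity (d := d) lambda f rho G).

Let mh : measurable_fun setT (fun z : Rd R d * measurableTypeR R * measurableTypeR R =>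
  ball_density lambda f rho z.1).
Proof. exact: (measurableT_comp (measurable_ball_density lambda rho mf) measurable_fst). Qed.

Let h0 (z : Rd R d * measurableTypeR R * measurableTypeR R) : 0 <= ball_density lambda f rho z.1.
Proof. exact: ball_density_ge0. Qed.

Let LLs := product_sigma_finite (lebesgue_tuple d) leb.

Let hN' : poisson_random_measure P N (density_measure (LLs \x G)%E mh h0).
Proof.
rewrite (_ : (density_measure (LLs \x G)%E mh h0 : set _ -> \bar R) = ball_intensity (d := d) lambda f rho G); first exact: hN.
by apply/esym; exact: (ball_intensityE d lambda0 rho0 mf f0).
Qed.

Let ihF (mu : charge (Rd R d) R) : LL.-integrable setT
  (EFin \o (fun z : Rd R d * measurableTypeR R => ball_density lambda f rho z * ball_mass mu z)).
Proof.
have := integrableZl measurableT (lambda * rho `^ beta) (rescaled_ball_mass_integrable hf mu rho0).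
apply: eq_integrable => // z _ /=.
by rewrite (ball_densityE beta f lambda z rho0) -EFinM mulrA.
Qed.

Lemma measurable_ball_field mu : measurable_fun setT (ball_field N mu).
Proof. exact: (measurable_weighted_field N (measurable_ball_mass mu)). Qed.

Lemma ball_field_functional (mu : charge (Rd R d) R) (u : R) :
  let a := \int[LL]_z (ball_density lambda f rho z * weight_cos G (ball_mass mu z / u)) in
  let c := \int[LL]_z (ball_density lambda f rho z * weight_sin tau G (ball_mass mu z / u)) in
  \int[P]_w cos ((ball_field N mu w - fine 'E_P[ball_field N mu]) / u) = expR a * cos c /\
  \int[P]_w sin ((ball_field N mu w - fine 'E_P[ball_field N mu]) / u) = expR a * sin c.
Proof.
exact: (@weighted_field_functional _ _ R LLs G (weight_integrable alpha1 hG) (ball_density lambda f rho)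
  mh h0 _ _ P N hN' (ball_mass mu) u tau (measurable_ball_mass mu) (ihF mu) (weight_mean alpha1 hG)).
Qed.

Lemma ball_field_sum k (v : 'I_k -> charge (Rd R d) R) (t : 'I_k -> R) (mu : charge (Rd R d) R) (u : R) :
  (forall z, ball_mass mu z = \sum_i t i * ball_mass (v i) z) ->
  {ae P, forall w, \sum_i t i * ((ball_field N (v i) w - fine 'E_P[ball_field N (v i)]) / u) =
    (ball_field N mu w - fine 'E_P[ball_field N mu]) / u}.
Proof.
exact: (@weighted_field_sum _ _ R LLs G (weight_integrable alpha1 hG) (ball_density lambda f rho)
  mh h0 _ _ P N hN' k (fun i => ball_mass (v i)) t (ball_mass mu) u
  (fun i => measurable_ball_mass (v i)) (fun i => ihF (v i))).
Qed.

Variable mu : charge (Rd R d) R.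
Variable B : R.
Hypothesis hB : (\int[LL]_z (resc rho z.2 * `|ball_mass mu z| `^ alpha)%:E <= B%:E)%E.

Let B0 : 0 <= B.
Proof.
rewrite -lee_fin; apply: le_trans hB; apply: integral_ge0 => z _.
by rewrite lee_fin mulr_ge0 ?powR_ge0//; exact: (rescaled_density_ge0 hf).
Qed.

Let exponent_bound (psi : R -> R) (C q : R) : 0 < q -> 0 <= C -> measurable_fun setT psi ->
  (forall x, `|psi x| <= C * `|x| `^ alpha) ->
  `|\int[LL]_z (ball_density lambda f rho z * psi (ball_mass mu z / q))| <=
    C * (lambda * rho `^ beta) / q `^ alpha * B.
Proof.
move=> q0 C0 mpsi hpsi.
pose D := C * (lambda * rho `^ beta) / q `^ alpha.
have D0 : 0 <= D by rewrite divr_ge0 ?powR_ge0// !mulr_ge0 ?powR_ge0// ltW.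
pose g (z : Rd R d * measurableTypeR R) : R := resc rho z.2 * `|ball_mass mu z| `^ alpha.
have mg : measurable_fun setT g.
  apply: measurable_funM; last exact: measurable_ball_powR.
  exact: (measurableT_comp (measurable_rescaled_density hf rho) measurable_snd).
have g0 z : 0 <= g z by rewrite mulr_ge0 ?powR_ge0//; exact: (rescaled_density_ge0 hf).
have ig : LL.-integrable setT (EFin \o g).
  apply/integrableP; split; first exact/measurable_EFinP.
  under eq_integral do rewrite /= ger0_norm//.
  by apply: le_lt_trans hB _; exact: ltry.
have iDg : LL.-integrable setT (EFin \o (fun z => D * g z)) by exact: (integrableZl measurableT D ig).
pose h (z : Rd R d * measurableTypeR R) : R := ball_density lambda f rho z * psi (ball_mass mu z / q).
have mh' : measurable_fun setT h.
  apply: measurable_funM; first exact: (measurable_ball_density lambda rho mf).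
  apply: (measurableT_comp mpsi); apply: measurable_funM => //; exact: measurable_ball_mass.
have hD z : `|h z| <= D * g z.
  rewrite /h normrM (ger0_norm (ball_density_ge0 lambda0 rho0 f0 z)).
  apply: (@le_trans _ _ (ball_density lambda f rho z * (C * `|ball_mass mu z / q| `^ alpha))).
    by rewrite ler_wpM2l// ball_density_ge0.
  rewrite (ball_densityE beta f lambda z rho0) normrM normfV (gtr0_norm q0) powR_div ?(ltW q0)//.
  by rewrite le_eqVlt; apply/orP; left; apply/eqP; rewrite /D /g; ring.
have ih' : LL.-integrable setT (EFin \o h).
  apply: le_integrable iDg => //; first exact/measurable_EFinP.
  by move=> z _; rewrite lee_fin (le_trans (hD z))// ler_norm.
apply: le_trans (le_normr_Rintegral measurableT ih') _.
apply: (@le_trans _ _ (\int[LL]_z (D * g z))).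
  by apply: le_Rintegral => //; exact: (integrable_norm ih').
rewrite (RintegralZl _ measurableT ig) ler_wpM2l//.
have : (\int[LL]_z (g z)%:E)%E \is a fin_num by exact: (integrable_fin_num measurableT ig).
by rewrite -lee_fin /Rintegral => /fineK ->.
Qed.

(** As the power [alpha] of [u] is [lambda rho^beta], each exponent at the scale [th] is at most
    [Cw * B * th^alpha], with constants that do not involve [rho] except through [B]. [hK] is the
    conclusion of [dyadic_moment_bound], passed in so that a single [K] serves all [rho]. *)
Lemma ball_field_moment (K Cw u : R) :
  (forall (d : measure_display) (T : measurableType d) (P : probability T R) (X : T -> R) (C : R),
     measurable_fun setT X -> 0 <= C ->
     (forall n : nat, \int[P]_w (1 - cos (2 ^- n * X w)) <= C * (2 ^- n) `^ alpha) ->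
     (\int[P]_w (`|X w|)%:E <= (1 + K * C)%:E)%E) ->
  0 <= Cw -> (forall x, `|weight_cos G x| <= Cw * `|x| `^ alpha /\ `|weight_sin tau G x| <= Cw * `|x| `^ alpha) ->
  0 < u -> u `^ alpha = lambda * rho `^ beta ->
  (\int[P]_w (`|(ball_field N mu w - fine 'E_P[ball_field N mu]) / u|)%:E
     <= (1 + K * (2 * Cw * B))%:E)%E.
Proof.
move=> hK Cw0 hw u0 uE.
have mX : measurable_fun setT (fun w => (ball_field N mu w - fine 'E_P[ball_field N mu]) / u).
  by apply: measurable_funM => //; apply: measurable_funB => //; exact: measurable_ball_field.
apply: hK => //; first by rewrite !mulr_ge0.
move=> n; set th : R := 2 ^- n; have th0 : 0 < th by rewrite invr_gt0 exprn_gt0.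
(* Multiplying the normalised field by [th] amounts to normalising by [u / th]. *)
have [Hc _] := ball_field_functional mu (u / th).
have icos : P.-integrable setT (EFin \o (fun w => cos (th * ((ball_field N mu w - fine 'E_P[ball_field N mu]) / u)))).
  apply: (@bounded_integrable _ _ _ _ _ 1); last by move=> w; exact: norm_cos_le1.
  by apply: measurable_cos_comp; exact: measurable_funM.
have i1 : P.-integrable setT (EFin \o (fun=> 1 : R)).
  by apply: (@bounded_integrable _ _ _ _ _ 1) => // w; rewrite normr1.
rewrite (RintegralB measurableT i1 icos) Rintegral_cst1.
have -> : \int[P]_w cos (th * ((ball_field N mu w - fine 'E_P[ball_field N mu]) / u)) =
    \int[P]_w cos ((ball_field N mu w - fine 'E_P[ball_field N mu]) / (u / th)).
  by apply: eq_Rintegral => w _; congr cos; field; rewrite !gt_eqF.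
have q0 : 0 < u / th by rewrite divr_gt0.
rewrite Hc (le_trans (one_sub_expR_cos_le _ _))//.
  by apply: Rintegral_le0 => z; rewrite mulr_ge0_le0 ?weight_cos_le0//; exact: ball_density_ge0.
have qE : lambda * rho `^ beta / (u / th) `^ alpha = th `^ alpha.
  rewrite powR_div ?(ltW u0) ?(ltW th0)// uE; field.
  by rewrite !gt_eqF ?mulr_gt0 ?powR_gt0.
have := exponent_bound q0 Cw0 (measurable_weight_cos G) (fun x => (hw x).1).
have := exponent_bound q0 Cw0 (measurable_weight_sin tau G) (fun x => (hw x).2).
rewrite -!(mulrA Cw) qE => h2 h1; apply: le_trans (lerD h1 h2) _.
by rewrite le_eqVlt; apply/orP; left; apply/eqP; ring.
Qed.

End fixed.
End ball_field.

(** * The exponents of the limit *)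

Section stable_side.
Context {R : realType} (d : nat) (alpha beta Cbeta sigma : R).
Hypotheses (alpha1 : 1 < alpha) (Cbeta0 : 0 < Cbeta).

Local Notation leb := (@lebesgue_measure R).
Local Notation LL := (lebesgue_tuple d \x leb)%E.
Local Notation w := (pos_part_fun (fun r : R => r `^ (- 1 - beta))).
Local Notation m := (density_measure LL (measurable_stable_density alpha beta Cbeta sigma)
    (stable_density_ge0 alpha beta sigma Cbeta0)).

Lemma stable_density_posE (z : Rd R d * measurableTypeR R) :
  stable_density alpha beta Cbeta sigma z = sigma `^ alpha * Cbeta * w z.2.
Proof.
rewrite /stable_density; have [r0|r0] := ltP 0 z.2; first by rewrite !pos_part_funE.
by rewrite !pos_part_fun0// mulr0.
Qed.

Variable mu : charge (Rd R d) R.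
Hypothesis hmu : alpha_beta_space d alpha beta mu.

Let g (z : Rd R d * measurableTypeR R) : R := stable_density alpha beta Cbeta sigma z * `|ball_mass mu z| `^ alpha.

Let ig : LL.-integrable setT (EFin \o g).
Proof.
pose g' (z : Rd R d * measurableTypeR R) : R := w z.2 * `|ball_mass mu z| `^ alpha.
have w0 (r : R) : 0 <= w r by apply: pos_part_fun_ge0 => s _; exact: powR_ge0.
have ig' : LL.-integrable setT (EFin \o g').
  apply/integrableP; split.
    apply/measurable_EFinP; apply: measurable_funM; last exact: measurable_ball_powR.
    apply: (measurableT_comp _ measurable_snd); apply: measurable_pos_part_fun.
    by apply: (@measurable_funTS _ _ _ _ _ (fun r => r `^ _)); exact: measurable_powR.
  under eq_integral do rewrite /= ger0_norm ?mulr_ge0 ?powR_ge0//.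
  exact: ball_mass_integrable.
have := integrableZl measurableT (sigma `^ alpha * Cbeta) ig'.
by apply: eq_integrable => // z _ /=; rewrite -EFinM /g /g' stable_density_posE !mulrA.
Qed.

Lemma ball_mass_Lalpha : Lalpha alpha m (ball_mass mu).
Proof.
split; first exact: measurable_ball_mass.
rewrite ge0_integral_density_measure.
- have /integrableP[_] := ig; apply: le_lt_trans.
  rewrite le_eqVlt; apply/orP; left; apply/eqP; apply: eq_integral => z _.
  have gz : 0 <= g z.
    by rewrite mulr_ge0 ?powR_ge0//; exact: (stable_density_ge0 alpha beta sigma Cbeta0).
  by rewrite /= (ger0_norm gz) EFinM.
- by apply/measurable_EFinP; exact: measurable_ball_powR.
- by move=> z; rewrite lee_fin powR_ge0.
Qed.

(** Brings the real exponent of the stable integral to the form of the limit in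
    [rescaled_integral_cvg]; [stable_exponent_im] does so for the imaginary one. *)
Lemma stable_exponent_re :
  - (\int[m]_z (`|ball_mass mu z| `^ alpha)) =
  \int[LL]_z (Cbeta * w z.2 * - (sigma `^ alpha * `|ball_mass mu z| `^ alpha)).
Proof.
rewrite Rintegral_density_measure; last exact: measurable_ball_powR.
transitivity (-1 * \int[LL]_z g z); first by rewrite mulN1r.
rewrite -(RintegralZl _ measurableT ig); apply: eq_Rintegral => z _.
by rewrite /g stable_density_posE; ring.
Qed.

Lemma stable_exponent_im (b : R) :
  \int[m]_z (`|ball_mass mu z| `^ alpha * (b * Num.sg (ball_mass mu z) * tan (pi * alpha / 2))) =
  \int[LL]_z (Cbeta * w z.2 * (sigma `^ alpha * `|ball_mass mu z| `^ alpha * (b * Num.sg (ball_mass mu z) * tan (pi * alpha / 2)))).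
Proof.
rewrite Rintegral_density_measure.
  apply: eq_Rintegral => z _; rewrite stable_density_posE.
  by move: (tan _) => t; ring.
apply: measurable_funM; first exact: measurable_ball_powR.
apply: measurable_funM => //; apply: measurable_funM => //.
exact: (measurableT_comp (@measurable_sgr R) (measurable_ball_mass mu)).
Qed.

End stable_side.

(** * Convergence of the rescaled exponents *)

Section scaled_exponents.
Context {R : realType} (d : nat) (eps : int) (alpha beta Cbeta sigma b tau : R) (f : R -> R).
Hypotheses (heps : eps = 1 \/ eps = -1) (alpha1 : 1 < alpha) (Cbeta0 : 0 < Cbeta).
Hypothesis hf : radius_density d eps beta Cbeta f.
Variable G : probability (measurableTypeR R) R.
Hypothesis hG : normal_domain_of_attraction alpha sigma b tau G.
Variables (lambda rho u : nat -> R).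
Hypotheses (rho0 : forall n, 0 < rho n) (u0 : forall n, 0 < u n).
Hypothesis uE : forall n, u n `^ alpha = lambda n * rho n `^ beta.
Hypotheses (crho : rho @ \oo --> zero_pow (- eps)) (cu : (u n)^-1 @[n --> \oo] --> (0 : R)).
Variable mu : charge (Rd R d) R.
Hypothesis hmu : alpha_beta_space d alpha beta mu.

Local Notation leb := (@lebesgue_measure R).
Local Notation LL := (lebesgue_tuple d \x leb)%E.
Local Notation w := (pos_part_fun (fun r : R => r `^ (- 1 - beta))).

(** Matches the convergence of the weights, stated for a sequence [s n] tending to 0, with the form
    in which [rescaled_integral_cvg] takes it, for [s n = (u n)^-1]. *)
Let rescale (psi L : R -> R) :
  (forall x, psi ((u n)^-1 * x) / (u n)^-1 `^ alpha @[n --> \oo] --> L x) ->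
  forall x, u n `^ alpha * psi (x / u n) @[n --> \oo] --> L x.
Proof.
move=> h x; have := h x; apply: cvg_trans; apply: near_eq_cvg; apply: nearW => n.
rewrite (mulrC x) [RHS]mulrC; congr (_ * _).
by rewrite -(div1r (u n)) powR_div ?(ltW (u0 n))// powR1 div1r invrK.
Qed.

Lemma scaled_exponent_re :
  \int[LL]_z (ball_density (lambda n) f (rho n) z * weight_cos G (ball_mass mu z / u n)) @[n --> \oo]
  --> \int[LL]_z (Cbeta * w z.2 * - (sigma `^ alpha * `|ball_mass mu z| `^ alpha)).
Proof.
have [C C0 hC] := weight_bound alpha1 hG.
have ui0 n : 0 < (u n)^-1 by rewrite invr_gt0.
have h := @rescaled_integral_cvg _ d eps alpha beta Cbeta f heps alpha1 Cbeta0 hf mu hmu rho u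
  (weight_cos G) (fun x => - (sigma `^ alpha * `|x| `^ alpha)) C rho0 u0 crho
  (measurable_weight_cos G) _ C0 (fun x => (hC x).1)
  (rescale (fun x => @weight_cos_cvg _ _ _ _ _ _ alpha1 hG _ x ui0 cu)).
rewrite (_ : (fun n => _) = (fun n => \int[LL]_z (rescaled_density beta f (rho n) z.2 *
   (u n `^ alpha * weight_cos G (ball_mass mu z / u n))))).
  apply: h; apply: measurableT_comp => //; apply: measurable_funM => //.
  exact: measurable_norm_powR.
apply/funext => n; apply: eq_Rintegral => z _.
by rewrite (ball_densityE beta f (lambda n) z (rho0 n)) uE; ring.
Qed.

Lemma scaled_exponent_im :
  \int[LL]_z (ball_density (lambda n) f (rho n) z * weight_sin tau G (ball_mass mu z / u n)) @[n --> \oo]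
  --> \int[LL]_z (Cbeta * w z.2 * (sigma `^ alpha * `|ball_mass mu z| `^ alpha *
        (b * Num.sg (ball_mass mu z) * tan (pi * alpha / 2)))).
Proof.
have [C C0 hC] := weight_bound alpha1 hG.
have ui0 n : 0 < (u n)^-1 by rewrite invr_gt0.
have h := @rescaled_integral_cvg _ d eps alpha beta Cbeta f heps alpha1 Cbeta0 hf mu hmu rho u
  (weight_sin tau G) (fun x => sigma `^ alpha * `|x| `^ alpha * (b * Num.sg x * tan (pi * alpha / 2))) C rho0 u0 crho
  (measurable_weight_sin tau G) _ C0 (fun x => (hC x).2)
  (rescale (fun x => @weight_sin_cvg _ _ _ _ _ _ alpha1 hG _ x ui0 cu)).
rewrite (_ : (fun n => _) = (fun n => \int[LL]_z (rescaled_density beta f (rho n) z.2 *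
   (u n `^ alpha * weight_sin tau G (ball_mass mu z / u n))))).
  apply: h; apply: measurable_funM.
    by apply: measurable_funM => //; exact: measurable_norm_powR.
  apply: measurable_funM => //; apply: measurable_funM => //; exact: measurable_sgr.
apply/funext => n; apply: eq_Rintegral => z _.
by rewrite (ball_densityE beta f (lambda n) z (rho0 n)) uE; ring.
Qed.

End scaled_exponents.

(** * Finite-dimensional convergence of the rescaled field *)

Lemma cvg_eq_limit (R : realType) (g : nat -> R) (x y : R) :
  x = y -> g @ \oo --> x -> g @ \oo --> y.
Proof. by move=> ->. Qed.

Theorem theorem2p4 (R : realType) (d : nat) (hd : (1 <= d)%N)
  (eps : int) (heps : eps = 1 \/ eps = -1)
  (alpha beta Cbeta sigma b tau : R)
  (halpha : 1 < alpha <= 2) (hbeta : 0 < beta) (hCbeta : 0 < Cbeta)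
  (hsigma : 0 < sigma) (hb : -1 <= b <= 1)
  (f : R -> R) (hf : radius_density d eps beta Cbeta f)
  (G : probability (measurableTypeR R) R)
  (hG : normal_domain_of_attraction alpha sigma b tau G)
  (lambda : R -> R) (hlambda : forall rho : R, 0 < rho -> 0 < lambda rho)
  (hlambda_oo : lambda rho * rho `^ beta @[rho --> zero_pow (- eps)] --> +oo)
  (dO : measure_display) (Omega : R -> measurableType dO)
  (P : forall rho : R, probability (Omega rho) R)
  (N : forall rho : R, R.-ker (Omega rho) ~>
         (Rd R d * measurableTypeR R * measurableTypeR R)%type)
  (hN : forall rho : R, 0 < rho ->
     poisson_random_measure (P rho) (N rho)
       (ball_intensity (d := d) (lambda rho) f rho G))
  (dO' : measure_display) (Omega' : measurableType dO')
  (P' : probability Omega' R)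
  (M : set (Rd R d * measurableTypeR R)%type -> Omega' -> R)
  (hM : stable_random_measure P' alpha
          (stable_control d alpha beta Cbeta sigma) b M)
  (I : (Rd R d * measurableTypeR R -> R) -> Omega' -> R)
  (hI : stable_integral P' alpha
          (stable_control d alpha beta Cbeta sigma) M I) :
  fdd_cvg P P' (zero_pow (- eps)) (alpha_beta_space d alpha beta)
    (fun rho mu w =>
       (ball_field (N rho) mu w - fine 'E_(P rho)[ball_field (N rho) mu])
         / (lambda rho `^ alpha^-1 * rho `^ (beta / alpha)))
    (fun mu => I (ball_mass mu)).
Proof.
have /andP[alpha1 _] := halpha.
rewrite (stable_controlE d alpha beta sigma hCbeta) in hM hI.
move=> k v abv.
pose u (rho : R) : R := lambda rho `^ alpha^-1 * rho `^ (beta / alpha).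
have u0 rho : 0 < rho -> 0 < u rho.
  by move=> rho0; apply: normalisation_gt0 => //; exact: hlambda.
have uE rho : 0 < rho -> u rho `^ alpha = lambda rho * rho `^ beta.
  by move=> rho0; apply: normalisation_powR => //; exact: hlambda.
have Lv i : Lalpha alpha (density_measure (lebesgue_tuple d \x @lebesgue_measure R)%E
    (measurable_stable_density alpha beta Cbeta sigma)
    (stable_density_ge0 alpha beta sigma hCbeta)) (ball_mass (v i)).
  exact: ball_mass_Lalpha.
have mI i : measurable_fun setT (I (ball_mass (v i))) by have [] := hI _ (Lv i).
pose X rho (w : Omega rho) i : R :=
  (ball_field (N rho) (v i) w - fine 'E_(P rho)[ball_field (N rho) (v i)]) / u rho.
have mX rho i : measurable_fun setT (fun w => X rho w i).
  by apply: measurable_funM => //; apply: measurable_funB => //; exact: measurable_ball_field.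
have [Bs hBs] := choice (fun i => stable_integral_moment alpha1 hM hI (Lv i)).
have [K K0 hK] := dyadic_moment_bound alpha1.
have [Cw Cw0 hw] := weight_bound alpha1 hG.
have [Bb hBb] := choice (fun i => rescaled_integral_bound heps alpha1 hCbeta hf (abv i)).
(* One constant for both moment hypotheses of [levy_continuity]: [Bs] for the limit, the other terms
   for the field. The absolute values make each term at most the sum. *)
pose B := \sum_i (`|Bs i| + `|1 + K * (2 * Cw * Bb i)|).
have leB i : `|Bs i| <= B /\ `|1 + K * (2 * Cw * Bb i)| <= B.
  rewrite /B (bigD1 i)//=; set S := \sum_(j | _) _.
  have S0 : 0 <= S by apply: sumr_ge0 => j _; rewrite addr_ge0.
  by split; rewrite -addrA ?lerDl ?addr_ge0// addrCA lerDl addr_ge0.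
apply: (@levy_continuity R R (zero_pow (- eps)) _ _ Omega P _ _ P' k X
  (fun w i => I (ball_mass (v i)) w) B mX mI).
- have allB : \forall rho \near zero_pow (- eps), forall i,
     (\int[(lebesgue_tuple d \x @lebesgue_measure R)%E]_z
       (rescaled_density beta f rho z.2 * `|ball_mass (v i) z| `^ alpha)%:E <= (Bb i)%:E)%E.
    by apply: filter_forall => i; exact: hBb.
  apply: filterS2 allB (zero_powN_gt0 (- eps)) => rho hB rho0 i.
  apply: (le_trans (ball_field_moment alpha1 hf hG (hlambda _ rho0) rho0 (hN _ rho0) (hB i) hK Cw0 hw (u0 _ rho0) (uE _ rho0))).
  by rewrite lee_fin (le_trans (ler_norm _))//; have [] := leB i.
- move=> i; apply: le_trans (hBs i) _.
  by rewrite lee_fin (le_trans (ler_norm _))//; have [] := leB i.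
(* The Cramer-Wold step: pairing with [t] reduces to the field at one measure [mu] of the space. *)
all: move=> t; have [mu abmu muE] := alpha_beta_space_sum alpha1 hbeta t abv.
all: have [Hc Hs] := stable_functional alpha1 hM hI t Lv.
all: apply: zero_pow_cvgP => r r0 cr.
all: have cua : u (r n) `^ alpha @[n --> \oo] --> +oo by
  rewrite (_ : (fun n => _) = (fun n => lambda (r n) * r n `^ beta));
  [exact: (cvg_comp _ _ cr hlambda_oo)|apply/funext => n; exact: uE].
all: have cu := cvg_inv_normalisation alpha1 (fun n => u0 _ (r0 n)) cua.
all: have cre := scaled_exponent_re heps alpha1 hCbeta hf hG r0 (fun n => u0 _ (r0 n)) (fun n => uE _ (r0 n)) cr cu abmu.
all: have cim := scaled_exponent_im heps alpha1 hCbeta hf hG r0 (fun n => u0 _ (r0 n)) (fun n => uE _ (r0 n)) cr cu abmu.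
(* The limits of the exponents are recognised as those that [stable_functional] gives for the stable
   integral. *)
all: rewrite -(@stable_exponent_re R d alpha beta Cbeta sigma hCbeta mu abmu) in cre.
all: rewrite -(@stable_exponent_im R d alpha beta Cbeta sigma hCbeta mu b) in cim.
all: have EX n : {ae P (r n), forall w, pairing t (X (r n) w) =
    (ball_field (N (r n)) mu w - fine 'E_(P (r n))[ball_field (N (r n)) mu]) / u (r n)} by
  exact: (ball_field_sum alpha1 hf hG (hlambda _ (r0 n)) (r0 n) (hN _ (r0 n)) (u (r n)) muE).
all: have mp n : measurable_fun setT (fun w => pairing t (X (r n) w)) by
  apply: measurable_sum => i; exact: measurable_funM.
all: have mZ n : measurable_fun setT (fun w : Omega (r n) =>
    (ball_field (N (r n)) mu w - fine 'E_(P (r n))[ball_field (N (r n)) mu]) / u (r n)) by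
  apply: measurable_funM => //; apply: measurable_funB => //; exact: measurable_ball_field.
all: have HX n := ball_field_functional alpha1 hf hG (hlambda _ (r0 n)) (r0 n) (hN _ (r0 n)) mu (u (r n)).
all: pose a_ n := \int[(lebesgue_tuple d \x @lebesgue_measure R)%E]_z
  (ball_density (lambda (r n)) f (r n) z * weight_cos G (ball_mass mu z / u (r n))).
all: pose c_ n := \int[(lebesgue_tuple d \x @lebesgue_measure R)%E]_z
  (ball_density (lambda (r n)) f (r n) z * weight_sin tau G (ball_mass mu z / u (r n))).
- have -> : (fun n => \int[P (r n)]_w cos (pairing t (X (r n) w))) = (fun n => expR (a_ n) * cos (c_ n)).
    apply/funext => n; rewrite -[RHS](HX n).1; apply: ae_eq_Rintegral.
    + exact: measurable_cos_comp.
    + exact: measurable_cos_comp.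
    + by apply: filterS (EX n) => w ->.
  apply: (cvg_eq_limit (esym Hc)).
  apply: (cvg_eq_limit _ (cvgM (continuous_cvg _ (@continuous_expR R _) cre)
    (continuous_cvg _ (@continuous_cos R _) cim))).
  by rewrite (funext muE : ball_mass mu = _).
- have -> : (fun n => \int[P (r n)]_w sin (pairing t (X (r n) w))) = (fun n => expR (a_ n) * sin (c_ n)).
    apply/funext => n; rewrite -[RHS](HX n).2; apply: ae_eq_Rintegral.
    + exact: measurable_sin_comp.
    + exact: measurable_sin_comp.
    + by apply: filterS (EX n) => w ->.
  apply: (cvg_eq_limit (esym Hs)).
  apply: (cvg_eq_limit _ (cvgM (continuous_cvg _ (@continuous_expR R _) cre)
    (continuous_cvg _ (@continuous_sin R _) cim))).
  by rewrite (funext muE : ball_mass mu = _).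
Qed.
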